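(* Let $M\subset\mathrm{Sp}(4,\mathbb{Z})$ be the monodromy group $Mon(\mathcal{P}_{\mathbf{250}})$ of the double octic orphan operator $\mathbf{250}$ in a symplectic basis, i.e. the subgroup generated by the four matrices $$ \begin{pmatrix}1&0&0&0\\0&1&0&8\\0&0&1&0\\0&0&0&1\end{pmatrix},\quad \begin{pmatrix}-1&0&0&0\\0&1&0&4\\-2&0&-1&0\\0&-1&0&-3\end{pmatrix},\quad \begin{pmatrix}1&-2&-8&12\\-6&-5&-12&0\\2&3&9&-6\\1&2&6&-5\end{pmatrix},\quad \begin{pmatrix}5&4&4&8\\8&9&8&16\\-4&-4&-3&-8\\-4&-4&-4&-7\end{pmatrix}. $$ Then $M$ is arithmetic and its index is $$[\mathrm{Sp}(4,\mathbb{Z}):M]=23592960=2^{19}\cdot 3^2\cdot 5.$$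
   Context: $\mathrm{Sp}(4,\mathbb{Z})$ is the group of integral $4\times4$ matrices preserving the alternating form with Gram matrix $\Omega=\begin{pmatrix}0&\mathrm{Id}_2\\-\mathrm{Id}_2&0\end{pmatrix}$. A finitely generated Zariski-dense subgroup $G\subset\mathrm{Sp}(4,\mathbb{Z})$ is called arithmetic if $[\mathrm{Sp}(4,\mathbb{Z}):G]<\infty$. Origin of the group: with $\Theta=t\frac{d}{dt}$, the operator is $$\mathcal{P}_{\mathbf{250}}=\Theta(\Theta-1)(\Theta-\tfrac12)^2+\tfrac18t\,\Theta(44\Theta^3-96\Theta^2+65\Theta-12)+t^2\big(\tfrac{19}2\Theta^4-23\Theta^3+\tfrac{131}8\Theta^2-\tfrac{47}8\Theta-\tfrac14\big)$$ $$+t^3\big(\tfrac52\Theta^4-20\Theta^3-\tfrac{23}4\Theta-\tfrac{17}{32}\big)-\tfrac1{32}t^4(68\Theta^2+100\Theta+53)(2\Theta+1)^2-\tfrac14t^5(8\Theta^2+14\Theta+9)(2\Theta+1)^2-\tfrac18t^6(2\Theta+3)^2(2\Theta+1)^2,$$ the Picard-Fuchs operator of a one-parameter family of Calabi-Yau threefolds. Its local monodromies at $t=1,\infty,-1,-2$, which generate the monodromy group, are (as determined numerically) the four matrices of the claim, in this order, with respect to a suitable symplectic basis of the solution space; the monodromy group is understood as the group generated by these matrices. *)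

(* Defs.v *)
(* Loaded before ssrnat, which gives N_scope the delimiter %num. *)
From Stdlib Require Import BinNat.
From mathcomp Require Import all_boot all_order all_algebra.
From mathcomp Require Import boolp classical_sets functions cardinality reals.
From mathcomp Require Import complex.
From mathcomp Require mpoly.

Set Implicit Arguments.
Unset Strict Implicit.
Unset Printing Implicit Defensive.

Import GRing.Theory.

Local Open Scope classical_set_scope.
Local Open Scope ring_scope.

Definition sympl_form (K : comNzRingType) : 'M[K]_4 :=
  block_mx (0 : 'M_2) 1%:M (- 1%:M) 0.

Definition Sp4 (K : comNzRingType) : set 'M[K]_4 :=
  [set A | A^T *m sympl_form K *m A = sympl_form K].
Arguments Sp4 K : clear implicits.

Section MatrixGroups.
Variables (K : comUnitRingType) (n : nat).
Implicit Types G H S : set 'M[K]_n.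

Definition mx_subgroup H : Prop :=
  [/\ H `<=` [set A | A \in unitmx],
      H 1%:M,
      forall A B, H A -> H B -> H (A *m B)
    & forall A, H A -> H (invmx A)].

(* Only meaningful when S consists of invertible matrices: otherwise no
   subgroup contains S and the intersection is the set of all matrices. *)
Definition mx_generated S : set 'M[K]_n := smallest mx_subgroup S.

Definition mx_finitely_generated G : Prop :=
  exists S, [/\ finite_set S, S `<=` G & G = mx_generated S].

Definition left_cosets G H : set (set 'M[K]_n) :=
  [set [set g *m h | h in H] | g in G].

(* [G : H] = k *)
Definition mx_index G H (k : nat) : Prop := (left_cosets G H #= `I_k)%card.

End MatrixGroups.

(* Closure in the affine space of n x n matrices, for the polynomials in the
   n * n entries. *)
Definition zariski_closure (K : fieldType) (n : nat) (S : set 'M[K]_n) :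
    set 'M[K]_n :=
  [set A | forall p : mpoly.mpoly (n * n) K,
     (forall B, S B -> mpoly.meval (mxvec B ord0) p = 0) ->
     mpoly.meval (mxvec A ord0) p = 0].

(* Density of the integral matrices G in the algebraic group Sp(4), on its
   K-points. *)
Definition zariski_dense_Sp4 (K : fieldType) (G : set 'M[int]_4) : Prop :=
  Sp4 K `<=` zariski_closure [set map_mx intr A | A in G].

Definition arithmetic_Sp4Z (R : realType) (G : set 'M[int]_4) : Prop :=
  [/\ mx_subgroup G /\ G `<=` Sp4 int,
      mx_finitely_generated G,
      zariski_dense_Sp4 R[i] G
    & finite_set (left_cosets (Sp4 int) G)].

Definition mx4_of_rows (s : seq (seq int)) : 'M[int]_4 :=
  \matrix_(i < 4, j < 4) (nth [::] s i)`_j.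

(* Local monodromies of the operator 250 at t = 1, oo, -1, -2. *)
Definition T_1 : 'M[int]_4 := mx4_of_rows
  [:: [:: 1; 0; 0; 0];
      [:: 0; 1; 0; 8];
      [:: 0; 0; 1; 0];
      [:: 0; 0; 0; 1] ]%Z.

Definition T_oo : 'M[int]_4 := mx4_of_rows
  [:: [:: -1; 0; 0; 0];
      [:: 0; 1; 0; 4];
      [:: -2; 0; -1; 0];
      [:: 0; -1; 0; -3] ]%Z.

Definition T_m1 : 'M[int]_4 := mx4_of_rows
  [:: [:: 1; -2; -8; 12];
      [:: -6; -5; -12; 0];
      [:: 2; 3; 9; -6];
      [:: 1; 2; 6; -5] ]%Z.

Definition T_m2 : 'M[int]_4 := mx4_of_rows
  [:: [:: 5; 4; 4; 8];
      [:: 8; 9; 8; 16];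
      [:: -4; -4; -3; -8];
      [:: -4; -4; -4; -7] ]%Z.

Definition Mon250 : set 'M[int]_4 :=
  mx_generated [set T_1; T_oo; T_m1; T_m2].

(* Main.v *)
Require Import Defs.
From Stdlib Require Import BinNat.
From Stdlib Require Import ZArith Lia Setoid Morphisms.
From Stdlib Require Znumtheory Zpow_facts.
From mathcomp Require Import all_boot all_order all_algebra.
From mathcomp Require Import boolp classical_sets functions cardinality reals.
From mathcomp Require Import complex.
From HB Require Import structures.
From mathcomp Require Import ssrZ zify.
From mathcomp Require mpoly.
Import -(notations) mpoly.

(** Let G be the group of integral symplectic matrices, M the monodromy group,
    and let [tw w n] be the transvection power x |-> x + n <w, x> w.  [EE n] is
    the subgroup generated by all [tw w n], which is normal in G, and [Gam n] is
    the principal congruence subgroup of level n; [EE n] lies in [Gam n].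

    The index is computed by locating M between [Gam 32] and G.

    First, M contains [EE (2 * 64 ^ 4)].  Two of the four generators are powers of
    transvections, of exponents 8 and 4, so M contains the corresponding powers of
    the transvections of all vectors in two of its orbits.  A dozen vectors of
    these orbits, reached by explicit words, produce the 64-th powers of enough root
    elements with respect to a symplectic basis ([HF_roots]).  From root elements
    of exponent n one builds, for every w = (a, b, c, d), two elements whose
    commutator is the transvection power of w with exponent 2 n^4 c^4; as c may be
    replaced by any coordinate and fourth powers of coprime integers are coprime,
    all transvections with exponent 2 n^4 are obtained ([root_elements_EE]).

    Secondly, [Gam N] = [EE N] when N > 1 is a power of 2 ([Gam_EE_pow2]); for
    the purposes of this theorem, this replaces the congruence subgroup property.
    By induction it suffices to bound EE N / EE (2 N) by the order 2^10 of
    Gam N / Gam (2 N), and this follows once [tw w N] modulo [EE (2 N)] is known to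
    depend only on w modulo 2.  Dependence modulo 4 holds for every even N; the
    difference between 4 and 2 is measured by one element of order at most 2,
    which explicit identities kill for N = 2 and N = 4, and squaring transfers its
    triviality from N to 2 N ([layer_split_pow2]).  The initial case Gam 2 = EE 2
    is a Euclidean algorithm with even quotients ([Gam2_EE2]).

    As 2 * 64 ^ 4 is a power of 2, M contains a principal congruence subgroup of
    2-power level.  Squaring maps each layer Gam N / Gam (2 N) onto the next when
    4 divides N, and M contains ten elements spanning the layer N = 32, hence M
    contains [Gam 32] ([Gam32_Mon]).  Modulo [Gam 32], M is a group of order 2^25,
    given by an explicit polycyclic sequence whose consistency is a computation
    with matrices modulo 32 ([Mon_layered], [layered_transversal]), while G has
    order 720 * 2^40 because Sp(4, Z / 2) has order 720 and each of the layers
    2, 4, 8, 16 has order 2^10.  Lagrange's theorem gives the index ([Mon_index]).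

    For density, a polynomial vanishing on M has zeros at the products of
    [tw w (2 * 64 ^ 4 * n)] by elements of M for all natural numbers n and
    coordinates of w.  A polynomial in one variable vanishing at all natural
    numbers is zero, so, one variable after the other, the coordinates of w and
    the exponent may be replaced by arbitrary scalars: the Zariski closure of M is
    stable under all transvections over the field ([preserves_all]), and these
    generate the symplectic group ([transvections_generate]). *)

Set Implicit Arguments.
Unset Strict Implicit.
Unset Printing Implicit Defensive.

Delimit Scope Z_scope with Z.

Local Arguments Z.mul : simpl never.
Local Arguments Z.add : simpl never.
Local Arguments Z.sub : simpl never.
Local Arguments Z.opp : simpl never.

Local Open Scope Z_scope.

(** * The symplectic group over the integers *)

(** With sixteen separate entries in the binary integers, an equality of
    explicit matrices is sixteen equalities of integers, left to [ring] or to
    fast computation. *)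
Record mat := Mat {
  m00 : Z; m01 : Z; m02 : Z; m03 : Z;
  m10 : Z; m11 : Z; m12 : Z; m13 : Z;
  m20 : Z; m21 : Z; m22 : Z; m23 : Z;
  m30 : Z; m31 : Z; m32 : Z; m33 : Z }.

Definition mat_mul (A B : mat) : mat :=
  let: Mat a00 a01 a02 a03 a10 a11 a12 a13 a20 a21 a22 a23 a30 a31 a32 a33
    := A in
  let: Mat b00 b01 b02 b03 b10 b11 b12 b13 b20 b21 b22 b23 b30 b31 b32 b33
    := B in
  Mat (a00 * b00 + a01 * b10 + a02 * b20 + a03 * b30)
      (a00 * b01 + a01 * b11 + a02 * b21 + a03 * b31)
      (a00 * b02 + a01 * b12 + a02 * b22 + a03 * b32)
      (a00 * b03 + a01 * b13 + a02 * b23 + a03 * b33)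
      (a10 * b00 + a11 * b10 + a12 * b20 + a13 * b30)
      (a10 * b01 + a11 * b11 + a12 * b21 + a13 * b31)
      (a10 * b02 + a11 * b12 + a12 * b22 + a13 * b32)
      (a10 * b03 + a11 * b13 + a12 * b23 + a13 * b33)
      (a20 * b00 + a21 * b10 + a22 * b20 + a23 * b30)
      (a20 * b01 + a21 * b11 + a22 * b21 + a23 * b31)
      (a20 * b02 + a21 * b12 + a22 * b22 + a23 * b32)
      (a20 * b03 + a21 * b13 + a22 * b23 + a23 * b33)
      (a30 * b00 + a31 * b10 + a32 * b20 + a33 * b30)
      (a30 * b01 + a31 * b11 + a32 * b21 + a33 * b31)
      (a30 * b02 + a31 * b12 + a32 * b22 + a33 * b32)
      (a30 * b03 + a31 * b13 + a32 * b23 + a33 * b33).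

Definition mat1 : mat := Mat 1 0 0 0  0 1 0 0  0 0 1 0  0 0 0 1.

(** The adjoint for the symplectic form, which is the inverse of a symplectic
    matrix. *)
Definition mat_adj (A : mat) : mat :=
  let: Mat a00 a01 a02 a03 a10 a11 a12 a13 a20 a21 a22 a23 a30 a31 a32 a33
    := A in
  Mat a22 a32 (- a02) (- a12)
      a23 a33 (- a03) (- a13)
      (- a20) (- a30) a00 a10
      (- a21) (- a31) a01 a11.

Definition mat_seq (A : mat) : seq Z :=
  let: Mat a00 a01 a02 a03 a10 a11 a12 a13 a20 a21 a22 a23 a30 a31 a32 a33
    := A in
  [:: a00; a01; a02; a03; a10; a11; a12; a13;
      a20; a21; a22; a23; a30; a31; a32; a33].

Definition seq_mat (s : seq Z) : mat :=
  let e := nth 0 s in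
  (Mat (e 0) (e 1) (e 2) (e 3) (e 4) (e 5) (e 6) (e 7)
       (e 8) (e 9) (e 10) (e 11) (e 12) (e 13) (e 14) (e 15))%N.

Lemma mat_seqK : cancel mat_seq seq_mat. Proof. by case. Qed.

HB.instance Definition _ := Countable.copy mat (can_type mat_seqK).

Lemma Mat_eq a0 a1 a2 a3 a4 a5 a6 a7 a8 a9 a10 a11 a12 a13 a14 a15 b0 b1 b2 b3 b4 b5 b6 b7 b8 b9 b10 b11 b12 b13 b14 b15 :
  a0 = b0 -> a1 = b1 -> a2 = b2 -> a3 = b3 ->
  a4 = b4 -> a5 = b5 -> a6 = b6 -> a7 = b7 ->
  a8 = b8 -> a9 = b9 -> a10 = b10 -> a11 = b11 ->
  a12 = b12 -> a13 = b13 -> a14 = b14 -> a15 = b15 ->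
  Mat a0 a1 a2 a3 a4 a5 a6 a7 a8 a9 a10 a11 a12 a13 a14 a15
  = Mat b0 b1 b2 b3 b4 b5 b6 b7 b8 b9 b10 b11 b12 b13 b14 b15.
Proof. by do 16!move=> ->. Qed.

Lemma mat_mulA : associative mat_mul.
Proof.
case=> ? ? ? ? ? ? ? ? ? ? ? ? ? ? ? ? [] ? ? ? ? ? ? ? ? ? ? ? ? ? ? ? ?.
by case=> ? ? ? ? ? ? ? ? ? ? ? ? ? ? ? ?; rewrite /=; apply: Mat_eq; ring.
Qed.

Lemma mat_mul1 : left_id mat1 mat_mul.
Proof. by case=> * ; rewrite /=; apply: Mat_eq; ring. Qed.

Lemma mat_mulr1 : right_id mat1 mat_mul.
Proof. by case=> * ; rewrite /=; apply: Mat_eq; ring. Qed.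

Lemma mat_adjM A B : mat_adj (mat_mul A B) = mat_mul (mat_adj B) (mat_adj A).
Proof. by case: A B => ? ? ? ? ? ? ? ? ? ? ? ? ? ? ? ? [] *; rewrite /=; apply: Mat_eq; ring. Qed.

Lemma mat_adjK : involutive mat_adj.
Proof. by case=> *; rewrite /= !Z.opp_involutive. Qed.

(** Stated through the adjoint, and on both sides, so that inverses need no
    argument about determinants. *)
Definition symplectic (A : mat) : bool :=
  (mat_mul (mat_adj A) A == mat1) && (mat_mul A (mat_adj A) == mat1).

Record Sp := MkSp { sp_mat :> mat; sp_matP : symplectic sp_mat }.

HB.instance Definition _ := [isSub for sp_mat].
HB.instance Definition _ := [Countable of Sp by <:].

Lemma symplectic1 : symplectic mat1. Proof. by []. Qed.

Lemma symplecticM A B : symplectic A -> symplectic B -> symplectic (mat_mul A B).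
Proof.
case/andP=> /eqP A1 /eqP A2 /andP[/eqP B1 /eqP B2].
rewrite /symplectic mat_adjM; apply/andP; split; apply/eqP.
  by rewrite -mat_mulA (mat_mulA (mat_adj A) A) A1 mat_mul1.
by rewrite -mat_mulA (mat_mulA B) B2 mat_mul1.
Qed.

Lemma symplecticV A : symplectic A -> symplectic (mat_adj A).
Proof. by rewrite /symplectic mat_adjK andbC. Qed.

Definition Sp_mul (g h : Sp) := MkSp (symplecticM (sp_matP g) (sp_matP h)).
Definition Sp_one := MkSp symplectic1.
Definition Sp_inv (g : Sp) := MkSp (symplecticV (sp_matP g)).

Fact Sp_mulA : associative Sp_mul.
Proof. by move=> g h k; apply: val_inj; exact: mat_mulA. Qed.
Fact Sp_mul1 : left_id Sp_one Sp_mul.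
Proof. by move=> g; apply: val_inj; exact: mat_mul1. Qed.
Fact Sp_mulr1 : right_id Sp_one Sp_mul.
Proof. by move=> g; apply: val_inj; exact: mat_mulr1. Qed.
Fact Sp_mulV : left_inverse Sp_one Sp_inv Sp_mul.
Proof. by move=> g; apply: val_inj => /=; case/andP: (sp_matP g) => /eqP ->. Qed.
Fact Sp_mulrV : right_inverse Sp_one Sp_inv Sp_mul.
Proof. by move=> g; apply: val_inj => /=; case/andP: (sp_matP g) => _ /eqP ->. Qed.

HB.instance Definition _ :=
  isGroup.Build Sp Sp_mulA Sp_mul1 Sp_mulr1 Sp_mulV Sp_mulrV.

Lemma sp_matM (g h : Sp) : sp_mat (g * h)%g = mat_mul g h. Proof. by []. Qed.
Lemma sp_matV (g : Sp) : sp_mat (g^-1)%g = mat_adj g. Proof. by []. Qed.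
Lemma sp_mat1 : sp_mat (1%g : Sp) = mat1. Proof. by []. Qed.

Lemma Sp_eq (g h : Sp) : sp_mat g = sp_mat h -> g = h.
Proof. exact: val_inj. Qed.

(** * Transvections *)

Definition tmat (a b c d n : Z) : mat :=
  Mat (1 - n * a * c) (- n * a * d) (n * a * a) (n * a * b)
      (- n * b * c) (1 - n * b * d) (n * b * a) (n * b * b)
      (- n * c * c) (- n * c * d) (1 + n * c * a) (n * c * b)
      (- n * d * c) (- n * d * d) (n * d * a) (1 + n * d * b).

Lemma tmat_sp a b c d n : symplectic (tmat a b c d n).
Proof. by apply/andP; split; apply/eqP; rewrite /=; apply: Mat_eq; ring. Qed.

(** The power x |-> x + n <w, x> w of the transvection of w = (a, b, c, d), for
    <x, y> = x0 y2 + x1 y3 - x2 y0 - x3 y1. *)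
Definition tv a b c d n : Sp := MkSp (tmat_sp a b c d n).

Ltac sp_ring := apply: Sp_eq; rewrite /=; apply: Mat_eq; ring.

Lemma tvD a b c d m n : (tv a b c d m * tv a b c d n)%g = tv a b c d (m + n).
Proof. sp_ring. Qed.

Lemma tv0 a b c d : tv a b c d 0 = 1%g.
Proof. sp_ring. Qed.

Lemma tvV a b c d n : (tv a b c d n)^-1%g = tv a b c d (- n).
Proof. sp_ring. Qed.

Lemma tvN a b c d n : tv (- a) (- b) (- c) (- d) n = tv a b c d n.
Proof. sp_ring. Qed.

Lemma tvZ k a b c d n : tv (k * a) (k * b) (k * c) (k * d) n = tv a b c d (k * k * n).
Proof. sp_ring. Qed.

Record vec := Vec { v0 : Z; v1 : Z; v2 : Z; v3 : Z }.
Definition act (A : mat) (w : vec) : vec :=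
  let: Mat a00 a01 a02 a03 a10 a11 a12 a13 a20 a21 a22 a23 a30 a31 a32 a33
    := A in
  let: Vec a b c d := w in
  Vec (a00 * a + a01 * b + a02 * c + a03 * d) (a10 * a + a11 * b + a12 * c + a13 * d)
      (a20 * a + a21 * b + a22 * c + a23 * d) (a30 * a + a31 * b + a32 * c + a33 * d).
Definition tw (w : vec) n := let: Vec a b c d := w in tv a b c d n.

Lemma eq_shift (l d x y : Z) : l = d -> x = y + (l - d) -> x = y.
Proof. lia. Qed.

(** Conjugation by g turns <w, x> w into <w, g^-1 x> (g w), and g preserves the
    form. By entries, both sides differ by a combination of the defining
    relations of g, which [eq_shift] adds one at a time. *)
Lemma twJ (g : Sp) w n : (g * tw w n * g^-1)%g = tw (act g w) n.
Proof.
apply: Sp_eq; case: g => A sA; rewrite !sp_matM sp_matV /=.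
have /andP[_ /eqP]:= sA.
case: A {sA} => ? ? ? ? ? ? ? ? ? ? ? ? ? ? ? ?; case: w => a b c d.
case=> e0 e1 e2 e3 e4 e5 e6 e7 e8 e9 e10 e11 e12 e13 e14 e15; rewrite /=; apply: Mat_eq;
  [ apply: (eq_shift e0); ring
  | apply: (eq_shift e1); ring
  | apply: (eq_shift e2); ring
  | apply: (eq_shift e3); ring
  | apply: (eq_shift e4); ring
  | apply: (eq_shift e5); ring
  | apply: (eq_shift e6); ring
  | apply: (eq_shift e7); ring
  | apply: (eq_shift e8); ring
  | apply: (eq_shift e9); ring
  | apply: (eq_shift e10); ring
  | apply: (eq_shift e11); ring
  | apply: (eq_shift e12); ring
  | apply: (eq_shift e13); ring
  | apply: (eq_shift e14); ring
  | apply: (eq_shift e15); ring ].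
Qed.

Local Open Scope group_scope.

(** * Subgroups *)

Record subgroup (H : Sp -> Prop) : Prop := Subgroup {
  sub1 : H 1;
  subM : forall g h, H g -> H h -> H (g * h);
  subV : forall g, H g -> H g^-1 }.

Inductive gen (S : Sp -> Prop) : Sp -> Prop :=
| gen1 : gen S 1
| gen_in g : S g -> gen S g
| genM g h : gen S g -> gen S h -> gen S (g * h)
| genV g : gen S g -> gen S g^-1.

Lemma gen_subgroup S : subgroup (gen S).
Proof. by split; [exact: gen1 | exact: genM | exact: genV]. Qed.

Lemma gen_min S H : subgroup H -> (forall g, S g -> H g) -> forall g, gen S g -> H g.
Proof.
move=> sH SH g; elim=> {g} [|g /SH//|g h _ Hg _ Hh|g _ Hg].
- exact: sub1.
- exact: subM.
- exact: subV.
Qed.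

Lemma subVr H g : subgroup H -> H g^-1 -> H g.
Proof. by move=> sH /(subV sH); rewrite invgK. Qed.

Lemma subMl H g h : subgroup H -> H g -> H (g * h) -> H h.
Proof. by move=> sH Hg /(subM sH (subV sH Hg)); rewrite mulKg. Qed.

Lemma subMr H g h : subgroup H -> H h -> H (g * h) -> H g.
Proof. by move=> sH Hh /(subM sH)/(_ (subV sH Hh)); rewrite mulgK. Qed.

(** * The normal subgroups generated by the n-th powers of transvections *)

Definition tvec n (g : Sp) := exists w, g = tw w n.
(** The elementary subgroup of level n. *)
Definition EE n := gen (tvec n).

Lemma EE_sub n : subgroup (EE n). Proof. exact: gen_subgroup. Qed.

Lemma EE_tw n w : EE n (tw w n). Proof. by apply: gen_in; exists w. Qed.

Lemma EE_tv n a b c d : EE n (tv a b c d n). Proof. exact: (EE_tw n (Vec a b c d)). Qed.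

Lemma EE_tvM n m a b c d : (n | m) -> EE n (tv a b c d m).
Proof.
case=> k ->; elim/Z.peano_ind: k => [|k IH|k IH].
- by rewrite tv0; exact: gen1.
- rewrite Z.mul_succ_l -tvD; apply: genM => //; exact: EE_tv.
- rewrite Z.mul_pred_l -Z.add_opp_r -tvD -tvV; apply: genM => //; apply: genV; exact: EE_tv.
Qed.

(** Conjugation permutes the generators, by [twJ]. *)
Lemma EE_normal n g h : EE n h -> EE n (g * h * g^-1).
Proof.
elim=> {h} [|h [w ->]|h k _ IHh _ IHk|h _ IH].
- by rewrite mulg1 mulgV; exact: gen1.
- by rewrite twJ; exact: EE_tw.
- have -> : g * (h * k) * g^-1 = (g * h * g^-1) * (g * k * g^-1).
    by rewrite !mulgA mulgVK.
  exact: genM.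
- have -> : g * h^-1 * g^-1 = (g * h * g^-1)^-1 by rewrite !invgM invgK mulgA.
  exact: genV.
Qed.

Lemma EE_dvd n m g : (n | m) -> EE m g -> EE n g.
Proof.
move=> nm; apply: gen_min; first exact: EE_sub.
by move=> _ [[a b c d] ->]; exact: EE_tvM.
Qed.

(** Congruence modulo a normal subgroup; it is made a setoid relation to allow
    rewriting in the quotient. *)
Definition eqE n (g h : Sp) := EE n (g * h^-1).

#[local] Instance eqE_equiv n : Equivalence (eqE n).
Proof.
split=> [g|g h|g h k]; rewrite /eqE.
- rewrite mulgV; exact: gen1.
- by move/genV; rewrite invgM invgK.
- by move=> gh /(genM gh); rewrite mulgA mulgVK.
Qed.

#[local] Instance eqE_mul n : Proper (eqE n ==> eqE n ==> eqE n) (@monoid.mul Sp).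
Proof.
move=> g g' gg' h h' hh'; rewrite /eqE in gg' hh' *.
have := genM gg' (EE_normal g' hh'); congr (EE _ _).
by rewrite invgM !mulgA mulgVK.
Qed.

#[local] Instance eqE_inv n : Proper (eqE n ==> eqE n) (@monoid.inv Sp).
Proof.
move=> g g'; rewrite /eqE => gg'.
have /genV := EE_normal g^-1 gg'; congr (EE _ _).
by rewrite mulKg invgM !invgK.
Qed.

Notation "g == h %[EE n ]" := (eqE n g h) (at level 70, h at next level).

Lemma eqE_refl n g : g == g %[EE n]. Proof. reflexivity. Qed.
#[local] Hint Resolve eqE_refl : core.

Lemma eqE1 n g : EE n g -> g == 1 %[EE n].
Proof. by rewrite /eqE invg1 mulg1. Qed.

Lemma eqE1P n g : g == 1 %[EE n] -> EE n g.
Proof. by rewrite /eqE invg1 mulg1. Qed.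

Lemma eqE_mulr n g h k : g * k == h * k %[EE n] -> g == h %[EE n].
Proof. by rewrite /eqE invgM !mulgA mulgK. Qed.

Lemma eqE_mull n g h k : k * g == k * h %[EE n] -> g == h %[EE n].
Proof. by move=> H; rewrite -[g](mulKg k) -[h](mulKg k) H. Qed.

Lemma eqE_conj n g h k : g == h %[EE n] -> k * g * k^-1 == k * h * k^-1 %[EE n].
Proof. by move=> ->. Qed.

Lemma eqE_tw n (g : Sp) v w m :
  tw v m == tw w m %[EE n] -> tw (act g v) m == tw (act g w) m %[EE n].
Proof. by move/(eqE_conj g); rewrite !twJ. Qed.

(** * Transvections modulo the next layer *)

Lemma Xmat_sp a b c d n : symplectic
  (Mat 1 (- n * a * d) 0 (n * a * b)
       (- n * b * c) 1 (n * b * a) 0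
       0 (- n * c * d) 1 (n * c * b)
       (- n * d * c) 0 (n * d * a) 1).
Proof. by apply/andP; split; apply/eqP; rewrite /=; apply: Mat_eq; ring. Qed.

(** For orthogonal u and v this is the Eichler element x |-> x + n (<u, x> v +
    <v, x> u), with u = (a, 0, c, 0) and v = (0, b, 0, d). It measures how far
    [tv] is from being multiplicative along the decomposition of the space into
    two hyperbolic planes; see [tv_split]. *)
Definition Xv a b c d n : Sp := MkSp (Xmat_sp a b c d n).

Lemma tv_split a b c d n :
  tv a b c d n = tv a 0 c 0 n * tv 0 b 0 d n * Xv a b c d n.
Proof. sp_ring. Qed.

Lemma tv_planesC a b c d m n :
  tv a 0 c 0 m * tv 0 b 0 d n = tv 0 b 0 d n * tv a 0 c 0 m.
Proof. sp_ring. Qed.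

Lemma Xv_addl a b c d a' c' n :
  Xv a b c d n * Xv a' b c' d n =
  Xv (a + a') b (c + c') d n * tv 0 b 0 d (n * n * (a * c' - c * a')).
Proof. sp_ring. Qed.

Lemma Xv_addr a b c d b' d' n :
  Xv a b c d n * Xv a b' c d' n =
  Xv a (b + b') c (d + d') n * tv a 0 c 0 (n * n * (b * d' - d * b')).
Proof. sp_ring. Qed.

Lemma Xv_EE a b c d n : EE n (Xv a b c d n).
Proof.
have E := tv_split a b c d n.
by apply: (subMl (EE_sub n) (genM (EE_tv n a 0 c 0) (EE_tv n 0 b 0 d))); rewrite -E; exact: EE_tv.
Qed.

(** The vectors (a, 1, c, 0) and (a + 2, 1, c, 2 c) differ by twice y = (1, 0,
    0, c), which is orthogonal to both. For orthogonal vectors w and y, the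
    transvections of w, w + y and w + 2 y satisfy the second difference identity
    of a quadratic function. *)
Lemma orth_shift a c n :
  tv (a + 2) 1 c (2 * c) n =
  tv a 1 c 0 (- n) * tv 1 0 0 c (2 * n) * tv (a + 1) 1 c c (2 * n).
Proof. sp_ring. Qed.

Section Layer.
Variable m : Z.
Let N := (2 * m)%Z.
Let K := (2 * N)%Z.

Lemma tv_K a b c d n : (K | n) -> tv a b c d n == 1 %[EE K].
Proof. by move=> ?; apply: eqE1; exact: EE_tvM. Qed.

Lemma tv_opp a b c d : tv a b c d (- N) == tv a b c d N %[EE K].
Proof.
apply: (@eqE_mulr _ _ _ (tv a b c d N)); rewrite !tvD !tv_K //.
- by exists 1%Z; rewrite /K; ring.
- by exists 0%Z; ring.
Qed.

Lemma tv_sqr a b c d : tv a b c d N * tv a b c d N == 1 %[EE K].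
Proof. by rewrite tvD tv_K //; exists 1%Z; rewrite /K; ring. Qed.

(** The Eichler element is additive in each of its vectors up to a transvection
    of exponent N^2, so doubling a vector lands in level 2 N. *)
Lemma Xv_period a b c d i j : Xv (a + 2 * i) b (c + 2 * j) d N == Xv a b c d N %[EE K].
Proof.
have := Xv_addl a b c d (2 * i) (2 * j) N.
have -> : Xv (2 * i) b (2 * j) d N = Xv i b j d K by rewrite /K; sp_ring.
move/(congr1 (fun g => g == Xv a b c d N %[EE K])) => E.
have: Xv a b c d N * Xv i b j d K == Xv a b c d N %[EE K].
  by rewrite (eqE1 (Xv_EE _ _ _ _ K)) mulg1.
rewrite E tv_K ?mulg1 // /K /N; exists (m * (a * (2 * j) - c * (2 * i)))%Z; ring.
Qed.

Lemma Xv_period' a b c d i j : Xv a (b + 2 * i) c (d + 2 * j) N == Xv a b c d N %[EE K].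
Proof.
have := Xv_addr a b c d (2 * i) (2 * j) N.
have -> : Xv a (2 * i) c (2 * j) N = Xv a i c j K by rewrite /K; sp_ring.
move/(congr1 (fun g => g == Xv a b c d N %[EE K])) => E.
have: Xv a b c d N * Xv a i c j K == Xv a b c d N %[EE K].
  by rewrite (eqE1 (Xv_EE _ _ _ _ K)) mulg1.
rewrite E tv_K ?mulg1 // /K /N; exists (m * (b * (2 * j) - d * (2 * i)))%Z; ring.
Qed.

(** The obstruction to the dependence of [tw w N] on w modulo 2 only. It
    involves the second plane alone, but [plane_shift] shows that it also
    measures the failure of 2-periodicity in the first plane. *)
Definition defect c := tv 0 1 0 (2 * c) N * (tv 0 1 0 0 N)^-1.

(** Split both sides of [orth_shift] along the two planes: the Eichler parts
    agree by periodicity, and what remains in the second plane is the defect. *)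
Lemma plane_shift a c :
  tv (a + 2) 0 c 0 N == tv a 0 c 0 N * (defect c)^-1 %[EE K].
Proof.
have: tv (a + 2) 1 c (2 * c) N == tv a 1 c 0 N %[EE K].
  rewrite orth_shift !(tv_K _ _ _ _ (n := 2 * N)); try exact: Z.divide_refl.
  by rewrite !mulg1 tv_opp.
rewrite [tv (a + 2) _ _ _ _]tv_split [tv a _ _ _ _]tv_split.
have := Xv_period a 1 c (2 * c) 1 0; rewrite Z.mul_1_r Z.add_0_r => ->.
have := Xv_period' a 1 c 0 0 c; rewrite Z.add_0_l Z.add_0_r => ->.
move/eqE_mulr => E; apply: (@eqE_mulr _ _ _ (tv 0 1 0 (2 * c) N)).
by rewrite E /defect invgM invgK -!mulgA mulVg mulg1.
Qed.

(** By [plane_shift] the defect is congruent to an element supported in the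
    first plane, which commutes with the second. *)
Lemma defectC c b d n : defect c * tv 0 b 0 d n == tv 0 b 0 d n * defect c %[EE K].
Proof.
have E : defect c == (tv (0 + 2) 0 c 0 N)^-1 * tv 0 0 c 0 N %[EE K].
  by rewrite plane_shift invgM invgK mulgVK.
by rewrite !E tvV -mulgA (tv_planesC 0 b) !mulgA (tv_planesC (0 + 2) b).
Qed.

(** The defect is a quotient of two elements with trivial squares, and commutes
    with them. *)
Lemma defect_sqr c : defect c * defect c == 1 %[EE K].
Proof.
have E : defect c * tv 0 1 0 0 N = tv 0 1 0 (2 * c) N by rewrite /defect mulgVK.
have F := tv_sqr 0 1 0 (2 * c); rewrite -E in F.
transitivity (defect c * defect c * (tv 0 1 0 0 N * tv 0 1 0 0 N)).
  by rewrite (tv_sqr 0 1 0 0) mulg1.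
rewrite -F; have := defectC c 1 0 N; move: (defect c) (tv _ _ _ _ _) => D t C.
have -> : D * D * (t * t) = D * (D * t) * t by rewrite !mulgA.
have -> : D * t * (D * t) = D * (t * D) * t by rewrite !mulgA.
by rewrite C.
Qed.

(** Conjugation by a transvection of the second plane shifts c. *)
Lemma defect_add c c' : defect (c + c') == defect c * defect c' %[EE K].
Proof.
pose x := tv 0 0 0 1 (- (2 * c')).
have Ex : x * tv 0 1 0 (2 * c) N * x^-1 = tv 0 1 0 (2 * (c + c')) N.
  by rewrite -[tv 0 1 0 (2 * c) N]/(tw (Vec 0 1 0 (2 * c)) N) twJ /=; congr tv; ring.
have E0 : x * tv 0 1 0 0 N * x^-1 = tv 0 1 0 (2 * c') N.
  by rewrite -[tv 0 1 0 0 N]/(tw (Vec 0 1 0 0) N) twJ /=; congr tv; ring.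
have -> : defect (c + c') = x * defect c * (x^-1 * (x * tv 0 1 0 0 N * x^-1 * (tv 0 1 0 0 N)^-1)).
  by rewrite {1}/defect -Ex /defect !mulgA !mulgVK.
by rewrite E0 -/(defect c') -defectC -mulgA mulVKg.
Qed.

Lemma plane_shift4 a c : tv (a + 4) 0 c 0 N == tv a 0 c 0 N %[EE K].
Proof.
have -> : (a + 4 = (a + 2) + 2)%Z by ring.
by rewrite plane_shift plane_shift -mulgA -invgM defect_sqr invg1 mulg1.
Qed.

End Layer.

Lemma Jmat_sp : symplectic (Mat 0 0 1 0  0 1 0 0  (-1) 0 0 0  0 0 0 1).
Proof. by []. Qed.
(** The quarter turn of the first plane; with [Wsp] it generates the Weyl group.
    *)
Definition Jsp := MkSp Jmat_sp.

Lemma Wmat_sp : symplectic (Mat 0 1 0 0  1 0 0 0  0 0 0 1  0 0 1 0).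
Proof. by []. Qed.
(** The exchange of the two planes. *)
Definition Wsp := MkSp Wmat_sp.

Lemma act_J a b c d : act Jsp (Vec a b c d) = Vec c b (- a) d.
Proof. by rewrite /=; congr Vec; ring. Qed.

Lemma act_W a b c d : act Wsp (Vec a b c d) = Vec b a d c.
Proof. by rewrite /=; congr Vec; ring. Qed.

Lemma act_JV a b c d : act (Jsp^-1) (Vec a b c d) = Vec (- c) b a d.
Proof. by rewrite /=; congr Vec; ring. Qed.

Definition vec_eqm r (v w : vec) :=
  [/\ (r | v0 v - v0 w), (r | v1 v - v1 w), (r | v2 v - v2 w) & (r | v3 v - v3 w)]%Z.

Definition tw_periodic n r N := forall v w, vec_eqm r v w -> tw v N == tw w N %[EE n].

Section Periodicity.
Variables m r : Z.
Let N := (2 * m)%Z.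
Let K := (2 * N)%Z.
Hypothesis r_even : (2 | r).
Hypothesis plane_period : forall a c, tv (a + r) 0 c 0 N == tv a 0 c 0 N %[EE K].

(** The plane component is periodic by hypothesis and the Eichler component
    because r is even. *)
Lemma tv_period0 a b c d k : tv (a + r * k) b c d N == tv a b c d N %[EE K].
Proof.
have P1 a' : tv (a' + r) b c d N == tv a' b c d N %[EE K].
  rewrite [tv (a' + r) b c d N]tv_split [tv a' b c d N]tv_split plane_period.
  case: r_even => j ->.
  have := Xv_period m a' b c d j 0; rewrite Z.mul_0_r Z.add_0_r (Z.mul_comm 2 j) => E.
  by rewrite E.
elim/Z.peano_ind: k => [|k IH|k IH].
- by rewrite Z.mul_0_r Z.add_0_r.
- by rewrite Z.mul_succ_r Z.add_assoc P1.
- by rewrite -IH -(P1 (a + r * Z.pred k)%Z); apply: eq_subrelation; congr tv; lia.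
Qed.

(** Periodicity in one coordinate suffices: [Jsp] and [Wsp] carry it to the
    other three. *)
Lemma tw_period : tw_periodic K r N.
Proof.
have H0 a a' b c d : (r | a - a') -> tv a b c d N == tv a' b c d N %[EE K].
  by case=> k e; rewrite -(tv_period0 a' b c d k); have -> : (a' + r * k = a)%Z by lia.
have HJ a b c c' d : (r | c - c') -> tv a b c d N == tv a b c' d N %[EE K].
  move=> rc; have := eqE_tw Jsp^-1 (v := Vec c b (- a) d) (w := Vec c' b (- a) d) (H0 _ _ b (- a)%Z d rc).
  by rewrite !act_JV Z.opp_involutive.
have HW v w : tw v N == tw w N %[EE K] -> tw (act Wsp v) N == tw (act Wsp w) N %[EE K].
  exact: eqE_tw.
case=> a b c d [a' b' c' d'] [/= h0 h1 h2 h3].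
rewrite (H0 _ _ b c d h0) (HJ a' b _ _ d h2).
have := HW (Vec b a' d c') (Vec b' a' d c') (H0 _ _ a' d c' h1).
rewrite !act_W /= => ->.
have := HW (Vec b' a' d c') (Vec b' a' d' c') (HJ b' a' _ _ c' h3).
by rewrite !act_W /= => ->.
Qed.

End Periodicity.

(** The square of the defect is trivial, so shifting twice by 2 has no effect.
    *)
Lemma tw_period4 m : tw_periodic (2 * (2 * m)) 4 (2 * m).
Proof. by apply: tw_period; [exists 2%Z | exact: plane_shift4]. Qed.

(** The defect at 1 is trivial; by additivity all defects are. *)
Definition layer_split N := tv 0 1 0 2 N == tv 0 1 0 0 N %[EE (2 * N)].

Lemma defect_trivial m c : layer_split (2 * m) -> defect m c == 1 %[EE (2 * (2 * m))].
Proof.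
rewrite /layer_split => S; have D1 : defect m 1 == 1 %[EE (2 * (2 * m))].
  by rewrite /defect Z.mul_1_r S mulgV.
elim/Z.peano_ind: c => [|c IH|c IH].
- by rewrite /defect Z.mul_0_r mulgV.
- by rewrite -Z.add_1_r defect_add IH D1 mul1g.
- apply: (@eqE_mulr _ _ _ (defect m 1)); rewrite -defect_add D1 mulg1.
  by have -> : (Z.pred c + 1 = c)%Z by lia.
Qed.

Lemma tw_period2 m : layer_split (2 * m) -> tw_periodic (2 * (2 * m)) 2 (2 * m).
Proof.
move=> S; apply: tw_period; first by exists 1%Z.
by move=> a c; rewrite plane_shift defect_trivial // invg1 mulg1.
Qed.

(** An identity in the second plane shows that the defect at -1 is trivial; that
    at 1 is its inverse. *)
Lemma layer_split2 : layer_split 2.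
Proof.
have S: tv 0 1 0 (-2) 2 == tv 0 1 0 0 2 %[EE 4].
  apply: (@eqE_mulr _ _ _ (tv 0 1 0 0 2)^-1); rewrite mulgV; apply: eqE1.
  have -> : tv 0 1 0 (-2) 2 * (tv 0 1 0 0 2)^-1 =
     tv 0 1 0 (-1) (-4) * tv 0 (-2) 0 1 (-4) * tv 0 1 0 0 (-4) by exact: Sp_eq.
  by do 2?apply: genM; apply: EE_tvM; exists (-1)%Z.
have D : defect 1 (-1) == 1 %[EE 4] by rewrite /defect S mulgV.
rewrite /layer_split -[tv 0 1 0 2 2](mulgVK (tv 0 1 0 0 2)) -/(defect 1 1).
have -> : defect 1 1 == defect 1 1 * defect 1 (-1) %[EE 4] by rewrite D mulg1.
by rewrite -defect_add /defect mulgVK.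
Qed.

Lemma tw_conj_tw v w m n :
  tw v m * tw w n * (tw v m)^-1 =
  tw (let k := (m * (v0 v * v2 w + v1 v * v3 w - v2 v * v0 w - v3 v * v1 w))%Z in
      Vec (v0 w + k * v0 v) (v1 w + k * v1 v) (v2 w + k * v2 v) (v3 w + k * v3 v)) n.
Proof.
by rewrite twJ; congr tw; case: v w => ? ? ? ? [? ? ? ?] /=; congr Vec; ring.
Qed.

Section Elementary.
Variables (m r : Z).
Let N := (2 * m)%Z.
Let K := (2 * N)%Z.
Hypothesis per : tw_periodic K r N.

(** Conjugation changes the vector of each generator by a multiple of the
    period. *)
Lemma tw_acts_trivially v j e :
  EE N e -> tw v (r * j) * e * (tw v (r * j))^-1 == e %[EE K].
Proof.
set x := tw v _; elim=> {e} [|e [w ->]|e f _ IHe _ IHf|e _ IH].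
- by rewrite mulg1 mulgV.
- rewrite tw_conj_tw; apply: per; rewrite /vec_eqm.
  by case: v w {x} => a b c d [a' b' c' d'] /=; split;
     rewrite Z.add_simpl_l -!Z.mul_assoc; exact: Z.divide_factor_l.
- have -> : x * (e * f) * x^-1 = (x * e * x^-1) * (x * f * x^-1) by rewrite !mulgA mulgVK.
  by rewrite IHe IHf.
- have -> : x * e^-1 * x^-1 = (x * e * x^-1)^-1 by rewrite !invgM invgK mulgA.
  by rewrite IH.
Qed.

Hypothesis rN : (r | N).

(** The generators of level N have exponents divisible by the period, so
    conjugation by them is trivial. *)
Lemma EE_comm e f : EE N e -> EE N f -> e * f == f * e %[EE K].
Proof.
move=> + Hf; elim=> {e} [|e [w ->]|e e' _ IH _ IH'|e _ IH].
- by rewrite mulg1 mul1g.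
- have [j E] := rN; have := tw_acts_trivially w j Hf; rewrite Z.mul_comm -E => F.
  by apply: (@eqE_mulr _ _ _ (tw w N)^-1); rewrite F mulgK.
- by rewrite -mulgA IH' mulgA IH mulgA.
- apply: (@eqE_mulr _ _ _ e); apply: (@eqE_mull _ _ _ e).
  by rewrite -!mulgA mulVg mulg1 !mulgA mulgV mul1g IH.
Qed.

Lemma EE_sqr e : EE N e -> e * e == 1 %[EE K].
Proof.
elim=> {e} [|e [[a b c d] ->]|e f He IHe Hf IHf|e _ IH].
- by rewrite mulg1.
- exact: tv_sqr.
- have -> : e * f * (e * f) = e * (f * e) * f by rewrite !mulgA.
  have -> : f * e == e * f %[EE K] by exact: EE_comm.
  by rewrite !mulgA IHe mul1g IHf.
- by rewrite -invgM IH invg1.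
Qed.

End Elementary.

(** In the first plane the defect at -1 is an explicit product of six
    transvection powers of exponent -4. Modulo level 8 it is the square of the
    product of three of them, because the defects of the two factors that have
    to be shifted cancel. Squares are trivial since the quotient is elementary
    abelian. *)
Lemma layer_split4 : layer_split 4.
Proof.
have C := @EE_comm 2 4 (tw_period4 2) (Z.divide_refl 4).
have O a b c d : tv a b c d (-4) == tv a b c d 4 %[EE 8] by exact: (tv_opp 2).
have S : tv 1 0 (-2) 0 4 == tv 1 0 0 0 4 %[EE 8].
  apply: (@eqE_mulr _ _ _ (tv 1 0 0 0 4)^-1); rewrite mulgV.
  have -> : tv 1 0 (-2) 0 4 * (tv 1 0 0 0 4)^-1 =
     tv 1 0 (-1) 0 (-4) * tv (-2) 0 1 0 (-4) * tv 1 0 0 0 (-4) *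
     (tv 1 0 1 0 (-4) * tv 0 0 1 0 (-4) * tv 1 0 0 0 (-4)) by exact: Sp_eq.
  rewrite !O.
  have := plane_shift 2 (-1) 1; rewrite /= => ->.
  have := plane_shift 2 (-2) 1; rewrite /= => ->.
  have -> : tv 1 0 (-1) 0 4 = tv (-1) 0 1 0 4 by exact: Sp_eq.
  have E1 := EE_tv 4 (-1) 0 1 0; have E2 := EE_tv 4 (-2) 0 1 0; have E3 := EE_tv 4 1 0 0 0.
  have D1 : EE 4 (defect 2 1)^-1 by apply: genV; apply: genM; [|apply: genV]; exact: EE_tv.
  have D2 : (defect 2 1)^-1 * (defect 2 1)^-1 == 1 %[EE 8] by rewrite -invgM defect_sqr invg1.
  move: (tv (-1) 0 1 0 4) (tv (-2) 0 1 0 4) (tv 1 0 0 0 4) (defect 2 1)^-1 E1 E2 E3 D1 D2.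
  move=> x y z e Ex Ey Ez Ee e2.
  have Q : forall f, EE 4 f -> f * f == 1 %[EE 8] by exact: (EE_sqr (tw_period4 2) (Z.divide_refl 4)).
  have G3 : EE 4 (x * y * z) by do 2?apply: genM.
  have -> : x * e * (y * e) * z == x * y * z %[EE 8].
    have -> : x * e * (y * e) * z = x * (e * y) * e * z by rewrite !mulgA.
    by rewrite (C _ _ Ee Ey) -!mulgA (mulgA e e z) e2 mul1g.
  exact: Q.
have := eqE_tw Wsp (v := Vec 1 0 (-2) 0) (w := Vec 1 0 0 0) S; rewrite !act_W /= => T.
have D : defect 2 (-1) == 1 %[EE 8] by rewrite /defect T mulgV.
rewrite /layer_split -[tv 0 1 0 2 4](mulgVK (tv 0 1 0 0 4)) -/(defect 2 1).
have -> : defect 2 1 == defect 2 1 * defect 2 (-1) %[EE 8] by rewrite D mulg1.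
by rewrite -defect_add /defect mulgVK.
Qed.

(** The defect of level 2 N is the product of the defect of level N with a
    conjugate of it by a transvection power t of level N. The defect of level N
    lies in EE (2 N) by hypothesis, t acts trivially on EE (2 N) modulo EE (4 N)
    as 4 divides N, and squares are trivial there. *)
Lemma layer_split_double N : (4 | N) -> layer_split N -> layer_split (2 * N).
Proof.
case=> j -> S; set N' := (j * 4)%Z in S *.
have Nd : N' = (2 * (2 * j))%Z by rewrite /N'; ring.
have per : tw_periodic (2 * (2 * N')) 4 (2 * N') := tw_period4 N'.
set t := tv 0 1 0 0 N'; pose e := tv 0 1 0 2 N' * t^-1.
have Ee : EE (2 * N') e by exact: S.
have E : tv 0 1 0 2 (2 * N') = e * (t * e * t^-1) * tv 0 1 0 0 (2 * N').
  have -> : tv 0 1 0 0 (2 * N') = t * t by rewrite /t tvD; congr tv; ring.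
  have -> : tv 0 1 0 2 (2 * N') = tv 0 1 0 2 N' * tv 0 1 0 2 N' by rewrite tvD; congr tv; ring.
  by rewrite /e !mulgA !mulgVK.
rewrite /layer_split E.
have T : t * e * t^-1 == e %[EE (2 * (2 * N'))].
  have := tw_acts_trivially per (Vec 0 1 0 0) j Ee.
  by rewrite /= (Z.mul_comm 4 j).
rewrite T (EE_sqr per) ?mul1g //; exists (2 * j)%Z; rewrite /N'; ring.
Qed.

Theorem layer_split_pow2 k : layer_split (2 ^ Z.of_nat k.+1).
Proof.
case: k => [|k]; first exact: layer_split2.
elim: k => [|k IH]; first exact: layer_split4.
have -> : (2 ^ Z.of_nat k.+3 = 2 * 2 ^ Z.of_nat k.+2)%Z.
  by rewrite (Nat2Z.inj_succ k.+2) Z.pow_succ_r //; exact: Nat2Z.is_nonneg.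
apply: layer_split_double IH.
exists (2 ^ Z.of_nat k)%Z; rewrite !Nat2Z.inj_succ !Z.pow_succ_r; lia.
Qed.

(** * Principal congruence subgroups *)

Definition mat_add (A B : mat) : mat :=
  let: Mat a00 a01 a02 a03 a10 a11 a12 a13 a20 a21 a22 a23 a30 a31 a32 a33
    := A in
  let: Mat b00 b01 b02 b03 b10 b11 b12 b13 b20 b21 b22 b23 b30 b31 b32 b33
    := B in
  Mat (a00 + b00) (a01 + b01) (a02 + b02) (a03 + b03)
      (a10 + b10) (a11 + b11) (a12 + b12) (a13 + b13)
      (a20 + b20) (a21 + b21) (a22 + b22) (a23 + b23)
      (a30 + b30) (a31 + b31) (a32 + b32) (a33 + b33).

Definition mat_scale (k : Z) (A : mat) : mat :=
  let: Mat a00 a01 a02 a03 a10 a11 a12 a13 a20 a21 a22 a23 a30 a31 a32 a33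
    := A in
  Mat (k * a00) (k * a01) (k * a02) (k * a03) (k * a10) (k * a11) (k * a12) (k * a13)
      (k * a20) (k * a21) (k * a22) (k * a23) (k * a30) (k * a31) (k * a32) (k * a33).

Definition mat0 : mat := Mat 0 0 0 0  0 0 0 0  0 0 0 0  0 0 0 0.

Local Notation mat_lin n X := (mat_add mat1 (mat_scale n X)).

Definition Gam n (g : Sp) := exists X, sp_mat g = mat_lin n X.

Ltac mat_case := repeat match goal with X : mat |- _ => destruct X end.
Ltac mat_ring := mat_case; rewrite /=; apply: Mat_eq; ring.

Lemma mat_linM n X Y : mat_mul (mat_lin n X) (mat_lin n Y) =
  mat_lin n (mat_add (mat_add X Y) (mat_scale n (mat_mul X Y))).
Proof. mat_ring. Qed.

Lemma mat_addC : commutative mat_add.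
Proof. by move=> X Y; mat_ring. Qed.

Lemma mat_adj_lin n X : mat_adj (mat_lin n X) = mat_lin n (mat_adj X).
Proof. mat_ring. Qed.

Lemma Gam_sub n : subgroup (Gam n).
Proof.
split.
- by exists mat0; rewrite sp_mat1 /=; apply: Mat_eq; ring.
- move=> g h [X EX] [Y EY]; rewrite /Gam sp_matM EX EY mat_linM; by eexists.
- by move=> g [X EX]; rewrite /Gam sp_matV EX mat_adj_lin; eexists.
Qed.

Lemma Gam_tv n m a b c d : (n | m) -> Gam n (tv a b c d m).
Proof.
case=> k ->; exists (Mat (- k * a * c) (- k * a * d) (k * a * a) (k * a * b)
      (- k * b * c) (- k * b * d) (k * b * a) (k * b * b)
      (- k * c * c) (- k * c * d) (k * c * a) (k * c * b)
      (- k * d * c) (- k * d * d) (k * d * a) (k * d * b)).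
by rewrite /=; apply: Mat_eq; ring.
Qed.

Lemma EE_Gam n g : EE n g -> Gam n g.
Proof.
by apply: gen_min; [exact: Gam_sub | move=> _ [[a b c d] ->]; exact/Gam_tv/Z.divide_refl].
Qed.

Lemma Gam_dvd n m g : (n | m) -> Gam m g -> Gam n g.
Proof.
case=> k -> [X EX]; exists (mat_scale k X); rewrite EX; mat_ring.
Qed.

Lemma Gam_normal n g h : Gam n h -> Gam n (g * h * g^-1).
Proof.
case=> X EX; exists (mat_mul (mat_mul g X) (mat_adj g)).
have /andP[_ /eqP E] := sp_matP g.
rewrite !sp_matM sp_matV EX.
transitivity (mat_add (mat_mul g (mat_adj g)) (mat_scale n (mat_mul (mat_mul g X) (mat_adj g)))); last by rewrite E.
by move: (sp_mat g) {E EX} => A; mat_ring.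
Qed.

(** ** Consecutive layers *)

(** The residue X of g = 1 + N X in the layer Gam N / Gam (2 N), which only
    matters modulo 2. *)
Definition res N (g : Sp) X :=
  exists E, sp_mat g = mat_lin N (mat_add X (mat_scale 2 E)).

Lemma res_Gam N g X : res N g X -> Gam N g.
Proof. by case=> E EX; eexists; exact: EX. Qed.

Lemma Gam_res N g : Gam N g -> exists X, res N g X.
Proof. by case=> X EX; exists X, mat0; rewrite EX; mat_ring. Qed.

Lemma res1 N : res N 1 mat0.
Proof. by exists mat0; rewrite sp_mat1; mat_ring. Qed.

Lemma resM m g h X Y : res (2 * m) g X -> res (2 * m) h Y -> res (2 * m) (g * h) (mat_add X Y).
Proof.
case=> E EE [F EF]; rewrite /res sp_matM EE EF mat_linM.
exists (mat_add (mat_add E F) (mat_scale m (mat_mul (mat_add X (mat_scale 2 E)) (mat_add Y (mat_scale 2 F))))).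
congr (mat_lin _ _); mat_ring.
Qed.

(** (1 + N X)^2 = 1 + 2 N X + N^2 X^2, where N^2 is divisible by 4 N. *)
Lemma res_sqr m g X : res (4 * m) g X -> res (2 * (4 * m)) (g * g) X.
Proof.
case=> E EE; rewrite /res sp_matM EE mat_linM.
exists (mat_add E (mat_scale m (mat_mul (mat_add X (mat_scale 2 E)) (mat_add X (mat_scale 2 E))))).
mat_ring.
Qed.

Fixpoint prodb (us : seq Sp) (ys : seq bool) : Sp :=
  match us, ys with
  | u :: us', y :: ys' => (if y then u else 1) * prodb us' ys'
  | _, _ => 1
  end.

Fixpoint sumb (Bs : seq mat) (ys : seq bool) : mat :=
  match Bs, ys with
  | B :: Bs', y :: ys' => mat_add (if y then B else mat0) (sumb Bs' ys')
  | _, _ => mat0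
  end.

Lemma res_prodb m us Bs ys : List.Forall2 (res (2 * m)) us Bs ->
  res (2 * m) (prodb us ys) (sumb Bs ys).
Proof.
move=> F; elim: F ys => [|u B us' Bs' uB _ IH] [|y ys] /=; try exact: res1.
by apply: resM => //; case: y => //; exact: res1.
Qed.

Lemma prodb_sub H us ys : subgroup H -> List.Forall H us -> H (prodb us ys).
Proof.
move=> sH F; elim: F ys => [|u us' Hu _ IH] [|y ys] /=; try exact: sub1.
by apply: subM => //; case: y => //; exact: sub1.
Qed.

Definition layer_basis N : seq Sp :=
  [:: tv 1 0 0 0 N; tv 0 1 0 0 N; tv 0 0 1 0 N; tv 0 0 0 1 N;
      Xv 1 1 0 0 N; Xv 1 0 0 1 N; Xv 0 1 1 0 N; Xv 0 0 1 1 N;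
      tv 1 0 1 0 N; tv 0 1 0 1 N].

(** The residues of [layer_basis], a basis of the symplectic Lie algebra modulo
    2. *)
Definition lie_basis : seq mat :=
  [:: Mat 0 0 1 0  0 0 0 0  0 0 0 0  0 0 0 0;
      Mat 0 0 0 0  0 0 0 1  0 0 0 0  0 0 0 0;
      Mat 0 0 0 0  0 0 0 0  1 0 0 0  0 0 0 0;
      Mat 0 0 0 0  0 0 0 0  0 0 0 0  0 1 0 0;
      Mat 0 0 0 1  0 0 1 0  0 0 0 0  0 0 0 0;
      Mat 0 1 0 0  0 0 0 0  0 0 0 0  0 0 1 0;
      Mat 0 0 0 0  1 0 0 0  0 0 0 1  0 0 0 0;
      Mat 0 0 0 0  0 0 0 0  0 1 0 0  1 0 0 0;
      Mat 1 0 1 0  0 0 0 0  1 0 1 0  0 0 0 0;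
      Mat 0 0 0 0  0 1 0 1  0 0 0 0  0 1 0 1 ].

Lemma layer_basis_res N : List.Forall2 (res N) (layer_basis N) lie_basis.
Proof.
rewrite /layer_basis /lie_basis; repeat constructor.
- by exists mat0; rewrite /=; apply: Mat_eq; ring.
- by exists mat0; rewrite /=; apply: Mat_eq; ring.
- by exists (Mat 0 0 0 0  0 0 0 0  (-1) 0 0 0  0 0 0 0); rewrite /=; apply: Mat_eq; ring.
- by exists (Mat 0 0 0 0  0 0 0 0  0 0 0 0  0 (-1) 0 0); rewrite /=; apply: Mat_eq; ring.
- by exists mat0; rewrite /=; apply: Mat_eq; ring.
- by exists (Mat 0 (-1) 0 0  0 0 0 0  0 0 0 0  0 0 0 0); rewrite /=; apply: Mat_eq; ring.
- by exists (Mat 0 0 0 0  (-1) 0 0 0  0 0 0 0  0 0 0 0); rewrite /=; apply: Mat_eq; ring.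
- by exists (Mat 0 0 0 0  0 0 0 0  0 (-1) 0 0  (-1) 0 0 0); rewrite /=; apply: Mat_eq; ring.
- by exists (Mat (-1) 0 0 0  0 0 0 0  (-1) 0 0 0  0 0 0 0); rewrite /=; apply: Mat_eq; ring.
- by exists (Mat 0 0 0 0  0 (-1) 0 0  0 0 0 0  0 (-1) 0 0); rewrite /=; apply: Mat_eq; ring.
Qed.

(** Coordinates modulo 2 in [lie_basis] of a matrix of the Lie algebra: ten
    entries determine the other six. *)
Definition lie_coord (X : mat) : seq bool :=
  let: Mat a00 a01 a02 a03 a10 a11 a12 a13 a20 a21 a22 a23 a30 a31 a32 a33
    := X in
  map Z.odd [:: a02 + a00; a13 + a11; a20 + a00; a31 + a11; a03; a01; a10; a21; a00; a11].

Lemma mat_add0 X : mat_add mat0 X = X.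
Proof. mat_ring. Qed.

Lemma sumb_coord (y : seq bool) : size y = 10%N -> lie_coord (sumb lie_basis y) = y.
Proof.
by do 10?[case: y => // ? y]; case: y => // _; do 10!match goal with b : bool |- _ => case: b end.
Qed.

Lemma Z_odd_even k : Z.odd k = false -> exists j, k = (2 * j)%Z.
Proof. by move=> ok; exists (Z.div2 k); rewrite {1}(Z.div2_odd k) ok /= Z.add_0_r. Qed.

Lemma cancel_layer N x s : N <> 0%Z -> (N * (x + N * s) = 0)%Z -> (N | x).
Proof.
by move=> N0 /Z.mul_eq_0[//|E]; exists (- s)%Z; rewrite Z.mul_comm; lia.
Qed.

(** To first order in N, the relations defining the symplectic group are those
    of its Lie algebra. *)
Lemma symplectic_lin N X : N <> 0%Z -> symplectic (mat_lin N X) ->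
  [/\ (N | m00 X + m22 X), (N | m11 X + m33 X), (N | m01 X + m32 X)
    & [/\ (N | m10 X + m23 X), (N | m03 X - m12 X) & (N | m21 X - m30 X)]]%Z.
Proof.
move=> N0 /andP[/eqP + _].
case: X => x00 x01 x02 x03 x10 x11 x12 x13 x20 x21 x22 x23 x30 x31 x32 x33.
rewrite /=; case=> e00 e01 _ e03 e10 e11 _ _ _ e21 _ _ _ _ _ _.
split; [..|split].
- apply: (@cancel_layer _ _ (x22 * x00 + x32 * x10 - x02 * x20 - x12 * x30)%Z N0).
  by apply: (eq_shift e00); ring.
- apply: (@cancel_layer _ _ (x23 * x01 + x33 * x11 - x03 * x21 - x13 * x31)%Z N0).
  by apply: (eq_shift e11); ring.
- apply: (@cancel_layer _ _ (x22 * x01 + x32 * x11 - x02 * x21 - x12 * x31)%Z N0).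
  by apply: (eq_shift e01); ring.
- apply: (@cancel_layer _ _ (x23 * x00 + x33 * x10 - x03 * x20 - x13 * x30)%Z N0).
  by apply: (eq_shift e10); ring.
- apply: (@cancel_layer _ _ (x22 * x03 + x32 * x13 - x02 * x23 - x12 * x33)%Z N0).
  by apply: (eq_shift e03); ring.
- apply: (@cancel_layer _ _ (- x20 * x01 - x30 * x11 + x00 * x21 + x10 * x31)%Z N0).
  by apply: (eq_shift e21); ring.
Qed.

Lemma mat_even X : [/\ (2 | m00 X), (2 | m01 X), (2 | m02 X) & (2 | m03 X)]%Z ->
  [/\ (2 | m10 X), (2 | m11 X), (2 | m12 X) & (2 | m13 X)]%Z ->
  [/\ (2 | m20 X), (2 | m21 X), (2 | m22 X) & (2 | m23 X)]%Z ->
  [/\ (2 | m30 X), (2 | m31 X), (2 | m32 X) & (2 | m33 X)]%Z ->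
  exists Y, X = mat_scale 2 Y.
Proof.
case: X => ? ? ? ? ? ? ? ? ? ? ? ? ? ? ? ?; rewrite [m00 _]/= /m01 /m02 /m03 /m10 /m11 /m12 /m13 /m20 /m21 /m22 /m23 /m30 /m31 /m32 /m33.
case=> -[a00 ->] [a01 ->] [a02 ->] [a03 ->].
case=> -[a10 ->] [a11 ->] [a12 ->] [a13 ->].
case=> -[a20 ->] [a21 ->] [a22 ->] [a23 ->].
case=> -[a30 ->] [a31 ->] [a32 ->] [a33 ->].
by exists (Mat a00 a01 a02 a03 a10 a11 a12 a13 a20 a21 a22 a23 a30 a31 a32 a33); rewrite /=; apply: Mat_eq; ring.
Qed.

Lemma even_addl y x : (2 | 2 * y + x)%Z -> (2 | x)%Z.
Proof. by case=> k E; exists (k - y)%Z; lia. Qed.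

Lemma even_subl y x : (2 | 2 * y - x)%Z -> (2 | x)%Z.
Proof. by case=> k E; exists (y - k)%Z; lia. Qed.

(** The ten coordinates and the six linearized relations make all entries of X
    even. *)
Lemma Gam_even m (g : Sp) X : m <> 0%Z -> sp_mat g = mat_lin (2 * m) X ->
  lie_coord X = nseq 10 false -> Gam (2 * (2 * m)) g.
Proof.
move=> m0 EX cX.
have N0 : (2 * m)%Z <> 0%Z by lia.
have := sp_matP g; rewrite EX => /(symplectic_lin N0).
have d2 k : (2 * m | k) -> (2 | k) by apply: Z.divide_trans; exact: Z.divide_factor_l.
case=> /d2 r0 /d2 r1 /d2 r2 [/d2 r3 /d2 r4 /d2 r5].
suff [Y EY] : exists Y, X = mat_scale 2 Y.
  by exists Y; rewrite EX EY; mat_ring.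
case: X EX cX r0 r1 r2 r3 r4 r5 => x00 x01 x02 x03 x10 x11 x12 x13 x20 x21 x22 x23 x30 x31 x32 x33 _.
rewrite [lie_coord _]/= !Z.odd_add; case=> + + + + o03 o01 o10 o21 o00 o11.
rewrite o00 o11 !Bool.xorb_false_r => o02 o13 o20 o31 /=.
move: o00 o01 o02 o03 o10 o11 o13 o20 o21 o31.
do 10!move/Z_odd_even=> [? ->].
move=> /even_addl r0 /even_addl r1 /even_addl r2 /even_addl r3 /even_subl r4 /even_subl r5.
by apply: mat_even; split; rewrite ?Z.divide_factor_l //; exact: Z.divide_factor_l.
Qed.

Lemma coordD X Y : lie_coord (mat_add X Y) =
  map (fun b => b.1 (+) b.2) (zip (lie_coord X) (lie_coord Y)).
Proof.
by mat_case; rewrite /= !Z.odd_add; do 10?[congr (_ :: _)]; repeat match goal with |- context [Z.odd ?x] => case: (Z.odd x) end.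
Qed.

Lemma coord_scale2 X : lie_coord (mat_scale 2 X) = nseq 10 false.
Proof. by mat_case; rewrite /= !Z.odd_add !Z.odd_mul. Qed.

Lemma size_coord X : size (lie_coord X) = 10%N.
Proof. by case: X. Qed.

Lemma coordDD X Y : lie_coord X = lie_coord Y -> lie_coord (mat_add X Y) = nseq 10 false.
Proof.
by rewrite coordD => ->; case: Y => *; rewrite /= !addbb.
Qed.

Lemma coord_even X Y : lie_coord (mat_add X (mat_scale 2 Y)) = lie_coord X.
Proof.
rewrite coordD coord_scale2; case: X => *.
by rewrite /= !addbF.
Qed.

Lemma res_even m (g : Sp) X : m <> 0%Z -> res (2 * m) g X ->
  lie_coord X = nseq 10 false -> Gam (2 * (2 * m)) g.
Proof.
by move=> m0 [E EX] cX; apply: (Gam_even m0 EX); rewrite coord_even.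
Qed.

Lemma res_coord_uniq N g X Y : N <> 0%Z -> res N g X -> res N g Y -> lie_coord X = lie_coord Y.
Proof.
move=> N0 [E EX] [F]; rewrite EX => EY; rewrite -(coord_even X E) -(coord_even Y F); congr lie_coord.
move: (mat_add X _) (mat_add Y _) EY => {EX} {}X {}Y.
mat_case; rewrite /=; case=> *; apply: Mat_eq; apply: (Z.mul_reg_l _ _ N) => //; lia.
Qed.

Lemma res_Gam2 m g : Gam (2 * (2 * m)) g -> res (2 * m) g mat0.
Proof. by case=> X EX; exists X; rewrite EX; mat_ring. Qed.

(** Every class of the layer has order at most 2, so the product with the same
    coordinates is an inverse modulo the next layer. *)
Lemma layer_reduce m us (g : Sp) : m <> 0%Z ->
  List.Forall2 (res (2 * m)) us lie_basis -> Gam (2 * m) g ->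
  exists2 y, size y = 10%N & Gam (2 * (2 * m)) (prodb us y * g).
Proof.
move=> m0 F /Gam_res[X rX]; exists (lie_coord X); first exact: size_coord.
apply: (res_even m0 (resM (res_prodb _ F) rX)); apply: coordDD.
by rewrite sumb_coord // size_coord.
Qed.

Lemma layer_uniq m us (g : Sp) y y' : m <> 0%Z -> size y = 10%N -> size y' = 10%N ->
  List.Forall2 (res (2 * m)) us lie_basis ->
  Gam (2 * (2 * m)) g -> prodb us y = prodb us y' * g -> y = y'.
Proof.
move=> m0 sy sy' F /res_Gam2 rg E.
have := resM (res_prodb y' F) rg; rewrite -E => r'.
have := res_coord_uniq _ r' (res_prodb y F).
rewrite mat_addC mat_add0 !sumb_coord // => -> //; lia.
Qed.

Lemma layer_triv m us y : m <> 0%Z -> size y = 10%N ->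
  List.Forall2 (res (2 * m)) us lie_basis ->
  Gam (2 * (2 * m)) (prodb us y) -> y = nseq 10 false.
Proof.
move=> m0 sy F /res_Gam2 r0.
have := res_coord_uniq _ (res_prodb y F) r0; rewrite sumb_coord // => -> //; lia.
Qed.

(** ** Products of basis elements exhaust [EE N] *)
Section Exhaust.
Variable m : Z.
Let N := (2 * m)%Z.
Let K := (2 * N)%Z.
Hypothesis split : layer_split N.
Let per : tw_periodic K 2 N := tw_period2 split.
Let N2 : (2 | N) := Z.divide_factor_l 2 m.
Let bas := layer_basis N.

Lemma layer_basis_EE : List.Forall (EE N) bas.
Proof. by do 10?[constructor; first by first [exact: EE_tv | exact: Xv_EE]]; constructor. Qed.

(** The quotient EE N / EE (2 N) is abelian of exponent 2, so exponents may be
    added bit by bit. *)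
Lemma prodb_mul us y y' : List.Forall (EE N) us -> size y = size us -> size y' = size us ->
  exists2 z, size z = size us & prodb us y * prodb us y' == prodb us z %[EE K].
Proof.
move=> F; elim: F y y' => [|u us' Hu Hus IH] [|b y] [|b' y'] //= => [_ _|[sy] [sy']].
  by exists [::] => //; rewrite mulg1.
have [z sz E] := IH _ _ sy sy'.
exists ((b (+) b') :: z); first by rewrite /= sz.
have P := prodb_sub y (EE_sub N) Hus.
have -> : (if b then u else 1) * prodb us' y * ((if b' then u else 1) * prodb us' y') ==
  ((if b then u else 1) * (if b' then u else 1)) * (prodb us' y * prodb us' y') %[EE K].
  have -> : (if b then u else 1) * prodb us' y * ((if b' then u else 1) * prodb us' y') =
    (if b then u else 1) * (prodb us' y * (if b' then u else 1)) * prodb us' y' by rewrite !mulgA.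
  rewrite (EE_comm per N2 P (f := if b' then u else 1)) ?mulgA //.
  by case: b'; [|exact: gen1].
rewrite E /=; case: b b' => [] [] /=; rewrite ?mulg1 ?mul1g //.
by rewrite (EE_sqr per N2 Hu) mul1g.
Qed.

Definition exhausted g := exists2 y, size y = 10%N & g == prodb bas y %[EE K].

Lemma exhaustedM g h : exhausted g -> exhausted h -> exhausted (g * h).
Proof.
case=> y sy Ey [z sz Ez]; have [x sx Ex] := prodb_mul layer_basis_EE sy sz.
by exists x => //; rewrite Ey Ez.
Qed.

Lemma exhausted_nth i : (i < 10)%N -> exhausted (nth 1 bas i).
Proof.
move=> i10; exists (mkseq (fun j => j == i) 10); first by rewrite size_mkseq.
by do 10?[case: i i10 => [|i] i10 //=]; rewrite ?mulg1 ?mul1g.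
Qed.

Lemma exhausted1 : exhausted 1.
Proof. by exists (nseq 10 false) => //=; rewrite !mulg1. Qed.

Lemma exhausted_eq g h : g == h %[EE K] -> exhausted h -> exhausted g.
Proof. by move=> E [y sy Ey]; exists y; rewrite // E. Qed.

Lemma exhausted_Xv (a b c d : bool) : exhausted (Xv (Z.b2z a) (Z.b2z b) (Z.b2z c) (Z.b2z d) N).
Proof.
have H1 (a' b' c' d' : Z) : Xv a' b' c' d' N == Xv a' b' 0 d' N * Xv 0 b' c' d' N %[EE K].
  rewrite Xv_addl tv_K ?Z.add_0_r ?mulg1 // /N.
  by exists (m * (a' * c' - 0 * 0))%Z; ring.
have H2 (a' b' c' d' : Z) : Xv a' b' c' d' N == Xv a' b' c' 0 N * Xv a' 0 c' d' N %[EE K].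
  rewrite Xv_addr tv_K ?Z.add_0_r ?mulg1 // /N.
  by exists (m * (b' * d' - 0 * 0))%Z; ring.
have E0 g : g = 1 -> exhausted g by move=> ->; exact: exhausted1.
apply: exhausted_eq (H1 _ _ _ _) _; apply: exhaustedM.
  apply: exhausted_eq (H2 _ _ _ _) _; apply: exhaustedM.
    by case: a b => [] [] /=; [exact: (@exhausted_nth 4) | apply: E0; sp_ring..].
  by case: a d => [] [] /=; [exact: (@exhausted_nth 5) | apply: E0; sp_ring..].
apply: exhausted_eq (H2 _ _ _ _) _; apply: exhaustedM.
  by case: b c => [] [] /=; [exact: (@exhausted_nth 6) | apply: E0; sp_ring..].
by case: c d => [] [] /=; [exact: (@exhausted_nth 7) | apply: E0; sp_ring..].
Qed.

(** By periodicity the coordinates of w may be taken in {0, 1}; [tv_split] then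
    expresses it by the basis. *)
Lemma exhausted_tw w : exhausted (tw w N).
Proof.
case: w => a b c d.
pose w' := Vec (Z.b2z (Z.odd a)) (Z.b2z (Z.odd b)) (Z.b2z (Z.odd c)) (Z.b2z (Z.odd d)).
have /per E : vec_eqm 2 (Vec a b c d) w'.
  have H k : (2 | k - Z.b2z (Z.odd k))%Z.
    by exists (Z.div2 k); rewrite {1}(Z.div2_odd k); ring.
  by split; exact: H.
apply: (exhausted_eq E); rewrite /w' /= tv_split.
apply: exhaustedM; last exact: exhausted_Xv.
apply: exhaustedM.
  case: (Z.odd a) (Z.odd c) => [] [] /=.
  - exact: (@exhausted_nth 8).
  - exact: (@exhausted_nth 0).
  - exact: (@exhausted_nth 2).
  - have -> : tv 0 0 0 0 N = 1 by sp_ring.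
    exact: exhausted1.
case: (Z.odd b) (Z.odd d) => [] [] /=.
- exact: (@exhausted_nth 9).
- exact: (@exhausted_nth 1).
- exact: (@exhausted_nth 3).
- have -> : tv 0 0 0 0 N = 1 by sp_ring.
  exact: exhausted1.
Qed.

Lemma EE_exhausted g : EE N g -> exhausted g.
Proof.
elim=> {g} [|g [w ->]|g h _ Hg _ Hh|g Eg Hg]; [exact: exhausted1|exact: exhausted_tw|exact: exhaustedM|].
have E : g^-1 == g %[EE K].
  by apply: (@eqE_mulr _ _ _ g); rewrite mulVg (EE_sqr per N2 Eg).
by case: Hg => y sy Ey; exists y => //; rewrite E.
Qed.

(** An element of [EE N] is congruent modulo [EE (2 N)] to a product of basis
    elements; if it lies in Gam (2 N), all exponents vanish because the residues
    are independent. *)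
Lemma EE_next g : m <> 0%Z -> EE N g -> Gam K g -> EE K g.
Proof.
move=> m0 /EE_exhausted[y sy Ey] GK; apply: eqE1P; rewrite Ey.
suff -> : y = nseq 10 false by rewrite /= !mulg1.
have /EE_Gam GK' : EE K (g * (prodb bas y)^-1) := Ey.
apply: (layer_triv m0 sy (layer_basis_res N)).
exact: (subVr (Gam_sub K) (subMl (Gam_sub K) GK GK')).
Qed.

End Exhaust.

(** Each layer is descended with [EE_next], whose hypothesis is
    [layer_split_pow2]. *)
Theorem Gam_EE_pow2 k : (forall g, Gam 2 g -> EE 2 g) ->
  forall g, Gam (2 ^ Z.of_nat k.+1) g -> EE (2 ^ Z.of_nat k.+1) g.
Proof.
move=> base; elim: k => [|k IH] g; first exact: base.
have E j : (2 ^ Z.of_nat j.+1 = 2 * 2 ^ Z.of_nat j)%Z.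
  by rewrite Nat2Z.inj_succ Z.pow_succ_r //; exact: Nat2Z.is_nonneg.
move=> Gg; have /IH EEg : Gam (2 ^ Z.of_nat k.+1) g.
  by apply: Gam_dvd Gg; rewrite (E k.+1); exact: Z.divide_factor_r.
move: Gg EEg; rewrite (E k.+1) (E k) => Gg EEg.
apply: EE_next => //; first by rewrite -E; exact: layer_split_pow2.
have := Z.pow_pos_nonneg 2 (Z.of_nat k); lia.
Qed.

(** * The principal congruence subgroup of level 2 *)

Lemma act_mul A B v : act (mat_mul A B) v = act A (act B v).
Proof. by case: v => ? ? ? ?; mat_case; rewrite /=; congr Vec; ring. Qed.

Lemma actM (g h : Sp) v : act (g * h) v = act g (act h v).
Proof. by rewrite sp_matM act_mul. Qed.

(** As the quotient is even, the remainder is only bounded by |y|; parity makes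
    the inequality strict wherever this is used. *)
Lemma balanced_rem x y : y <> 0%Z -> exists k, (Z.abs (x + 2 * k * y) <= Z.abs y)%Z.
Proof.
move=> y0; set d := (2 * Z.abs y)%Z; have d0 : (0 < d)%Z by lia.
have E := Z.div_mod (x + Z.abs y) d; have := Z.mod_pos_bound (x + Z.abs y) d d0.
set q := Z.div _ _ in E *; set r := Z.modulo _ _ in E *.
exists (- (q * Z.sgn y))%Z; have -> : (x + 2 * - (q * Z.sgn y) * y = x - q * (2 * (y * Z.sgn y)))%Z by ring.
have -> : (y * Z.sgn y = Z.abs y)%Z by lia.
rewrite -/d; lia.
Qed.

(** The last row is (- d, b) divided by the gcd of b and d, and Bezout
    coefficients complete it. *)
Lemma bezout_kill b d : exists p q r s, (p * s - q * r = 1 /\ r * b + s * d = 0)%Z.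
Proof.
case: (Z.eq_dec (Z.gcd b d) 0) => [/Z.gcd_eq_0[-> ->]|g0].
  by exists 1%Z, 0%Z, 0%Z, 1%Z.
have [u [v E]] := Z.gcd_bezout b d _ (erefl _).
have [b' Eb] := Z.gcd_divide_l b d; have [d' Ed] := Z.gcd_divide_r b d.
set g := Z.gcd b d in g0 E Eb Ed *.
exists u, v, (- d')%Z, b'; split; last by rewrite Eb Ed; ring.
apply: (Z.mul_reg_r _ _ g g0).
have -> : ((u * b' - v * - d') * g = u * (b' * g) + v * (d' * g))%Z by ring.
by rewrite -Eb -Ed E; ring.
Qed.

Lemma SL2_sp p q r s : (p * s - q * r = 1)%Z ->
  symplectic (Mat 1 0 0 0  0 p 0 q  0 0 1 0  0 r 0 s).
Proof.
by move=> E; apply/andP; split; apply/eqP; rewrite /=; apply: Mat_eq; try ring; apply: (eq_shift E); ring.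
Qed.

Local Notation e1 := (Vec 1 0 0 0).
Local Notation e2 := (Vec 0 1 0 0).

Lemma Gam2_col0 g : Gam 2 g -> exists a b c d, act g e1 = Vec (1 + 2 * a) (2 * b) (2 * c) (2 * d).
Proof.
case=> X ->; exists (m00 X), (m10 X), (m20 X), (m30 X).
by mat_case; rewrite /=; congr Vec; ring.
Qed.

Lemma Gam2_col1 g : Gam 2 g -> exists a b c d, act g e2 = Vec (2 * a) (1 + 2 * b) (2 * c) (2 * d).
Proof.
case=> X ->; exists (m01 X), (m11 X), (m21 X), (m31 X).
by mat_case; rewrite /=; congr Vec; ring.
Qed.

Lemma EE_Xv2 a b c d n : (2 | n) -> EE 2 (Xv a b c d n).
Proof. by move=> n2; apply: EE_dvd n2 (Xv_EE _ _ _ _ _). Qed.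

(** A symplectic matrix fixing the first two basis vectors is block unipotent,
    with a symmetric block of even entries. *)
Lemma fix_e12 (g : Sp) : Gam 2 g -> act g e1 = e1 -> act g e2 = e2 -> EE 2 g.
Proof.
case=> X EX; have /andP[/eqP] := sp_matP g.
case: X EX => x00 x01 x02 x03 x10 x11 x12 x13 x20 x21 x22 x23 x30 x31 x32 x33 EX.
rewrite EX /= => F F'.
case: F => i00 i01 _ i03 i10 i11 _ _ _ _ _ _ _ _ _ _.
move: F' => _ [h0 h1 h2 h3] [k0 k1 k2 k3].
have {h0} Z0 : x00 = 0%Z by lia. have {h1} Z1 : x10 = 0%Z by lia.
have {h2} Z2 : x20 = 0%Z by lia. have {h3} Z3 : x30 = 0%Z by lia.
have {k0} Z4 : x01 = 0%Z by lia. have {k1} Z5 : x11 = 0%Z by lia.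
have {k2} Z6 : x21 = 0%Z by lia. have {k3} Z7 : x31 = 0%Z by lia.
subst.
have {i00} Z0 : x22 = 0%Z by lia. have {i01} Z1 : x32 = 0%Z by lia.
have {i10} Z2 : x23 = 0%Z by lia. have {i11} Z3 : x33 = 0%Z by lia.
subst; have {i03} Z0 : x12 = x03 by lia.
subst.
suff -> : g = tv 1 0 0 0 (2 * x02) * tv 0 1 0 0 (2 * x13) * Xv 1 1 0 0 (2 * x03).
  apply: genM; last by apply: EE_Xv2; exists x03; ring.
  by apply: genM; apply: EE_tvM; [exists x02 | exists x13]; ring.
by apply: Sp_eq; rewrite EX /=; apply: Mat_eq; ring.
Qed.

(** Minus the identity on the second plane. As -1 is congruent to 1 modulo 2, it
    is one of the signs that remain at the end of the Euclidean algorithm. *)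
Definition neg_plane2 : Sp := MkSp (erefl : symplectic (Mat 1 0 0 0  0 (-1) 0 0  0 0 1 0  0 0 0 (-1))).

Lemma EE_neg_plane2 : EE 2 neg_plane2.
Proof.
have -> : neg_plane2 = tv 0 0 0 1 2 * tv 0 1 0 0 2 * tv 0 1 0 (-1) 2 by exact: Sp_eq.
by do 2?apply: genM; exact: EE_tv.
Qed.

Lemma mulEE e g : EE 2 e -> EE 2 (e * g) -> EE 2 g.
Proof. exact: (subMl (EE_sub 2)). Qed.

(** The third coordinate of g e2 is <e1, g e2> = <g e1, g e2> = <e1, e2> = 0. *)
Lemma fixed_e1_third (g : Sp) a b c d : act g e1 = e1 -> act g e2 = Vec a b c d -> c = 0%Z.
Proof.
have /andP[/eqP + _] := sp_matP g.
case: (sp_mat g) => x00 x01 x02 x03 x10 x11 x12 x13 x20 x21 x22 x23 x30 x31 x32 x33.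
rewrite /=; case=> _ _ _ _ _ _ _ _ _ E _ _ _ _ _ _ [h0 h1 h2 h3] [k0 k1 k2 k3].
have Z0 : x00 = 1%Z by lia. have Z1 : x10 = 0%Z by lia.
have Z2 : x20 = 0%Z by lia. have Z3 : x30 = 0%Z by lia.
subst; lia.
Qed.

Lemma fix_e1_reduced (g : Sp) a b : Gam 2 g -> act g e1 = e1 ->
  act g e2 = Vec (2 * a) b 0 0 -> EE 2 g.
Proof.
move=> Gg g1 g2.
have b1 : (b = 1 \/ b = -1)%Z.
  apply: Z.divide_1_r; move: g1 g2; have /andP[/eqP + _] := sp_matP g.
  case: (sp_mat g) => x00 x01 x02 x03 x10 x11 x12 x13 x20 x21 x22 x23 x30 x31 x32 x33.
  rewrite /=; case=> e00 e01 _ _ e10 e11 _ _ _ _ _ _ _ _ _ _ [h0 h1 h2 h3] [k0 k1 k2 k3].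
  have Z0 : x00 = 1%Z by lia. have Z1 : x10 = 0%Z by lia.
  have Z2 : x20 = 0%Z by lia. have Z3 : x30 = 0%Z by lia.
  have Z4 : x21 = 0%Z by lia. have Z5 : x31 = 0%Z by lia.
  have Z6 : x11 = b%Z by lia.
  by subst; exists x33; lia.
wlog b0 : g b Gg g1 g2 b1 / (b = 1)%Z.
  move=> W; case: b1 => b1; first by apply: (W g b) => //; left.
  apply: (mulEE EE_neg_plane2); apply: (W (neg_plane2 * g) 1%Z) => //; last by left.
  - by apply: (subM (Gam_sub 2)) => //; exact/EE_Gam/EE_neg_plane2.
  - by rewrite actM g1.
  - by rewrite actM g2 b1 /=; congr Vec; ring.
have E : EE 2 (Xv 1 0 0 1 (2 * a)) by apply: EE_Xv2; exists a; ring.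
apply: (mulEE E); apply: fix_e12; first by apply: (subM (Gam_sub 2)) => //; exact: EE_Gam.
- by rewrite actM g1 /=; congr Vec; ring.
- by rewrite actM g2 b0 /=; congr Vec; ring.
Qed.

(** Euclid's algorithm with even quotients, on the second and fourth entries of
    the second column. One is odd and the other even, so the inequality in
    [balanced_rem] is strict. *)
Lemma fix_e1 n (g : Sp) : Gam 2 g -> act g e1 = e1 ->
  (Z.abs (v1 (act g e2)) < Z.of_nat n)%Z -> EE 2 g.
Proof.
elim: n g => [|n IH] g Gg g1; first by lia.
have [a [b [c [d g2]]]] := Gam2_col1 Gg.
have c0 := fixed_e1_third g1 g2.
rewrite g2 /= => lt; rewrite c0 in g2.
have [k lek] := @balanced_rem (2 * d)%Z (1 + 2 * b)%Z ltac:(lia).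
have E : EE 2 (tv 0 0 0 1 (2 * - k)) by apply: EE_tvM; exists (- k)%Z; ring.
apply: (mulEE E).
set g' := _ * g.
have Gg' : Gam 2 g' by apply: (subM (Gam_sub 2)) => //; exact: EE_Gam.
have g1' : act g' e1 = e1 by rewrite actM g1 /=; congr Vec; ring.
have g2' : act g' e2 = Vec (2 * a) (1 + 2 * b) 0 (2 * (d + k * (1 + 2 * b))).
  by rewrite actM g2 /=; congr Vec; ring.
case: (Z.eq_dec (d + k * (1 + 2 * b)) 0) => [d0|d0].
  by rewrite d0 Z.mul_0_r in g2'; exact: fix_e1_reduced g2'.
move: g' Gg' g1' g2' {Gg g1 g2 E} => {}g Gg g1 g2.
have {}lek : (Z.abs (2 * (d + k * (1 + 2 * b))) <= Z.abs (1 + 2 * b))%Z.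
  by move: lek; congr (Z.abs _ <= _)%Z; ring.
move: {d}(d + k * _)%Z d0 lek g2 => d d0 lek g2.
have [j lej] := @balanced_rem (1 + 2 * b)%Z (2 * d)%Z ltac:(lia).
have E : EE 2 (tv 0 1 0 0 (2 * j)) by apply: EE_tvM; exists j; ring.
apply: (mulEE E); apply: IH; first by apply: (subM (Gam_sub 2)) => //; exact: EE_Gam.
- by rewrite actM g1 /=; congr Vec; ring.
- rewrite actM g2 /=.
  have -> : ((1 - 2 * j * 1 * 0) * (1 + 2 * b) = 1 + 2 * b)%Z by ring.
  have -> : (2 * j * 1 * 1 * (2 * d) = 2 * j * (2 * d))%Z by ring.
  lia.
Qed.

Lemma conjEE h g : EE 2 (h * g * h^-1) -> EE 2 g.
Proof.
move/(EE_normal h^-1); by rewrite invgK !mulgA mulVg mul1g mulgVK.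
Qed.

Definition neg_plane1 : Sp := MkSp (erefl : symplectic (Mat (-1) 0 0 0  0 1 0 0  0 0 (-1) 0  0 0 0 1)).

Lemma EE_neg_plane1 : EE 2 neg_plane1.
Proof.
have -> : neg_plane1 = tv 0 0 1 0 2 * tv 1 0 0 0 2 * tv 1 0 (-1) 0 2 by exact: Sp_eq.
by do 2?apply: genM; exact: EE_tv.
Qed.

Lemma Gam2_mul e g : EE 2 e -> Gam 2 g -> Gam 2 (e * g).
Proof. by move=> /EE_Gam Ge Gg; exact: (subM (Gam_sub 2)). Qed.

Lemma col_e1_reduced (g : Sp) a : Gam 2 g -> act g e1 = Vec a 0 0 0 -> EE 2 g.
Proof.
move=> Gg g1.
have a1 : (a = 1 \/ a = -1)%Z.
  apply: Z.divide_1_r; move: g1; have /andP[/eqP + _] := sp_matP g.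
  case: (sp_mat g) => x00 x01 x02 x03 x10 x11 x12 x13 x20 x21 x22 x23 x30 x31 x32 x33.
  rewrite /=; case=> e00 _ _ _ _ _ _ _ _ _ _ _ _ _ _ _ [h0 h1 h2 h3].
  have Z0 : x00 = a%Z by lia. have Z1 : x10 = 0%Z by lia.
  have Z2 : x20 = 0%Z by lia. have Z3 : x30 = 0%Z by lia.
  by subst; exists x22; lia.
have F (h : Sp) : Gam 2 h -> act h e1 = e1 -> EE 2 h.
  by move=> Gh h1; apply: (@fix_e1 (Z.to_nat (Z.abs (v1 (act h e2)) + 1))) => //; lia.
case: a1 => a1; rewrite a1 in g1; first exact: F.
apply: (mulEE EE_neg_plane1); apply: F; first exact: Gam2_mul EE_neg_plane1 Gg.
by rewrite actM g1.
Qed.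

(** The same algorithm on the first column. Conjugation by SL(2) on the second
    plane, under which [EE 2] is stable, first cancels the fourth entry; then
    multiples of the odd entry are removed from the two even ones, and a nonzero
    even remainder reduces the odd entry. *)
Theorem Gam2_EE2 (g : Sp) : Gam 2 g -> EE 2 g.
Proof.
suff: forall n g, Gam 2 g -> (Z.abs (v0 (act g e1)) < Z.of_nat n)%Z -> EE 2 g.
  by move=> H Gg; apply: (H (Z.to_nat (Z.abs (v0 (act g e1)) + 1))) => //; lia.
elim=> [|n IH] {}g Gg; first by lia.
wlog [a [b [c g1]]] : g Gg / exists a b c, act g e1 = Vec (1 + 2 * a) (2 * b) (2 * c) 0.
  move=> W; have [a [b [c [d g1]]]] := Gam2_col0 Gg.
  have [p [q [r [s [E kill]]]]] := bezout_kill (2 * b) (2 * d).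
  pose h := MkSp (SL2_sp E) => lt; apply: (@conjEE h); apply: W.
  - exact: Gam_normal.
  - exists a, (p * b + q * d)%Z, c; rewrite !actM.
    have -> : act h^-1 e1 = e1 by rewrite /=; congr Vec; ring.
    by rewrite g1 /=; congr Vec; [ring | ring | ring | apply: (eq_shift kill); ring].
  - rewrite !actM; have -> : act h^-1 e1 = e1 by rewrite /=; congr Vec; ring.
    move: lt; rewrite g1 /=; lia.
rewrite g1 /= => lt.
have [k lek] := @balanced_rem (2 * c)%Z (1 + 2 * a)%Z ltac:(lia).
have [j lej] := @balanced_rem (2 * b)%Z (1 + 2 * a)%Z ltac:(lia).
have E : EE 2 (tv 0 0 1 0 (2 * - k)) by apply: EE_tvM; exists (- k)%Z; ring.
have F : EE 2 (Xv 0 1 1 0 (2 * - j)) by apply: EE_Xv2; exists (- j)%Z; ring.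
apply: (mulEE E); apply: (mulEE F).
set g' := _ * (_ * g).
have Gg' : Gam 2 g' by apply: (Gam2_mul F); exact: (Gam2_mul E).
have g1' : act g' e1 = Vec (1 + 2 * a) (2 * (b + j * (1 + 2 * a))) (2 * (c + k * (1 + 2 * a))) 0.
  by rewrite !actM g1 /=; congr Vec; ring.
have {}lek : (Z.abs (2 * (c + k * (1 + 2 * a))) <= Z.abs (1 + 2 * a))%Z.
  by move: lek; congr (Z.abs _ <= _)%Z; ring.
have {}lej : (Z.abs (2 * (b + j * (1 + 2 * a))) <= Z.abs (1 + 2 * a))%Z.
  by move: lej; congr (Z.abs _ <= _)%Z; ring.
move: g' Gg' g1' lek lej {Gg g1 E F} => {}g Gg.
move: {b}(b + j * _)%Z {c}(c + k * _)%Z => b c g1 lec leb {k j}.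
case: (Z.eq_dec c 0) => [c0|c0].
  rewrite c0 Z.mul_0_r in g1; case: (Z.eq_dec b 0) => [b0|b0].
    by rewrite b0 Z.mul_0_r in g1; exact: col_e1_reduced g1.
  have [k lek] := @balanced_rem (1 + 2 * a)%Z (2 * b)%Z ltac:(lia).
  have E : EE 2 (Xv 1 0 0 1 (2 * - k)) by apply: EE_Xv2; exists (- k)%Z; ring.
  apply: (mulEE E); apply: IH; first exact: (Gam2_mul E).
  rewrite actM g1 /=.
  have -> : (- (2 * - k) * 1 * 1 * (2 * b) = 2 * k * (2 * b))%Z by ring.
  lia.
have [k lek] := @balanced_rem (1 + 2 * a)%Z (2 * c)%Z ltac:(lia).
have E : EE 2 (tv 1 0 0 0 (2 * k)) by apply: EE_tvM; exists k; ring.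
apply: (mulEE E); apply: IH; first exact: (Gam2_mul E).
rewrite actM g1 /=.
have -> : ((1 - 2 * k * 1 * 0) * (1 + 2 * a) = 1 + 2 * a)%Z by ring.
have -> : (2 * k * 1 * 1 * (2 * c) = 2 * k * (2 * c))%Z by ring.
lia.
Qed.

(** * From finitely many root elements to all transvections *)

(** One element of exponent n for each of the eight roots. *)
Record root_elements n (H : Sp -> Prop) : Prop := RootElements {
  root_e1 : H (tv 1 0 0 0 n); root_e2 : H (tv 0 1 0 0 n);
  root_e3 : H (tv 0 0 1 0 n); root_e4 : H (tv 0 0 0 1 n);
  root_12 : H (Xv 1 1 0 0 n); root_14 : H (Xv 1 0 0 1 n);
  root_23 : H (Xv 0 1 1 0 n); root_34 : H (Xv 0 0 1 1 n) }.

Lemma one_param (f : Z -> Sp) H n m : subgroup H ->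
  (forall x y, f x * f y = f (x + y)%Z) -> H (f n) -> (n | m) -> H (f m).
Proof.
move=> sH fD Hn [k ->]; have f0 : f 0%Z = 1.
  by apply: (@mulgI _ (f 0%Z)); rewrite fD mulg1.
have fN x : f (- x)%Z = (f x)^-1.
  by apply: (@mulgI _ (f x)); rewrite fD mulgV Z.add_opp_diag_r.
elim/Z.peano_ind: k => [|k IH|k IH].
- by rewrite Z.mul_0_l f0; exact: sub1.
- by rewrite Z.mul_succ_l -fD; exact: subM.
- by rewrite Z.mul_pred_l -Z.add_opp_r -fD fN; apply: subM => //; exact: subV.
Qed.

Lemma tvM_sub H a b c d n m : subgroup H -> H (tv a b c d n) -> (n | m) -> H (tv a b c d m).
Proof. by move=> sH; apply: one_param => // x y; exact: tvD. Qed.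

Lemma XvD a b c d m n : Xv a b c d m * Xv a b c d n = Xv a b c d (m + n).
Proof. sp_ring. Qed.

Lemma XvM_sub H a b c d n m : subgroup H -> H (Xv a b c d n) -> (n | m) -> H (Xv a b c d m).
Proof. by move=> sH; apply: one_param => // x y; exact: XvD. Qed.

Lemma S12_sp a b c d n : symplectic
  (Mat (1 - n * d * c) (- n * d * d) (n * 2 * d * a) (n * (d * b - c * a))
       (n * c * c) (1 + n * c * d) (n * (b * d - c * a)) (- n * 2 * c * b)
       0 0 (1 + n * c * d) (- n * c * c)
       0 0 (n * d * d) (1 - n * d * c)).
Proof. by apply/andP; split; apply/eqP; rewrite /=; apply: Mat_eq; ring. Qed.

(** The element 1 + n (u w^* + w u^* ), where w = (a, b, c, d), u = (d, - c, 0,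
    0) is orthogonal to w and u^* is the linear form x |-> <u, x>. *)
Definition S12 a b c d n := MkSp (S12_sp a b c d n).

Lemma S14_sp a b c d n : symplectic
  (Mat (1 - n * b * c) (- n * (b * d + a * c)) (n * 2 * a * b) (n * b * b)
       0 (1 - n * b * c) (n * b * b) 0
       0 (- n * c * c) (1 + n * b * c) 0
       (- n * c * c) (- n * 2 * c * d) (n * (c * a + d * b)) (1 + n * b * c)).
Proof. by apply/andP; split; apply/eqP; rewrite /=; apply: Mat_eq; ring. Qed.

(** The same for u = (b, 0, 0, c). *)
Definition S14 a b c d n := MkSp (S14_sp a b c d n).

(** Both are in the Heisenberg group attached to w, where the commutator of the
    elements given by u and u' is the transvection power of w with exponent
    proportional to <u, u'>, here - c^2. *)
Lemma S12_S14 a b c d x y :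
  S12 a b c d x * S14 a b c d y =
  S14 a b c d y * S12 a b c d x * tv a b c d (- (2 * x * y * c * c)).
Proof. sp_ring. Qed.

Lemma lag12_sp p q r : symplectic (Mat 1 0 p r  0 1 r q  0 0 1 0  0 0 0 1).
Proof. by apply/andP; split; apply/eqP; rewrite /=; apply: Mat_eq; ring. Qed.
(** The unipotent radical of the stabilizer of the Lagrangian spanned by the
    first two basis vectors; [lag14] is that for the first and the fourth. *)
Definition lag12 p q r := MkSp (lag12_sp p q r).

Lemma lag14_sp p q r : symplectic (Mat 1 (- r) p 0  0 1 0 0  0 0 1 0  0 (- q) r 1).
Proof. by apply/andP; split; apply/eqP; rewrite /=; apply: Mat_eq; ring. Qed.
Definition lag14 p q r := MkSp (lag14_sp p q r).

Lemma lag12E p q r : lag12 p q r = tv 1 0 0 0 p * tv 0 1 0 0 q * Xv 1 1 0 0 r.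
Proof. sp_ring. Qed.

Lemma lag14E p q r : lag14 p q r = tv 1 0 0 0 p * tv 0 0 0 1 q * Xv 1 0 0 1 r.
Proof. sp_ring. Qed.

(** Write w as the sum of its components in two complementary Lagrangians; the
    error of additivity is supported in the Lagrangian containing u. *)
Lemma S12_split a b c d x :
  let m := (x * x * (a * c + b * d))%Z in
  S12 a b c d x = S12 0 0 c d x *
    lag12 (2 * x * d * a + m * d * d) (m * c * c - 2 * x * c * b) (x * (d * b - c * a) - m * c * d).
Proof. rewrite /=; sp_ring. Qed.

Lemma S14_split a b c d x :
  let m := (x * x * (a * c - b * d))%Z in
  S14 a b c d x = S14 0 b c 0 x *
    lag14 (2 * x * a * b + m * b * b) (2 * x * c * d + m * c * c) (x * (b * d + a * c) + m * b * c).
Proof. rewrite /=; sp_ring. Qed.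

(** The conjugate of a transvection of w' = (0, 0, c, d) by a Lagrangian element
    is the transvection of w' + n c u; expanding it gives the Eichler element of
    u and w' up to a Lagrangian element. *)
Lemma S12_conj c d n :
  S12 0 0 c d (n * n * c) * lag12 (n * n * n * c * c * d * d) (n * n * n * c * c * c * c)
      (- (n * n * n * c * c * c * d)) =
  tv (n * c * d) (- (n * c * c)) c d n * tv 0 0 c d (- n).
Proof. sp_ring. Qed.

Lemma S14_conj b c n :
  S14 0 b c 0 (n * n * c) * lag14 (n * n * n * c * c * b * b) (n * n * n * c * c * c * c)
      (n * n * n * c * c * c * b) =
  tv (n * c * b) b c (n * c * c) n * tv 0 b c 0 (- n).
Proof. sp_ring. Qed.

Section Siegel.
Variables (n : Z) (H : Sp -> Prop).
Hypothesis sH : subgroup H.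
Hypothesis rH : root_elements n H.

Lemma lag12_in p q r : (n | p)%Z -> (n | q)%Z -> (n | r)%Z -> H (lag12 p q r).
Proof.
move=> np nq nr; rewrite lag12E; apply: (subM sH); first apply: (subM sH).
- exact: (tvM_sub sH (root_e1 rH)).
- exact: (tvM_sub sH (root_e2 rH)).
- exact: (XvM_sub sH (root_12 rH)).
Qed.

Lemma lag14_in p q r : (n | p)%Z -> (n | q)%Z -> (n | r)%Z -> H (lag14 p q r).
Proof.
move=> np nq nr; rewrite lag14E; apply: (subM sH); first apply: (subM sH).
- exact: (tvM_sub sH (root_e1 rH)).
- exact: (tvM_sub sH (root_e4 rH)).
- exact: (XvM_sub sH (root_14 rH)).
Qed.

Lemma tv_34 c d : H (tv 0 0 c d n).
Proof.
have -> : tv 0 0 c d n = tv 0 0 1 0 (n * (c * c)) * tv 0 0 0 1 (n * (d * d)) * Xv 0 0 1 1 (n * (c * d)).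
  by sp_ring.
apply: (subM sH); first apply: (subM sH).
- exact: (tvM_sub sH (root_e3 rH) (Z.divide_factor_l _ _)).
- exact: (tvM_sub sH (root_e4 rH) (Z.divide_factor_l _ _)).
- exact: (XvM_sub sH (root_34 rH) (Z.divide_factor_l _ _)).
Qed.

Lemma tv_23 b c : H (tv 0 b c 0 n).
Proof.
have -> : tv 0 b c 0 n = tv 0 1 0 0 (n * (b * b)) * tv 0 0 1 0 (n * (c * c)) * Xv 0 1 1 0 (n * (b * c)).
  by sp_ring.
apply: (subM sH); first apply: (subM sH).
- exact: (tvM_sub sH (root_e2 rH) (Z.divide_factor_l _ _)).
- exact: (tvM_sub sH (root_e3 rH) (Z.divide_factor_l _ _)).
- exact: (XvM_sub sH (root_23 rH) (Z.divide_factor_l _ _)).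
Qed.

Lemma conj_sub g h : H g -> H h -> H (g * h * g^-1).
Proof. by move=> Hg Hh; apply: (subM sH); [exact: (subM sH) | exact: (subV sH)]. Qed.

(** For exponent n^2 c the element decomposes by [S12_split] into Lagrangian
    elements, whose exponents are divisible by n, and an element that [S12_conj]
    expresses by transvections. *)
Lemma S12_in a b c d : H (S12 a b c d (n * n * c)).
Proof.
have E : H (tv (n * c * d) (- (n * c * c)) c d n).
  have -> : tv (n * c * d) (- (n * c * c)) c d n =
      lag12 (2 * n * d) 0 (- (n * c)) * tw (Vec 0 0 c d) n * (lag12 (2 * n * d) 0 (- (n * c)))^-1.
    by rewrite twJ /=; congr tv; ring.
  apply: conj_sub; last exact: tv_34.
  by apply: lag12_in; [exists (2 * d)%Z | exists 0%Z | exists (- c)%Z]; ring.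
have F : H (S12 0 0 c d (n * n * c)).
  apply: (subMr sH (h := lag12 (n * n * n * c * c * d * d) (n * n * n * c * c * c * c)
      (- (n * n * n * c * c * c * d)))); last first.
    by rewrite S12_conj -tvV; apply: (subM sH E); apply: (subV sH); exact: tv_34.
  by apply: lag12_in; [exists (n * n * c * c * d * d)%Z | exists (n * n * c * c * c * c)%Z | exists (- (n * n * c * c * c * d))%Z]; ring.
rewrite S12_split; apply: (subM sH F).
set k := (a * c + b * d)%Z.
apply: lag12_in.
- exists (2 * n * c * d * a + n * c * (n * n * c) * k * d * d)%Z; ring.
- exists (n * c * (n * n * c) * k * c * c - 2 * n * c * c * b)%Z; ring.
- exists (n * c * (d * b - c * a) - n * c * (n * n * c) * k * c * d)%Z; ring.
Qed.

Lemma S14_in a b c d : H (S14 a b c d (n * n * c)).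
Proof.
have E : H (tv (n * c * b) b c (n * c * c) n).
  have -> : tv (n * c * b) b c (n * c * c) n =
      lag14 (2 * n * b) 0 (n * c) * tw (Vec 0 b c 0) n * (lag14 (2 * n * b) 0 (n * c))^-1.
    by rewrite twJ /=; congr tv; ring.
  apply: conj_sub; last exact: tv_23.
  by apply: lag14_in; [exists (2 * b)%Z | exists 0%Z | exists c]; ring.
have F : H (S14 0 b c 0 (n * n * c)).
  apply: (subMr sH (h := lag14 (n * n * n * c * c * b * b) (n * n * n * c * c * c * c)
      (n * n * n * c * c * c * b))); last first.
    by rewrite S14_conj -tvV; apply: (subM sH E); apply: (subV sH); exact: tv_23.
  by apply: lag14_in; [exists (n * n * c * c * b * b)%Z | exists (n * n * c * c * c * c)%Z | exists (n * n * c * c * c * b)%Z]; ring.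
rewrite S14_split; apply: (subM sH F).
set k := (a * c - b * d)%Z.
apply: lag14_in.
- exists (2 * n * c * a * b + n * c * (n * n * c) * k * b * b)%Z; ring.
- exists (2 * n * c * c * d + n * c * (n * n * c) * k * c * c)%Z; ring.
- exists (n * c * (b * d + a * c) + n * c * (n * n * c) * k * b * c)%Z; ring.
Qed.

(** The commutator of [S12_in] and [S14_in]. *)
Lemma tv_in_third a b c d : H (tv a b c d (2 * n ^ 4 * c ^ 4)).
Proof.
have A := S12_in a b c d; have B := S14_in a b c d.
have E := S12_S14 a b c d (n * n * c) (n * n * c).
have : H (tv a b c d (- (2 * (n * n * c) * (n * n * c) * c * c))).
  apply: (subMl sH (subM sH B A)); rewrite -E; exact: (subM sH).
move/(subV sH); rewrite tvV Z.opp_involutive; congr (H (tv _ _ _ _ _)); ring.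
Qed.

End Siegel.

Section AllTransvections.
Variables (n : Z) (H : Sp -> Prop).
Hypothesis sH : subgroup H.
Hypothesis rH : root_elements n H.

Let conj_by g x := H (g^-1 * x * g).

Lemma conj_by_sub g : subgroup (conj_by g).
Proof.
rewrite /conj_by; split.
- by rewrite mulg1 mulVg; exact: (sub1 sH).
- move=> x y Hx Hy; have -> : g^-1 * (x * y) * g = (g^-1 * x * g) * (g^-1 * y * g).
    by rewrite !mulgA mulgK.
  exact: (subM sH).
- move=> x Hx; have -> : g^-1 * x^-1 * g = (g^-1 * x * g)^-1 by rewrite !invgM invgK mulgA.
  exact: (subV sH).
Qed.

Lemma conj_by_J : root_elements n (conj_by Jsp).
Proof.
case: rH => r1 r2 r3 r4 r12 r14 r23 r34; split; rewrite /conj_by.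
- by have -> : Jsp^-1 * tv 1 0 0 0 n * Jsp = tv 0 0 1 0 n by sp_ring.
- by have -> : Jsp^-1 * tv 0 1 0 0 n * Jsp = tv 0 1 0 0 n by sp_ring.
- by have -> : Jsp^-1 * tv 0 0 1 0 n * Jsp = tv 1 0 0 0 n by sp_ring.
- by have -> : Jsp^-1 * tv 0 0 0 1 n * Jsp = tv 0 0 0 1 n by sp_ring.
- by have -> : Jsp^-1 * Xv 1 1 0 0 n * Jsp = Xv 0 1 1 0 n by sp_ring.
- by have -> : Jsp^-1 * Xv 1 0 0 1 n * Jsp = Xv 0 0 1 1 n by sp_ring.
- have -> : Jsp^-1 * Xv 0 1 1 0 n * Jsp = (Xv 1 1 0 0 n)^-1 by sp_ring.
  exact: (subV sH).
- have -> : Jsp^-1 * Xv 0 0 1 1 n * Jsp = (Xv 1 0 0 1 n)^-1 by sp_ring.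
  exact: (subV sH).
Qed.

Lemma conj_by_W : root_elements n (conj_by Wsp).
Proof.
case: rH => r1 r2 r3 r4 r12 r14 r23 r34; split; rewrite /conj_by.
- by have -> : Wsp^-1 * tv 1 0 0 0 n * Wsp = tv 0 1 0 0 n by sp_ring.
- by have -> : Wsp^-1 * tv 0 1 0 0 n * Wsp = tv 1 0 0 0 n by sp_ring.
- by have -> : Wsp^-1 * tv 0 0 1 0 n * Wsp = tv 0 0 0 1 n by sp_ring.
- by have -> : Wsp^-1 * tv 0 0 0 1 n * Wsp = tv 0 0 1 0 n by sp_ring.
- by have -> : Wsp^-1 * Xv 1 1 0 0 n * Wsp = Xv 1 1 0 0 n by sp_ring.
- by have -> : Wsp^-1 * Xv 1 0 0 1 n * Wsp = Xv 0 1 1 0 n by sp_ring.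
- by have -> : Wsp^-1 * Xv 0 1 1 0 n * Wsp = Xv 1 0 0 1 n by sp_ring.
- by have -> : Wsp^-1 * Xv 0 0 1 1 n * Wsp = Xv 0 0 1 1 n by sp_ring.
Qed.

Lemma conj_by_tw g w k : conj_by g (tw (act g w) k) -> H (tw w k).
Proof. by rewrite /conj_by -twJ !mulgA mulVg mul1g mulgVK. Qed.

End AllTransvections.

(** The Weyl group permutes the coordinates up to sign, and preserves the
    hypothesis on root elements. *)
Lemma tv_in_pow4 n H a b c d : subgroup H -> root_elements n H ->
  [/\ H (tv a b c d (2 * n ^ 4 * a ^ 4)), H (tv a b c d (2 * n ^ 4 * b ^ 4)),
      H (tv a b c d (2 * n ^ 4 * c ^ 4)) & H (tv a b c d (2 * n ^ 4 * d ^ 4))].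
Proof.
move=> sH rH; have third := tv_in_third sH rH.
have first_ H' a' b' c' d' : subgroup H' -> root_elements n H' -> H' (tv a' b' c' d' (2 * n ^ 4 * a' ^ 4)).
  move=> sH' rH'; apply: (conj_by_tw (g := Jsp) (w := Vec a' b' c' d')).
  have := tv_in_third (conj_by_sub sH' Jsp) (conj_by_J sH' rH') c' b' (- a') d'.
  by rewrite act_J; have -> : ((- a') ^ 4 = a' ^ 4)%Z by ring.
split=> //; first exact: first_.
- apply: (conj_by_tw (g := Wsp) (w := Vec a b c d)); rewrite act_W.
  exact: first_ (conj_by_sub sH Wsp) (conj_by_W rH).
- apply: (conj_by_tw (g := Wsp) (w := Vec a b c d)); rewrite act_W.
  exact: tv_in_third (conj_by_sub sH Wsp) (conj_by_W rH) _ _ _ _.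
Qed.

(** Fourth powers of coprime integers are coprime. *)
Lemma pow4_gcd (I : Z -> Prop) a b :
  (forall x y, I x -> I y -> I (x + y)%Z) -> (forall x y, I x -> I (y * x)%Z) ->
  I (a ^ 4)%Z -> I (b ^ 4)%Z -> I (Z.gcd a b ^ 4)%Z.
Proof.
move=> ID IM Ia Ib; case: (Z.eq_dec (Z.gcd a b) 0) => [g0|g0].
  by case/Z.gcd_eq_0: (g0) => a0 b0; rewrite g0 -a0.
have [a' Ea] := Z.gcd_divide_l a b; have [b' Eb] := Z.gcd_divide_r a b.
set g := Z.gcd a b in g0 Ea Eb *.
have cop : Znumtheory.rel_prime a' b'.
  have [u [v E]] := Z.gcd_bezout a b _ (erefl _).
  apply: Znumtheory.bezout_rel_prime; apply: (Znumtheory.Bezout_intro _ _ _ u v).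
  apply: (Z.mul_reg_r _ _ g g0); rewrite -/g in E.
  have -> : ((u * a' + v * b') * g = u * (a' * g) + v * (b' * g))%Z by ring.
  by rewrite -Ea -Eb E; ring.
have /Znumtheory.rel_prime_bezout[u v E] : Znumtheory.rel_prime (a' ^ 4) (b' ^ 4).
  by apply: Zpow_facts.rel_prime_Zpower.
have -> : (g ^ 4 = u * a ^ 4 + v * b ^ 4)%Z.
  rewrite Ea Eb; transitivity ((u * a' ^ 4 + v * b' ^ 4) * g ^ 4)%Z; last by ring.
  by rewrite E; ring.
by apply: ID; exact: IM.
Qed.

(** For primitive w, the exponents k * c^4 for the four coordinates c of w
    generate k Z. The general case follows because the transvection of g w is
    the g^2-th power of that of w. *)
Theorem root_elements_EE n H : subgroup H -> root_elements n H ->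
  forall g, EE (2 * n ^ 4) g -> H g.
Proof.
move=> sH rH; apply: gen_min => // _ [[a b c d] ->]; rewrite [tw _ _]/=.
set k := (2 * n ^ 4)%Z.
wlog g1 : a b c d / Z.gcd (Z.gcd a b) (Z.gcd c d) = 1%Z.
  move=> W; set g := Z.gcd (Z.gcd a b) (Z.gcd c d).
  have [x Ex] := Z.gcd_divide_l (Z.gcd a b) (Z.gcd c d).
  have [y Ey] := Z.gcd_divide_r (Z.gcd a b) (Z.gcd c d).
  have [a' Ea] := Z.gcd_divide_l a b; have [b' Eb] := Z.gcd_divide_r a b.
  have [c' Ec] := Z.gcd_divide_l c d; have [d' Ed] := Z.gcd_divide_r c d.
  rewrite -/g in Ex Ey.
  case: (Z.eq_dec g 0) => g0.
    have [/Z.gcd_eq_0[-> ->] /Z.gcd_eq_0[-> ->]] := proj1 (Z.gcd_eq_0 _ _) g0.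
    have -> : tv 0 0 0 0 k = 1 by sp_ring.
    exact: (sub1 sH).
  have -> : tv a b c d k = tv (a' * x) (b' * x) (c' * y) (d' * y) (g * g * k).
    rewrite -tvZ; congr tv.
    + by rewrite {1}Ea Ex; ring.
    + by rewrite {1}Eb Ex; ring.
    + by rewrite {1}Ec Ey; ring.
    + by rewrite {1}Ed Ey; ring.
  apply: (tvM_sub sH (n := k)); last by exists (g * g)%Z.
  apply: W; apply: (Z.mul_reg_l _ _ g g0).
  have gnn : (0 <= g)%Z := Z.gcd_nonneg _ _.
  rewrite -Z.gcd_mul_mono_l_nonneg // -!Z.gcd_mul_mono_l_nonneg //.
  have -> : (g * (a' * x) = a)%Z by rewrite [RHS]Ea Ex; ring.
  have -> : (g * (b' * x) = b)%Z by rewrite [RHS]Eb Ex; ring.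
  have -> : (g * (c' * y) = c)%Z by rewrite [RHS]Ec Ey; ring.
  have -> : (g * (d' * y) = d)%Z by rewrite [RHS]Ed Ey; ring.
  by rewrite -/g Z.mul_1_r.
have [Ia Ib Ic Id] := tv_in_pow4 a b c d sH rH.
pose I x := H (tv a b c d (k * x)).
have ID x y : I x -> I y -> I (x + y)%Z.
  by rewrite /I => Hx Hy; rewrite Z.mul_add_distr_l -tvD; exact: (subM sH).
have IM x y : I x -> I (y * x)%Z.
  by rewrite /I => Hx; apply: (tvM_sub sH Hx); exists y; ring.
have := pow4_gcd ID IM (pow4_gcd ID IM Ia Ib) (pow4_gcd ID IM Ic Id).
by rewrite g1 /I Z.mul_1_r.
Qed.

(** * Subgroups of finite index over the principal congruence subgroup of level 32 *)

Definition cong32 (A B : mat) := exists X, A = mat_add B (mat_scale 32 X).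

Definition mat_map (f : Z -> Z) (A : mat) : mat := seq_mat (map f (mat_seq A)).

Definition red32 := mat_map (fun x => Z.modulo x 32).

Lemma cong32_refl A : cong32 A A.
Proof. by exists mat0; mat_ring. Qed.

Lemma cong32_mul A A' B B' : cong32 A A' -> cong32 B B' -> cong32 (mat_mul A B) (mat_mul A' B').
Proof.
case=> X -> [Y ->].
exists (mat_add (mat_add (mat_mul A' Y) (mat_mul X B')) (mat_scale 32 (mat_mul X Y))).
mat_ring.
Qed.

Lemma cong32_adj A A' : cong32 A A' -> cong32 (mat_adj A) (mat_adj A').
Proof. by case=> X ->; exists (mat_adj X); mat_ring. Qed.

Lemma cong32_trans A B C : cong32 A B -> cong32 B C -> cong32 A C.
Proof. by case=> X -> [Y ->]; exists (mat_add X Y); mat_ring. Qed.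

Lemma cong32_red A : cong32 A (red32 A).
Proof.
exists (mat_map (fun x => Z.div x 32) A).
have E x : x = (Z.modulo x 32 + 32 * Z.div x 32)%Z.
  by rewrite {1}(Z.div_mod x 32) //; ring.
by case: A => *; rewrite /mat_map /=; apply: Mat_eq; exact: E.
Qed.

(** A step of a polycyclic sequence: a matrix modulo 32, the level N of the
    layer where it lives and the positions of the entries whose sum modulo 2 is
    the coordinate, in that layer, that singles it out. *)
Definition datum := (mat * Z * seq nat)%type.

Definition layer_coord (p : seq nat) (X : mat) : bool :=
  foldr (fun i b => Z.odd (nth 0%Z (mat_seq X) i) (+) b) false p.

Definition layer_part (N : Z) (A : mat) : mat :=
  mat_map (fun x => Z.div x N) (mat_add A (mat_scale (-1) mat1)).

(** Membership test: the coordinate of A along each step decides whether that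
    step is divided out. *)
Fixpoint sift (ds : seq datum) (A : mat) : bool :=
  match ds with
  | [::] => A == mat1
  | (B, N, p) :: ds' =>
      sift ds' (if layer_coord p (layer_part N A) then red32 (mat_mul (mat_adj B) A) else A)
  end.

(** The products of a subsequence with an element of [Gam 32]: a group when the
    sequence is polycyclic. *)
Fixpoint layered (bs : seq Sp) (g : Sp) : Prop :=
  match bs with
  | [::] => Gam 32 g
  | b :: bs' => layered bs' g \/ layered bs' (b^-1 * g)
  end.

Definition approx (b : Sp) (d : datum) := cong32 b d.1.1.

Lemma siftP bs ds (g : Sp) A : List.Forall2 approx bs ds -> cong32 g A ->
  sift ds A -> layered bs g.
Proof.
move=> F; elim: F g A => [|b [[B N] p] bs' ds' bB _ IH] g A /= gA.
  by move/eqP => A1; case: gA => X E; exists X; rewrite E A1.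
case: (layer_coord _ _) => S; [right|left]; apply: IH S => //.
apply: cong32_trans (cong32_red _); rewrite sp_matM sp_matV.
by apply: cong32_mul => //; exact: cong32_adj.
Qed.

Lemma layered_min H bs : subgroup H -> (forall g, Gam 32 g -> H g) ->
  List.Forall H bs -> forall g, layered bs g -> H g.
Proof.
move=> sH GH; elim=> [|b bs' Hb _ IH] g /=; first exact: GH.
by case=> /IH //; exact: (subMl sH (subV sH Hb)).
Qed.

Lemma layered_Gam bs g : Gam 32 g -> layered bs g.
Proof. by elim: bs => //= b bs IH Gg; left; exact: IH. Qed.

Definition mat_conj A B := mat_mul (mat_mul A B) (mat_adj A).

(** The relations to be checked: the square of each element, and its conjugates
    of the later ones, sift to the identity. *)
Fixpoint closed_data (ds : seq datum) : bool :=
  match ds with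
  | [::] => true
  | (B, N, p) :: ds' =>
      [&& sift ds' (red32 (mat_mul B B)),
          all (fun d => sift ds' (red32 (mat_conj B d.1.1)) &&
                        sift ds' (red32 (mat_conj (mat_adj B) d.1.1))) ds'
        & closed_data ds']
  end.

Lemma conj_by_subgroup (b : Sp) H : subgroup H -> subgroup (fun x => H (b * x * b^-1)).
Proof.
move=> sH; split.
- by rewrite mulg1 mulgV; exact: (sub1 sH).
- move=> x y Hx Hy; have -> : b * (x * y) * b^-1 = (b * x * b^-1) * (b * y * b^-1).
    by rewrite !mulgA mulgVK.
  exact: (subM sH).
- move=> x Hx; have -> : b * x^-1 * b^-1 = (b * x * b^-1)^-1 by rewrite !invgM invgK mulgA.
  exact: (subV sH).
Qed.

(** The union of H and b H is closed under products since b normalizes H and b^2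
    belongs to H. *)
Lemma adjoin_subgroup (b : Sp) H : subgroup H ->
  (forall g, H g -> H (b * g * b^-1)) -> (forall g, H g -> H (b^-1 * g * b)) ->
  H (b * b) -> subgroup (fun g => H g \/ H (b^-1 * g)).
Proof.
move=> sH c1 c2 bb; split.
- by left; exact: (sub1 sH).
- move=> g h [Hg|Hg] [Hh|Hh].
  + by left; exact: (subM sH).
  + right; have -> : b^-1 * (g * h) = (b^-1 * g * b) * (b^-1 * h) by rewrite !mulgA mulgK.
    by apply: (subM sH) => //; exact: c2.
  + by right; rewrite mulgA; exact: (subM sH).
  + left; have -> : g * h = (b * b) * (b^-1 * (b^-1 * g) * b) * (b^-1 * h).
      by rewrite !mulgA mulgK mulgK mulgV mul1g.
    by apply: (subM sH) => //; apply: (subM sH) => //; exact: c2.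
- move=> g [Hg|Hg]; first by left; exact: (subV sH).
  right; have -> : b^-1 * g^-1 = (b * b)^-1 * (b * (b^-1 * g)^-1 * b^-1).
    by rewrite !invgM invgK !mulgA !mulgVK mulgK.
  by apply: (subM sH); [exact: (subV sH)|apply: c1; exact: (subV sH)].
Qed.

Lemma Forall_approx bs ds (P : Sp -> Prop) : List.Forall2 approx bs ds ->
  (forall d b, d \in ds -> approx b d -> P b) -> List.Forall P bs.
Proof.
elim=> [|b d bs' ds' bd _ IH] H; constructor.
  by apply: H bd; rewrite inE eqxx.
by apply: IH => d' b' d'in; apply: H; rewrite inE d'in orbT.
Qed.

Lemma layered_subgroup bs ds : List.Forall2 approx bs ds -> closed_data ds ->
  subgroup (layered bs) /\ List.Forall (layered bs) bs.
Proof.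
elim=> [|b [[B N] p] bs' ds' bB F IH].
  by move=> _; split; [exact: Gam_sub | constructor].
case/and3P=> sq /allP cj /IH [sH gens].
have cng (c : Sp) (C : mat) : cong32 c C ->
   (forall d, d \in ds' -> sift ds' (red32 (mat_conj C d.1.1))) ->
   forall g, layered bs' g -> layered bs' (c * g * c^-1).
  move=> cC S; apply: layered_min; first exact: conj_by_subgroup.
    by move=> g Gg; apply: layered_Gam; exact: Gam_normal.
  apply: (Forall_approx F) => d b' din b'd; apply: (siftP F) (S d din).
  apply: cong32_trans (cong32_red _); rewrite /mat_conj !sp_matM sp_matV.
  by apply: cong32_mul; [exact: cong32_mul | exact: cong32_adj].
split.
  apply: adjoin_subgroup => //.
  - by apply: (cng _ _ bB) => d din; case/andP: (cj d din).
  - move=> g; have -> : b^-1 * g * b = b^-1 * g * (b^-1)^-1 by rewrite invgK.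
    by apply: (cng b^-1 _ (cong32_adj bB)) => d din; case/andP: (cj d din).
  - by apply: (siftP F) sq; apply: cong32_trans (cong32_red _); exact: cong32_mul.
constructor; first by right; rewrite mulVg; exact: (sub1 sH).
by apply: List.Forall_impl gens => c Hc; left.
Qed.

(** ** The index of each step is exactly two *)

Lemma nth_mat_add i X Y : nth 0%Z (mat_seq (mat_add X Y)) i =
  (nth 0%Z (mat_seq X) i + nth 0%Z (mat_seq Y) i)%Z.
Proof. by mat_case; do 16?[case: i => [|i] //=]; rewrite !nth_nil. Qed.

Lemma nth_mat_scale i k X : nth 0%Z (mat_seq (mat_scale k X)) i = (k * nth 0%Z (mat_seq X) i)%Z.
Proof. by mat_case; do 16?[case: i => [|i] //=]; rewrite !nth_nil Z.mul_0_r. Qed.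

Lemma layer_coordD p X Y : layer_coord p (mat_add X Y) = layer_coord p X (+) layer_coord p Y.
Proof.
elim: p => [|i p IH] //=; rewrite IH nth_mat_add Z.odd_add.
by case: (Z.odd _) (Z.odd _) (layer_coord p X) (layer_coord p Y) => [] [] [] [].
Qed.

Lemma layer_coord_even p X : layer_coord p (mat_scale 2 X) = false.
Proof. by elim: p => [|i p IH] //=; rewrite IH nth_mat_scale Z.odd_mul. Qed.

(** Only the lower left block may be nonzero: the layer N = 1 is not an abelian
    group under addition of residues, but on such matrices products of residues
    vanish. *)
Definition low_block (L : mat) : bool :=
  let: Mat _ _ _ _ _ _ _ _ y0 y1 _ _ y2 y3 _ _ := L in
  L == Mat 0 0 0 0  0 0 0 0  y0 y1 0 0  y2 y3 0 0.

(** The condition for N = 1 makes these elements a group. *)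
Definition coord_zero (N : Z) (p : seq nat) (A : mat) : Prop :=
  exists L X, [/\ A = mat_lin N (mat_add L (mat_scale 2 X)), layer_coord p L = false
    & (N =? 1)%Z ==> low_block L].

Definition low_check (N : Z) (p : seq nat) (A : mat) : bool :=
  let L := mat_map (fun x => Z.modulo x 2) (layer_part N A) in
  [&& mat_lin N (layer_part N A) == A, ~~ layer_coord p L & (N =? 1)%Z ==> low_block L].

Lemma low_checkP N p A : low_check N p A -> coord_zero N p A.
Proof.
case/and3P=> /eqP E /negbTE pL b.
exists (mat_map (fun x => Z.modulo x 2) (layer_part N A)), (mat_map (fun x => Z.div x 2) (layer_part N A)).
split=> //; rewrite -{1}E; congr (mat_lin _ _).
case: (layer_part N A) => *; rewrite /mat_map /=.
by apply: Mat_eq; rewrite Z.add_comm -Z.div_mod.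
Qed.

(** (1 + N L) (1 + N M) = 1 + N (L + M) + N^2 L M, and N L M is even, for N = 1
    because L M vanishes. *)
Lemma coord_zeroM N p A B : N = 1%Z \/ (2 | N)%Z ->
  coord_zero N p A -> coord_zero N p B -> coord_zero N p (mat_mul A B).
Proof.
move=> N12 [L [X [-> pL bL]]] [M [Y [-> pM bM]]]; rewrite mat_linM.
have [K EK] : exists K, mat_scale N (mat_mul L M) = mat_scale 2 K.
  case: N12 bL bM => [-> /=|[k ->] _ _]; last by exists (mat_scale k (mat_mul L M)); mat_ring.
  case: L {pL} => ? ? ? ? ? ? ? ? ? ? ? ? ? ? ? ? /eqP[-> -> -> -> -> -> -> -> -> -> -> ->].
  case: M {pM} => ? ? ? ? ? ? ? ? ? ? ? ? ? ? ? ? /eqP[-> -> -> -> -> -> -> -> -> -> -> ->].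
  by exists mat0; mat_ring.
pose Z := mat_add (mat_add X Y) (mat_add K (mat_scale N (mat_add (mat_add (mat_mul L Y) (mat_mul X M)) (mat_scale 2 (mat_mul X Y))))).
exists (mat_add L M), Z; split.
- congr (mat_lin _ _); rewrite /Z.
  transitivity (mat_add (mat_scale N (mat_mul L M)) (mat_add (mat_add L M) (mat_scale 2 (mat_add (mat_add X Y) (mat_scale N (mat_add (mat_add (mat_mul L Y) (mat_mul X M)) (mat_scale 2 (mat_mul X Y)))))))).
    by clear; mat_ring.
  by rewrite EK; clear; mat_ring.
- by rewrite layer_coordD pL pM.
- case: Z.eqb_spec bL bM => //= _.
  case: L {pL EK Z} => ? ? ? ? ? ? ? ? ? ? ? ? ? ? ? ? /eqP[-> -> -> -> -> -> -> -> -> -> -> ->].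
  case: M {pM} => ? ? ? ? ? ? ? ? ? ? ? ? ? ? ? ? /eqP[-> -> -> -> -> -> -> -> -> -> -> ->].
  by apply/eqP; apply: Mat_eq; ring.
Qed.

Lemma coord_zero_approx N p (b : mat) B : (2 * N | 32)%Z ->
  cong32 b B -> coord_zero N p B -> coord_zero N p b.
Proof.
case=> k Ek [Y ->] [L [X [-> pL bL]]]; exists L, (mat_add X (mat_scale k Y)); split=> //.
by rewrite Ek; clear; mat_ring.
Qed.

Lemma coord_zero_Gam N p (g : Sp) : (2 * N | 32)%Z -> Gam 32 g -> coord_zero N p g.
Proof.
move=> N32 [X EX]; apply: (@coord_zero_approx _ _ _ mat1 N32); first by exists X.
exists mat0, mat0; split; first by mat_ring.
- by elim: p => //= i p ->; rewrite addbF; do 16?[case: i => [|i] //=]; rewrite nth_nil.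
- by rewrite implybT.
Qed.

Lemma layered_coord_zero N p bs ds : (2 * N | 32)%Z -> N = 1%Z \/ (2 | N)%Z ->
  List.Forall2 approx bs ds -> all (fun d => low_check N p d.1.1) ds ->
  forall g, layered bs g -> coord_zero N p g.
Proof.
move=> N32 N12; elim=> [|b d bs' ds' bd F IH] /=; first by move=> _ g; exact: coord_zero_Gam.
case/andP=> /low_checkP/(coord_zero_approx N32 bd) bz /IH {}IH g [/IH//|/IH H].
by rewrite -[g](mulVKg b) sp_matM; exact: coord_zeroM.
Qed.

Definition coord_one (N : Z) (p : seq nat) (A : mat) : bool :=
  (mat_lin N (layer_part N A) == A) && layer_coord p (layer_part N A).

Lemma coord_zero_one N p (b : mat) B : (2 * N | 32)%Z -> N <> 0%Z -> cong32 b B ->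
  coord_zero N p b -> coord_one N p B -> False.
Proof.
case=> k Ek N0 [Y ->] [L [X [E pL _]]] /andP[/eqP EB pB].
have : mat_add L (mat_scale 2 X) = mat_add (layer_part N B) (mat_scale 2 (mat_scale k Y)).
  have {E} : mat_lin N (mat_add L (mat_scale 2 X)) = mat_lin N (mat_add (layer_part N B) (mat_scale 2 (mat_scale k Y))).
    by rewrite -E -{1}EB Ek; clear; mat_ring.
  move: (mat_add L _) (mat_add (layer_part _ _) _) => U V; clear - N0.
  mat_case; rewrite /=; case=> *; apply: Mat_eq; apply: (Z.mul_reg_l _ _ N) => //; lia.
move/(congr1 (layer_coord p)); rewrite !layer_coordD !layer_coord_even !addbF pL => e.
by rewrite -e in pB.
Qed.

(** All later elements have zero coordinate along each step while the element of
    the step has coordinate one, so the index of each step is exactly two. *)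
Fixpoint echelon (ds : seq datum) : bool :=
  match ds with
  | [::] => true
  | (B, N, p) :: ds' =>
      [&& N \in [:: 1; 2; 4; 8; 16]%Z, all (fun d => low_check N p d.1.1) ds',
          coord_one N p B & echelon ds']
  end.

Lemma echelon_notin b bs d ds : List.Forall2 approx (b :: bs) (d :: ds) ->
  echelon (d :: ds) -> ~ layered bs b.
Proof.
case: d => [[B N] p] F; inversion F as [|? ? ? ? bB F']; subst.
case/and4P=> N5 low one _ Wb.
have [N32 N12 N0] : [/\ (2 * N | 32)%Z, N = 1%Z \/ (2 | N)%Z & N <> 0%Z].
  have dvd x y : (y mod x = 0)%Z -> x <> 0%Z -> (x | y)%Z by move=> h n0; exact: (proj1 (Z.mod_divide y x n0) h).
  by move: N5; rewrite !inE => /or4P[/eqP->|/eqP->|/eqP->|/orP[]/eqP->]; split=> //;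
    first [exact: dvd | by left | by right; exact: dvd].
by apply: (coord_zero_one N32 N0 bB) one; exact: (layered_coord_zero N32 N12 F' low).
Qed.

(** * The monodromy group *)

Definition g1 : Sp := MkSp (erefl : symplectic (Mat 1 0 0 0  0 1 0 8  0 0 1 0  0 0 0 1)).
Definition g2 : Sp := MkSp (erefl : symplectic
  (Mat (-1) 0 0 0  0 1 0 4  (-2) 0 (-1) 0  0 (-1) 0 (-3))).
Definition g3 : Sp := MkSp (erefl : symplectic
  (Mat 1 (-2) (-8) 12  (-6) (-5) (-12) 0  2 3 9 (-6)  1 2 6 (-5))).
Definition g4 : Sp := MkSp (erefl : symplectic
  (Mat 5 4 4 8  8 9 8 16  (-4) (-4) (-3) (-8)  (-4) (-4) (-4) (-7))).

Definition Mon := gen (fun g => [\/ g = g1, g = g2, g = g3 | g = g4]).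

Lemma Mon_sub : subgroup Mon. Proof. exact: gen_subgroup. Qed.

Definition letter (k : Z) : Sp :=
  if (Z.abs k =? 1)%Z then g1 else if (Z.abs k =? 2)%Z then g2
  else if (Z.abs k =? 3)%Z then g3 else g4.

(** Words in the generators: a negative letter stands for an inverse. *)
Fixpoint evalw (w : seq Z) : Sp :=
  match w with
  | [::] => 1
  | k :: w' => (if (k <? 0)%Z then (letter k)^-1 else letter k) * evalw w'
  end.

(** The same words on bare matrices, where evaluation does not meet proofs. *)
Fixpoint evalm (w : seq Z) : mat :=
  match w with
  | [::] => mat1
  | k :: w' => let A := sp_mat (letter k) in
      mat_mul (if (k <? 0)%Z then mat_adj A else A) (evalm w')
  end.

Lemma evalwE w : sp_mat (evalw w) = evalm w.
Proof. by elim: w => // k w IH; rewrite [evalw _]/= sp_matM IH [evalm (k :: w)]/=; case: ifP. Qed.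

Lemma letter_Mon k : Mon (letter k).
Proof.
apply: gen_in; rewrite /letter; case: ifP => _; first exact: Or41 erefl.
case: ifP => _; first exact: Or42 erefl.
by case: ifP => _; [exact: Or43 erefl | exact: Or44 erefl].
Qed.

Lemma evalw_Mon w : Mon (evalw w).
Proof.
elim: w => [|k w IH]; first exact: (sub1 Mon_sub).
apply: (subM Mon_sub) IH; case: ifP => _; last exact: letter_Mon.
by apply: (subV Mon_sub); exact: letter_Mon.
Qed.

(** ** A symplectic basis adapted to the monodromy group *)

(** The columns of this matrix form a symplectic basis made of vectors for which
    small powers of the transvections lie in the monodromy group. The second is
    the vector of the first generator and the fourth, up to sign, that of the
    last one. *)
Definition frame : Sp := MkSp (erefl : symplectic
  (Mat 1 0 0 (-1)  (-1) 1 (-1) (-2)  0 0 1 1  0 0 0 1)).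

(** The monodromy group in the coordinates of this basis. *)
Definition HF (x : Sp) := Mon (frame * x * frame^-1).

Lemma HF_sub : subgroup HF. Proof. exact: conj_by_subgroup Mon_sub. Qed.

(** Conjugation by a word maps the transvection of a vector to that of its
    image. *)
Lemma HF_orbit w v0 u n : Mon (tw v0 n) -> act (evalm w) v0 = act frame u -> HF (tw u n).
Proof.
move=> M0 E; rewrite /HF twJ -E -evalwE -twJ.
have Mw := evalw_Mon w; apply: (subM Mon_sub); last exact: (subV Mon_sub).
exact: (subM Mon_sub).
Qed.

Lemma Mon_e2 : Mon (tw (Vec 0 1 0 0) 8).
Proof.
have -> : tw (Vec 0 1 0 0) 8 = letter 1%Z by exact: Sp_eq.
exact: letter_Mon.
Qed.

Lemma Mon_v : Mon (tw (Vec 1 2 (-1) (-1)) 4).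
Proof.
have -> : tw (Vec 1 2 (-1) (-1)) 4 = letter 4 by exact: Sp_eq.
exact: letter_Mon.
Qed.

Lemma HF_1_0_0_m1 : HF (tv 1 0 0 (-1) 8).
Proof. rewrite -tvN; refine (@HF_orbit [:: -3; -4; -2]%Z _ (Vec (-1) 0 0 1) 8 Mon_e2 _); vm_compute; reflexivity. Qed.

Lemma HF_1_0_0_3 : HF (tv 1 0 0 3 8).
Proof. rewrite -tvN; refine (@HF_orbit [:: -2; -2; -1; 2; 4; 3; 3; 3; -4; -4; -2; -2; -2; -2]%Z _ (Vec (-1) 0 0 (-3)) 8 Mon_e2 _); vm_compute; reflexivity. Qed.

Lemma HF_4_5_0_0 : HF (tv 4 5 0 0 8).
Proof. refine (@HF_orbit [:: 2; -1; -2; -4; -2; 1; 3; -1; -1; -2; 3; -1; 2; 1; -2; 4; 4; -1; -2; -4; -4; -4; -1; -2; 4; 2; 2; 2; 2]%Z _ (Vec 4 5 0 0) 8 Mon_e2 _); vm_compute; reflexivity. Qed.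

Lemma HF_4_3_0_0 : HF (tv 4 3 0 0 8).
Proof. rewrite -tvN; refine (@HF_orbit [:: -2; -1; 2; 4; 3; -1; -2; -2; 3; -1; 2; 1; -2; 4; 4; -1; -2; -4; -4; -4; -1; -2; 4; 2; 2; 2; 2]%Z _ (Vec (-4) (-3) 0 0) 8 Mon_e2 _); vm_compute; reflexivity. Qed.

Lemma HF_0_5_m4_0 : HF (tv 0 5 (-4) 0 8).
Proof. refine (@HF_orbit [:: -3; -3; 4; 4; 2; 2; 2; 2]%Z _ (Vec 0 5 (-4) 0) 8 Mon_e2 _); vm_compute; reflexivity. Qed.

Lemma HF_0_3_m4_0 : HF (tv 0 3 (-4) 0 8).
Proof. rewrite -tvN; refine (@HF_orbit [:: 3; 3; -4; -4; -2; -2; -2; -2]%Z _ (Vec 0 (-3) 4 0) 8 Mon_e2 _); vm_compute; reflexivity. Qed.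

Lemma HF_0_0_1_2 : HF (tv 0 0 1 2 8).
Proof. refine (@HF_orbit [:: 3]%Z _ (Vec 0 0 1 2) 8 Mon_e2 _); vm_compute; reflexivity. Qed.

Lemma HF_0_0_1_m2 : HF (tv 0 0 1 (-2) 8).
Proof. refine (@HF_orbit [:: 2; 1; -3; -3; -3; 4; 2; 2; 2]%Z _ (Vec 0 0 1 (-2)) 8 Mon_e2 _); vm_compute; reflexivity. Qed.

Lemma HF_1_1_m1_m3 : HF (tv 1 1 (-1) (-3) 8).
Proof. rewrite -tvN; refine (@HF_orbit [:: 4; 2]%Z _ (Vec (-1) (-1) 1 3) 8 Mon_e2 _); vm_compute; reflexivity. Qed.

Lemma HF_1_0_3_0 : HF (tv 1 0 3 0 4).
Proof. rewrite -tvN; refine (@HF_orbit [:: 2; 4; 3; -1; -2; -2]%Z _ (Vec (-1) 0 (-3) 0) 4 Mon_v _); vm_compute; reflexivity. Qed.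

Lemma HF_0_1_0_0 : HF (tv 0 1 0 0 8).
Proof. refine (@HF_orbit [::]%Z _ (Vec 0 1 0 0) 8 Mon_e2 _); vm_compute; reflexivity. Qed.

Lemma HF_0_0_0_1 : HF (tv 0 0 0 1 4).
Proof. rewrite -tvN; refine (@HF_orbit [::]%Z _ (Vec 0 0 0 (-1)) 4 Mon_v _); vm_compute; reflexivity. Qed.

Lemma HF_tvM a b c d n m : HF (tv a b c d n) -> (m mod n = 0)%Z -> n <> 0%Z -> HF (tv a b c d m).
Proof.
by move=> h mn n0; apply: (tvM_sub HF_sub h); apply: (proj1 (Z.mod_divide m n n0)).
Qed.

Ltac sp_compute := apply: Sp_eq; vm_compute; reflexivity.
Ltac HF_mul := repeat apply: (subM HF_sub); try apply: (subV HF_sub); repeat apply: (subM HF_sub).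
Ltac HF_root h := apply: (HF_tvM h); [reflexivity | discriminate].

Lemma HF_X14_32 : HF (Xv 1 0 0 1 32).
Proof.
have -> : Xv 1 0 0 1 32 = tv 1 0 0 3 8 * tv 0 0 0 1 (-72) * tv 1 0 0 (-1) (-8) * tv 0 0 0 1 8.
  by sp_compute.
HF_mul; [exact: HF_1_0_0_3 | HF_root HF_0_0_0_1 | HF_root HF_1_0_0_m1 | HF_root HF_0_0_0_1].
Qed.

Lemma HF_e1_32 : HF (tv 1 0 0 0 32).
Proof.
have -> : tv 1 0 0 0 32 = tv 1 0 0 (-1) 32 * tv 0 0 0 1 (-32) * Xv 1 0 0 1 32 by sp_compute.
HF_mul; [HF_root HF_1_0_0_m1 | HF_root HF_0_0_0_1 | exact: HF_X14_32].
Qed.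

Lemma HF_X12_64 : HF (Xv 1 1 0 0 64).
Proof.
have -> : Xv 1 1 0 0 64 = tv 4 5 0 0 8 * tv 4 3 0 0 (-8) * tv 0 1 0 0 (-128) by sp_compute.
HF_mul; [exact: HF_4_5_0_0 | HF_root HF_4_3_0_0 | HF_root HF_0_1_0_0].
Qed.

Lemma HF_X23_64 : HF (Xv 0 1 1 0 64).
Proof.
have -> : Xv 0 1 1 0 64 = tv 0 3 (-4) 0 8 * tv 0 5 (-4) 0 (-8) * tv 0 1 0 0 128 by sp_compute.
HF_mul; [exact: HF_0_3_m4_0 | HF_root HF_0_5_m4_0 | HF_root HF_0_1_0_0].
Qed.

Lemma HF_X34_32 : HF (Xv 0 0 1 1 32).
Proof.
have -> : Xv 0 0 1 1 32 = tv 0 0 1 2 8 * tv 0 0 1 (-2) (-8) by sp_compute.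
HF_mul; [exact: HF_0_0_1_2 | HF_root HF_0_0_1_m2].
Qed.

Lemma HF_e3_16 : HF (tv 0 0 1 0 16).
Proof.
have -> : tv 0 0 1 0 16 = tv 0 0 1 2 8 * tv 0 0 1 (-2) 8 * tv 0 0 0 1 (-64) by sp_compute.
HF_mul; [exact: HF_0_0_1_2 | exact: HF_0_0_1_m2 | HF_root HF_0_0_0_1].
Qed.

(** Two vectors x u + y v of a plane with the same x and distinct y give the
    Eichler element of u and v up to transvections of u and v. *)
Lemma HF_roots : root_elements 64 HF.
Proof.
split.
- HF_root HF_e1_32.
- HF_root HF_0_1_0_0.
- HF_root HF_e3_16.
- HF_root HF_0_0_0_1.
- exact: HF_X12_64.
- by rewrite -(XvD 1 0 0 1 32 32); apply: (subM HF_sub); exact: HF_X14_32.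
- exact: HF_X23_64.
- by rewrite -(XvD 0 0 1 1 32 32); apply: (subM HF_sub); exact: HF_X34_32.
Qed.

(** For a normal subgroup it does not matter in which basis inclusion is
    checked. *)
Lemma Mon_conj_normal (P : Sp -> Prop) : (forall g h, P h -> P (g * h * g^-1)) ->
  (forall g, P g -> HF g) -> forall g, P g -> Mon g.
Proof.
move=> nP PH g Pg; have := PH _ (nP frame^-1 g Pg); rewrite /HF.
by rewrite invgK !mulgA mulgV mul1g mulgK.
Qed.

Lemma EE_Mon g : EE (2 * 64 ^ 4) g -> Mon g.
Proof.
apply: Mon_conj_normal; first by move=> *; exact: EE_normal.
exact: root_elements_EE HF_sub HF_roots.
Qed.

(** ** The level of the monodromy group *)

Definition res_check (N : Z) (A X : mat) : bool :=
  let E := mat_map (fun x => Z.div x 2) (mat_add (layer_part N A) (mat_scale (-1) X)) in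
  A == mat_lin N (mat_add X (mat_scale 2 E)).

Lemma res_checkP N (g : Sp) X : res_check N g X -> res N g X.
Proof. by move/eqP => E; eexists; exact: E. Qed.

(** Ten elements with residues [lie_basis]. Only residues matter, so root
    elements are not required: t12 and t23, products of two transvection powers
    of exponents 8 and -72, have the residues of Eichler elements of exponent
    32, where [HF_X12_64] and [HF_X23_64] only give exponent 64. *)
Lemma HF_layer5 : exists2 us, List.Forall HF us & List.Forall2 (res 32) us lie_basis.
Proof.
pose t12 := tv 4 3 0 0 8 * tv 0 1 0 0 (-72).
pose t23 := tv 0 3 (-4) 0 8 * tv 0 1 0 0 (-72).
have H12 : HF t12 by HF_mul; [exact: HF_4_3_0_0 | HF_root HF_0_1_0_0].
have H23 : HF t23 by HF_mul; [exact: HF_0_3_m4_0 | HF_root HF_0_1_0_0].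
pose t13 := tv 1 0 3 0 32.
have H13 : HF t13 by HF_root HF_1_0_3_0.
pose t24 := tv 1 1 (-1) (-3) 32 * t13 * t12 * Xv 1 0 0 1 32 * t23 * Xv 0 0 1 1 32.
have H24 : HF t24.
  have H1 : HF (tv 1 1 (-1) (-3) 32) by HF_root HF_1_1_m1_m3.
  have M := subM HF_sub.
  exact: (M _ _ (M _ _ (M _ _ (M _ _ (M _ _ H1 H13) H12) HF_X14_32) H23) HF_X34_32).
exists [:: tv 1 0 0 0 32; tv 0 1 0 0 32; tv 0 0 1 0 32; tv 0 0 0 1 32;
  t12; Xv 1 0 0 1 32; t23; Xv 0 0 1 1 32; t13; t24].
  apply: List.Forall_cons; first by exact: HF_e1_32.
  apply: List.Forall_cons; first by HF_root HF_0_1_0_0.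
  apply: List.Forall_cons; first by HF_root HF_e3_16.
  apply: List.Forall_cons; first by HF_root HF_0_0_0_1.
  apply: List.Forall_cons; first by exact: H12.
  apply: List.Forall_cons; first by exact: HF_X14_32.
  apply: List.Forall_cons; first by exact: H23.
  apply: List.Forall_cons; first by exact: HF_X34_32.
  apply: List.Forall_cons; first by exact: H13.
  apply: List.Forall_cons; first by exact: H24.
  exact: List.Forall_nil.
do 10![apply: List.Forall2_cons; first by apply: res_checkP; vm_compute].
exact: List.Forall2_nil.
Qed.

(** Successive squares span all the higher layers. *)
Lemma powers_layer us N j : List.Forall HF us -> List.Forall2 (res (4 * N)) us lie_basis ->
  exists2 us', List.Forall HF us' & List.Forall2 (res (2 ^ Z.of_nat j * (4 * N))) us' lie_basis.
Proof.
move=> H F; elim: j => [|j [us' H' F']]; first by exists us; rewrite // Z.mul_1_l.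
exists (map (fun u => u * u) us').
  by elim: H' {F'} => [|u us2 Hu _ IH] /=; constructor => //; exact: (subM HF_sub).
have E : (2 ^ Z.of_nat j * (4 * N) = 4 * (2 ^ Z.of_nat j * N))%Z by ring.
rewrite Nat2Z.inj_succ Z.pow_succ_r; last exact: Nat2Z.is_nonneg.
rewrite -Z.mul_assoc E; rewrite E in F'.
by elim: F' => [|u B us2 Bs uB _ IH] /=; constructor => //; exact: res_sqr.
Qed.

(** Multiplying by elements of M pushes g from layer to layer until level 2 *
    64^4, where [Gam_EE_pow2] and [root_elements_EE] apply. *)
Lemma Gam32_Mon g : Gam 32 g -> Mon g.
Proof.
have [us Hus Fus] := HF_layer5.
have step j x : Gam (2 ^ Z.of_nat j * (4 * 8)) x ->
    exists2 h, HF h & Gam (2 ^ Z.of_nat j.+1 * (4 * 8)) (h * x).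
  have [us' H' F'] := powers_layer (N := 8) j Hus Fus.
  have E : (2 ^ Z.of_nat j * (4 * 8) = 2 * (2 ^ Z.of_nat j * 16))%Z by ring.
  rewrite Nat2Z.inj_succ Z.pow_succ_r; last exact: Nat2Z.is_nonneg.
  rewrite -Z.mul_assoc E in F' * => Gx.
  have n0 : (2 ^ Z.of_nat j * 16)%Z <> 0%Z.
    by have := Z.pow_pos_nonneg 2 (Z.of_nat j); lia.
  have [y _ Gy] := layer_reduce n0 F' Gx.
  by exists (prodb us' y) => //; exact: (prodb_sub _ HF_sub).
apply: Mon_conj_normal; first by move=> *; exact: Gam_normal.
move=> {}g Gg.
(* 2 ^ 20 * 32 = 2 * 64 ^ 4 is the level reached by the root elements. *)
have : exists2 h, HF h & Gam (2 ^ Z.of_nat 20 * (4 * 8)) (h * g).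
  elim: 20%N => [|j [h Hh Gh]]; first by exists 1; [exact: (sub1 HF_sub)|rewrite mul1g].
  by have [h' Hh' Gh'] := step _ _ Gh; exists (h' * h); [exact: (subM HF_sub)|rewrite -mulgA].
case=> h Hh Gh; apply: (subMl HF_sub Hh).
have := root_elements_EE HF_sub HF_roots; apply.
have -> : (2 * 64 ^ 4 = 2 ^ Z.of_nat 24.+1)%Z by [].
have E : (2 ^ Z.of_nat 20 * (4 * 8) = 2 ^ Z.of_nat 24.+1)%Z by [].
by rewrite E in Gh; exact: (Gam_EE_pow2 Gam2_EE2 Gh).
Qed.

(** A polycyclic sequence of the monodromy group modulo [Gam 32]: for each
    element, a word, the number of times it is squared, the layer and the
    coordinate. The layers 1, 2, 4, 8, 16 contribute 2, 1, 4, 9 and 9 elements.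
    *)
Definition pc_data : seq (seq Z * nat * Z * seq nat) :=
  [:: ([:: 3]%Z, 0%N, 1%Z, [:: 9]%N);
      ([:: 2]%Z, 0%N, 1%Z, [:: 13]%N);
      ([:: 2]%Z, 1%N, 2%Z, [:: 13]%N);
      ([:: 3; 4]%Z, 1%N, 4%Z, [:: 0; 1]%N);
      ([:: 4]%Z, 0%N, 4%Z, [:: 0]%N);
      ([:: 3]%Z, 1%N, 4%Z, [:: 1; 8]%N);
      ([:: 2]%Z, 2%N, 4%Z, [:: 0; 1; 8; 13]%N);
      ([:: 2; 4; -2; 4]%Z, 0%N, 8%Z, [:: 0; 2]%N);
      ([:: 2; 3; -2; -3]%Z, 0%N, 8%Z, [:: 0; 1; 4; 8; 9]%N);
      ([:: 3; 1; -3]%Z, 0%N, 8%Z, [:: 4]%N);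
      ([:: 2; 1; -2]%Z, 0%N, 8%Z, [:: 0; 1; 4; 5; 8; 9]%N);
      ([:: 3; 4]%Z, 2%N, 8%Z, [:: 1; 2]%N);
      ([:: 4]%Z, 1%N, 8%Z, [:: 0]%N);
      ([:: 3]%Z, 2%N, 8%Z, [:: 1; 4; 8]%N);
      ([:: 2]%Z, 3%N, 8%Z, [:: 0; 2; 5; 9; 13]%N);
      ([:: 1]%Z, 0%N, 8%Z, [:: 0; 1; 5; 7; 8; 9]%N);
      ([:: 2; 4; -2; 4]%Z, 1%N, 16%Z, [:: 0; 2]%N);
      ([:: 2; 3; -2; -3]%Z, 1%N, 16%Z, [:: 0; 1; 4; 8; 9]%N);
      ([:: 3; 1; -3]%Z, 1%N, 16%Z, [:: 4]%N);
      ([:: 2; 1; -2]%Z, 1%N, 16%Z, [:: 0; 1; 4; 5; 8; 9]%N);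
      ([:: 3; 4]%Z, 3%N, 16%Z, [:: 1; 2]%N);
      ([:: 4]%Z, 2%N, 16%Z, [:: 0]%N);
      ([:: 3]%Z, 3%N, 16%Z, [:: 1; 4; 8]%N);
      ([:: 2]%Z, 4%N, 16%Z, [:: 0; 2; 5; 9; 13]%N);
      ([:: 1]%Z, 1%N, 16%Z, [:: 0; 1; 5; 7; 8; 9]%N)].

Definition pc_elt (p : seq Z * nat * Z * seq nat) : Sp :=
  iter p.1.1.2 (fun g => g * g) (evalw p.1.1.1).

Definition pc_datum (p : seq Z * nat * Z * seq nat) : datum :=
  (red32 (iter p.1.1.2 (fun A => red32 (mat_mul A A)) (evalm p.1.1.1)), p.1.2, p.2).

Lemma pc_approx : List.Forall2 approx (map pc_elt pc_data) (map pc_datum pc_data).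
Proof.
elim: pc_data => [|[[[w e] N] p] s IH]; constructor => //.
rewrite /approx /pc_elt /pc_datum /=; apply: cong32_trans (cong32_red _).
elim: e => [|e IHe] /=; first by rewrite evalwE; exact: cong32_refl.
by apply: cong32_trans (cong32_red _); exact: cong32_mul.
Qed.

Lemma pc_closed : closed_data (map pc_datum pc_data).
Proof. by vm_compute. Qed.

Lemma pc_echelon : echelon (map pc_datum pc_data).
Proof. by vm_compute. Qed.

Lemma pc_Mon : List.Forall Mon (map pc_elt pc_data).
Proof.
elim: pc_data => [|[[[w e] N] p] s IH]; constructor => //.
rewrite /pc_elt /=; elim: e => [|e IHe]; first exact: evalw_Mon.
exact: (subM Mon_sub).
Qed.

Theorem Mon_layered g : Mon g <-> layered (map pc_elt pc_data) g.
Proof.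
split; last exact: (layered_min Mon_sub Gam32_Mon pc_Mon).
have [sL _] := layered_subgroup pc_approx pc_closed.
apply: gen_min => // {g}.
have gens k : sift (map pc_datum pc_data) (red32 (letter k)) ->
    layered (map pc_elt pc_data) (letter k).
  by apply: siftP pc_approx _; exact: cong32_red.
move=> g [] ->.
- exact: (gens 1%Z).
- exact: (gens 2%Z).
- exact: (gens 3%Z).
- exact: (gens 4%Z).
Qed.

(** * Transversals and Lagrange's theorem *)

Definition transversal (G H : Sp -> Prop) (s : seq Sp) : Prop :=
  [/\ uniq s, forall x, x \in s -> G x,
      forall g, G g -> exists2 x, x \in s & H (x^-1 * g)
    & forall x y, x \in s -> y \in s -> H (x^-1 * y) -> x = y].

Lemma transversal_mul G H K s t : subgroup G -> subgroup H -> subgroup K ->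
  (forall g, H g -> G g) -> (forall g, K g -> H g) ->
  transversal G H s -> transversal H K t ->
  transversal G K [seq x * y | x <- s, y <- t].
Proof.
move=> sG sH sK HG KH [us sGs covs injs] [ut tHt covt injt].
have inj x y x' y' : x \in s -> x' \in s -> y \in t -> y' \in t ->
    K ((x * y)^-1 * (x' * y')) -> x = x' /\ y = y'.
  move=> xs xs' yt yt' k.
  have E : x = x'.
    apply: injs => //.
    have -> : x^-1 * x' = y * ((x * y)^-1 * (x' * y')) * y'^-1.
      by rewrite invgM !mulgA mulgV mul1g mulgK.
    apply: (subM sH); last by apply: (subV sH); exact: tHt.
    by apply: (subM sH); [exact: tHt | exact: KH].
  split=> //; apply: injt => //; rewrite -E in k.
  by have -> : y^-1 * y' = (x * y)^-1 * (x * y') by rewrite invgM !mulgA mulgVK.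
split.
- apply: allpairs_uniq => // -[x y] [x' y'] /allpairsP[[a b] /= [xs yt [-> ->]]].
  move=> /allpairsP[[a' b'] /= [xs' yt' [-> ->]]] /= E.
  have [|-> -> //] := inj a b a' b' xs xs' yt yt'.
  by rewrite E mulVg; exact: (sub1 sK).
- move=> g /allpairsP[[x y] /= [xs yt ->]].
  by apply: (subM sG); [exact: sGs | apply: HG; exact: tHt].
- move=> g /covs[x xs /covt[y yt k]]; exists (x * y).
    by apply/allpairsP; exists (x, y).
  by rewrite invgM -mulgA.
- move=> g h /allpairsP[[x y] /= [xs yt ->]] /allpairsP[[x' y'] /= [xs' yt' ->]] k.
  by have [-> ->] := inj _ _ _ _ xs xs' yt yt' k.
Qed.

Lemma transversal_leq G H s t : subgroup H ->
  transversal G H s -> transversal G H t -> (size s <= size t)%N.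
Proof.
move=> sH [us sG _ injs] [_ _ covt _].
pose P x y := `[< H (y^-1 * x) >]; pose f x := nth 1 t (find (P x) t).
have fP x : x \in s -> f x \in t /\ H ((f x)^-1 * x).
  move=> /sG/covt[y yt Hy]; have hP : has (P x) t.
    by apply/hasP; exists y => //; exact/asboolP.
  split; first by rewrite mem_nth // -has_find.
  by have /asboolP := nth_find 1 hP.
have uf : uniq (map f s).
  rewrite map_inj_in_uniq // => x y xs ys E; apply: injs => //.
  have [_ hx] := fP x xs; have [_ hy] := fP y ys; rewrite E in hx.
  have -> : x^-1 * y = ((f y)^-1 * x)^-1 * ((f y)^-1 * y) by rewrite invgM invgK !mulgA mulgK.
  by apply: (subM sH) => //; exact: (subV sH).
rewrite -(size_map f); apply: uniq_leq_size uf _ => _ /mapP[x xs ->].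
by case: (fP x xs).
Qed.

(** Discard redundant representatives, one at a time. *)
Lemma transversal_sub (G H K : Sp -> Prop) t : subgroup H -> (forall g, K g -> H g) ->
  transversal G K t -> exists s, transversal G H s.
Proof.
move=> sH KH [_ tG cov _].
suff [s [us sG covs injs]] : exists s, [/\ uniq s, forall x, x \in s -> G x,
    forall g, g \in t -> exists2 x, x \in s & H (x^-1 * g)
    & forall x y, x \in s -> y \in s -> H (x^-1 * y) -> x = y].
  exists s; split=> // g /cov[y /covs[x xs Hxy] /KH Hy]; exists x => //.
  have -> : x^-1 * g = (x^-1 * y) * (y^-1 * g) by rewrite !mulgA mulgK.
  exact: (subM sH).
elim: t tG {cov} => [|y t IH] tG; first by exists [::].
have [|s [us sG covs injs]] := IH; first by move=> x xt; apply: tG; rewrite inE xt orbT.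
have [[x xs Hxy]|N] := pselect (exists2 x, x \in s & H (x^-1 * y)).
  exists s; split=> // g; rewrite inE => /orP[/eqP->|]; [by exists x | exact: covs].
exists (y :: s); split.
- rewrite /= us andbT; apply/negP => ys; apply: N; exists y => //.
  by rewrite mulVg; exact: (sub1 sH).
- by move=> x; rewrite inE => /orP[/eqP->|/sG//]; apply: tG; rewrite inE eqxx.
- move=> g; rewrite inE => /orP[/eqP->|/covs[x xs Hx]].
    by exists y; rewrite ?inE ?eqxx // mulVg; exact: (sub1 sH).
  by exists x => //; rewrite inE xs orbT.
- move=> x z; rewrite !inE => /orP[/eqP->|xs] /orP[/eqP->|zs] // Hxz; last exact: injs.
    case: N; exists z => //.
    have -> : z^-1 * y = (y^-1 * z)^-1 by rewrite invgM invgK.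
    exact: (subV sH).
  by case: N; exists x.
Qed.

(** ** Between consecutive layers *)

Lemma layer_transversal m : m <> 0%Z ->
  exists2 s, transversal (Gam (2 * m)) (Gam (2 * (2 * m))) s & size s = (2 ^ 10)%N.
Proof.
move=> m0; pose bas := layer_basis (2 * m).
have F : List.Forall2 (res (2 * m)) bas lie_basis := layer_basis_res (2 * m).
have sK := Gam_sub (2 * (2 * m)).
have BG (y : seq bool) : Gam (2 * m) (prodb bas y).
  apply: prodb_sub; first exact: Gam_sub.
  by elim: F => [|u B us Bs /res_Gam Gu _ IH]; constructor.
pose f (y : 10.-tuple bool) := (prodb bas y)^-1.
have inj (y z : 10.-tuple bool) : Gam (2 * (2 * m)) ((f y)^-1 * f z) -> y = z.
  rewrite /f invgK => G; apply: val_inj.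
  apply: (layer_uniq (us := bas) (g := (prodb bas z)^-1 * prodb bas y) m0); rewrite ?size_tuple //.
    have := Gam_normal (prodb bas z)^-1 G.
    by rewrite -!mulgA mulgV mulg1.
  by rewrite mulVKg.
exists [seq f y | y <- enum {: 10.-tuple bool}]; last first.
  by rewrite size_map -cardE card_tuple card_bool.
split.
- rewrite map_inj_uniq ?enum_uniq // => y z E; apply: inj.
  by rewrite E mulVg; exact: (sub1 sK).
- by move=> _ /mapP[y _ ->]; apply: (subV (Gam_sub _)); exact: BG.
- move=> g Gg; have [y sy Gy] := layer_reduce m0 F Gg.
  have sy' : size y == 10%N by apply/eqP.
  exists (f (Tuple sy')); last by rewrite /f invgK.
  by apply/mapP; exists (Tuple sy'); rewrite ?mem_enum.
- by move=> _ _ /mapP[y _ ->] /mapP[z _ ->] /inj ->.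
Qed.

(** ** Polycyclic sequences *)

Lemma layered_transversal bs ds : List.Forall2 approx bs ds -> closed_data ds -> echelon ds ->
  exists2 s, transversal (layered bs) (Gam 32) s & size s = (2 ^ size bs)%N.
Proof.
move=> F; have sK := Gam_sub 32; elim: F => [_ _|b d bs' ds' bd F' IH cl ec].
  exists [:: 1] => //; split=> //.
  - by move=> x; rewrite inE => /eqP->; exact: (sub1 sK).
  - by move=> g Gg; exists 1; rewrite ?inE // invg1 mul1g.
  - by move=> x y; rewrite !inE => /eqP-> /eqP->.
have FF : List.Forall2 approx (b :: bs') (d :: ds') by constructor.
have nb := echelon_notin FF ec.
have [sG _] := layered_subgroup FF cl.
have [cl' ec'] : closed_data ds' /\ echelon ds'.
  by move: cl ec; case: d {bd FF} => [[B N] p] /and3P[_ _ ?] /and4P[_ _ _ ?].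
have [sH _] := layered_subgroup F' cl'.
have [t tt st] := IH cl' ec'.
have T : transversal (layered (b :: bs')) (layered bs') [:: 1; b].
  split.
  - rewrite /= inE andbT; apply/eqP => E; apply: nb; rewrite -E; exact: (sub1 sH).
  - move=> x; rewrite !inE => /orP[]/eqP-> /=; first by left; exact: (sub1 sH).
    by right; rewrite mulVg; exact: (sub1 sH).
  - move=> g /= [Hg|Hg]; [exists 1|exists b]; rewrite ?inE ?eqxx ?orbT //.
    by rewrite invg1 mul1g.
  - move=> x y; rewrite !inE => /orP[]/eqP-> /orP[]/eqP-> //.
      by rewrite invg1 mul1g => /nb.
    by rewrite mulg1 => /(subVr sH)/nb.
exists [seq x * y | x <- [:: 1; b], y <- t]; last by rewrite size_allpairs st [RHS]expnS.
by apply: (transversal_mul sG sH sK _ _ T tt) => g; [left | exact: layered_Gam].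
Qed.

(** ** The group Sp(4, Z / 2) has order 720 *)

Definition parity (A : mat) : seq bool := map Z.odd (mat_seq A).

(** Reduction modulo 2 identifies the cosets of [Gam 2]. *)
Lemma parity_Gam2 (g h : Sp) : parity g = parity h <-> Gam 2 (g^-1 * h).
Proof.
split=> [E|[X EX]].
  have [X EX] : exists X, sp_mat h = mat_add g (mat_scale 2 X).
    have ev x y : Z.odd x = Z.odd y -> exists k, y = (x + 2 * k)%Z.
      move=> e; have /Z_odd_even[k Ek] : Z.odd (y - x) = false by rewrite Z.odd_sub e Bool.xorb_nilpotent.
      by exists k; lia.
    move: E; case: (sp_mat g) => ? ? ? ? ? ? ? ? ? ? ? ? ? ? ? ?; case: (sp_mat h) => ? ? ? ? ? ? ? ? ? ? ? ? ? ? ? ?.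
    case; do 16!move=> /ev[? ->].
    by eexists (Mat _ _ _ _ _ _ _ _ _ _ _ _ _ _ _ _).
  have /andP[/eqP V _] := sp_matP g.
  exists (mat_mul (mat_adj g) X); rewrite sp_matM sp_matV EX.
  transitivity (mat_add (mat_mul (mat_adj g) g) (mat_scale 2 (mat_mul (mat_adj g) X))).
    by move: (mat_adj g) (sp_mat g) => A B; clear; mat_ring.
  by rewrite V.
have -> : sp_mat h = mat_mul g (mat_lin 2 X) by rewrite -EX -sp_matM mulVKg.
have -> : mat_mul g (mat_lin 2 X) = mat_add g (mat_scale 2 (mat_mul g X)).
  by move: (sp_mat g) => A; clear; mat_ring.
move: (sp_mat g) (mat_mul g X) => A B; clear; mat_case.
by rewrite /parity /= !Z.odd_add !Z.odd_mul /= !Bool.xorb_false_r.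
Qed.

(** Coxeter generators of the symmetric group of degree 6, which is isomorphic
    to Sp(4, Z / 2): the transvections of a chain of five vectors in which
    exactly the consecutive ones are not orthogonal. *)
Definition coxeter (i : nat) : Sp :=
  nth 1 [:: tv 1 0 0 0 1; tv 0 0 1 0 1; tv 1 1 0 0 1; tv 0 0 0 1 1; tv 0 1 0 0 1] i.

Definition coxeter_mat (i : nat) : mat :=
  nth mat1 [:: tmat 1 0 0 0 1; tmat 0 0 1 0 1; tmat 1 1 0 0 1; tmat 0 0 0 1 1; tmat 0 1 0 0 1] i.

(** The normal forms of the 6! permutations: for i = 1, ..., 5, a descending run
    of at most i generators, starting with the i-th. *)
Definition coxeter_words : seq (seq nat) :=
  foldr (fun i ws => [seq u ++ w | u <- [seq rev (iota (i - j) j) | j <- iota 0 i.+1], w <- ws])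
    [:: [::]] (iota 1 5).

Definition word_elt (w : seq nat) : Sp := foldr (fun i g => coxeter i * g) 1 w.
Definition word_mat (w : seq nat) : mat := foldr (fun i A => mat_mul (coxeter_mat i) A) mat1 w.

Lemma word_eltE w : sp_mat (word_elt w) = word_mat w.
Proof.
elim: w => // i w IH; rewrite -[word_elt (i :: w)]/(coxeter i * word_elt w) sp_matM IH.
congr (mat_mul _ (word_mat w)); rewrite /coxeter /coxeter_mat.
by do 5?[case: i => [|i] //]; rewrite /= !nth_nil.
Qed.

Definition parities : seq (seq bool) := Eval vm_compute in
  [seq parity (word_mat w) | w <- coxeter_words].

Lemma paritiesE : parities = [seq parity (word_elt w) | w <- coxeter_words].
Proof.
have -> : [seq parity (word_elt w) | w <- coxeter_words] = [seq parity (word_mat w) | w <- coxeter_words].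
  by apply: eq_map => w; rewrite word_eltE.
by vm_compute.
Qed.

Lemma uniq_parities : uniq parities. Proof. by vm_compute. Qed.

Lemma size_parities : size parities = 720%N. Proof. by vm_compute. Qed.

Definition all_bool (f : bool -> bool) := f true && f false.

Lemma all_boolP f : all_bool f -> forall b, f b.
Proof. by case/andP=> ? ? []. Qed.

(** The symplectic form modulo 2. *)
Definition bform (a b c d a' b' c' d' : bool) :=
  (c' && a) (+) (d' && b) (+) (a' && c) (+) (b' && d).

(** The predicate P holds for all symplectic matrices modulo 2, enumerated by
    columns in the order 0, 2, 1, 3; the relations are tested as early as
    possible to prune the search. *)
Definition all_symplectic_mod2 (P : seq bool -> bool) : bool :=
  all_bool (fun a0 => all_bool (fun b0 => all_bool (fun c0 => all_bool (fun d0 =>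
  all_bool (fun a2 => all_bool (fun b2 => all_bool (fun c2 => all_bool (fun d2 =>
  if ~~ bform a0 b0 c0 d0 a2 b2 c2 d2 then true else
  all_bool (fun a1 => all_bool (fun b1 => all_bool (fun c1 => all_bool (fun d1 =>
  if bform a1 b1 c1 d1 a2 b2 c2 d2 then true else
  if bform a1 b1 c1 d1 a0 b0 c0 d0 then true else
  all_bool (fun a3 => all_bool (fun b3 => all_bool (fun c3 => all_bool (fun d3 =>
  if bform a3 b3 c3 d3 a2 b2 c2 d2 then true else
  if bform a0 b0 c0 d0 a3 b3 c3 d3 then true else
  if ~~ bform a1 b1 c1 d1 a3 b3 c3 d3 then true else
  P [:: a0; a1; a2; a3; b0; b1; b2; b3; c0; c1; c2; c3; d0; d1; d2; d3])))))))))))))))).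

Lemma all_symplectic_mod2P P (g : Sp) : all_symplectic_mod2 P -> P (parity g).
Proof.
have /andP[/eqP + _] := sp_matP g.
case: (sp_mat g) => a0 a1 a2 a3 b0 b1 b2 b3 c0 c1 c2 c3 d0 d1 d2 d3.
rewrite /=; case=> e00 e01 _ e03 e10 e11 _ _ _ e21 _ _ _ _ _ _.
have oddE x y z w k : (x + y + z + w = k)%Z ->
    Z.odd x (+) Z.odd y (+) Z.odd z (+) Z.odd w = Z.odd k.
  by move=> <-; rewrite !Z.odd_add; case: (Z.odd x) (Z.odd y) (Z.odd z) (Z.odd w) => [] [] [] [].
move: {e00}(oddE _ _ _ _ _ e00) {e01}(oddE _ _ _ _ _ e01) {e03}(oddE _ _ _ _ _ e03).
move: {e10}(oddE _ _ _ _ _ e10) {e11}(oddE _ _ _ _ _ e11) {e21}(oddE _ _ _ _ _ e21).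
rewrite !Z.odd_mul !Z.odd_opp -!/(bform _ _ _ _ _ _ _ _) /parity /=.
move=> e10 e11 e21 e00 e01 e03.
move/all_boolP/(_ (Z.odd a0))/all_boolP/(_ (Z.odd b0))/all_boolP/(_ (Z.odd c0))/all_boolP/(_ (Z.odd d0)).
move/all_boolP/(_ (Z.odd a2))/all_boolP/(_ (Z.odd b2))/all_boolP/(_ (Z.odd c2))/all_boolP/(_ (Z.odd d2)).
rewrite e00 /=.
move/all_boolP/(_ (Z.odd a1))/all_boolP/(_ (Z.odd b1))/all_boolP/(_ (Z.odd c1))/all_boolP/(_ (Z.odd d1)).
rewrite e01 e21 /=.
move/all_boolP/(_ (Z.odd a3))/all_boolP/(_ (Z.odd b3))/all_boolP/(_ (Z.odd c3))/all_boolP/(_ (Z.odd d3)).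
by rewrite e03 e10 e11.
Qed.

Lemma parities_complete : all_symplectic_mod2 (fun s => s \in parities).
Proof. by vm_compute. Qed.

Lemma uniq_map_inj (T1 T2 : eqType) (f : T1 -> T2) (s : seq T1) :
  uniq (map f s) -> {in s &, injective f}.
Proof.
elim: s => //= x s IH /andP[fx us] a b; rewrite !inE.
move=> /orP[/eqP->|sa] /orP[/eqP->|sb] // E; last exact: IH.
  by case/negP: fx; rewrite E map_f.
by case/negP: fx; rewrite -E map_f.
Qed.

Lemma Gam2_transversal :
  exists2 s, transversal (fun _ => True) (Gam 2) s & size s = 720%N.
Proof.
exists (map word_elt coxeter_words); last by rewrite size_map -size_parities paritiesE size_map.
have U : uniq [seq parity (word_elt w) | w <- coxeter_words].
  by rewrite -paritiesE uniq_parities.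
have M := map_uniq (f := fun g : Sp => parity g).
split.
- by apply: M; rewrite -map_comp.
- by [].
- move=> g _; have := all_symplectic_mod2P g parities_complete.
  rewrite paritiesE => /mapP[w wW E]; exists (word_elt w); first exact: map_f.
  exact/parity_Gam2.
- move=> _ _ /mapP[v vW ->] /mapP[w wW ->] /parity_Gam2 E.
  by rewrite (uniq_map_inj U vW wW E).
Qed.

(** Powers of 2 are kept behind the variable p so that no large unary number is
    ever evaluated. *)
Lemma index_arith (p : nat -> nat) k n : (forall a b, p (a + b) = p a * p b)%N -> (0 < p 25)%N ->
  (p 4 * k * p 10 * p 10 * p 10 * p 10 = n * p 25)%N -> n = (p 19 * k)%N.
Proof.
move=> D p25; rewrite (mulnC (p 4)%N) -!mulnA -!D => E.
by apply/eqP; rewrite -(eqn_pmul2r p25) -E (mulnC (p 19)%N) -mulnA -D.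
Qed.

(** Lagrange's theorem through [Gam 32]: a transversal of M is combined with one
    of M modulo [Gam 32] and compared with a transversal obtained by layers. *)
Lemma Mon_index : exists2 s, size s = (2 ^ 19 * 3 ^ 2 * 5)%N & transversal (fun _ => True) Mon s.
Proof.
have sS : subgroup (fun _ => True) by [].
have sG N := Gam_sub N.
have [t1 T1 s1] := Gam2_transversal.
have {}s1 : size t1 = (2 ^ 4 * (3 ^ 2 * 5))%N by rewrite s1.
have step N t : (2 | N)%Z -> N <> 0%Z -> transversal (fun _ => True) (Gam N) t ->
    exists2 u, transversal (fun _ => True) (Gam (2 * N)) u & size u = (size t * 2 ^ 10)%N.
  case=> m -> m0 Tt; rewrite (Z.mul_comm m 2) in Tt m0 *.
  have [|u Tu su] := @layer_transversal m; first by lia.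
  exists [seq x * y | x <- t, y <- u]; last by rewrite size_allpairs su.
  apply: (transversal_mul sS (sG _) (sG _) _ _ Tt Tu) => // g.
  by apply: Gam_dvd; exact: Z.divide_factor_r.
have [t2 T2 s2] := step _ _ (Z.divide_refl 2) ltac:(done) T1.
have [t3 T3 s3] := step _ _ (Z.divide_factor_l 2 2) ltac:(done) T2.
have [t4 T4 s4] := step _ _ (Z.divide_factor_l 2 4) ltac:(done) T3.
have [t5 T5 s5] := step _ _ (Z.divide_factor_l 2 8) ltac:(done) T4.
have [u Tu su] := layered_transversal pc_approx pc_closed pc_echelon.
have Mu : transversal Mon (Gam 32) u.
  case: Tu => uu uG cov inj; split=> // [x /uG|g]; first by move/Mon_layered.
  by move/Mon_layered; exact: cov.
have [r Tr] := transversal_sub Mon_sub Gam32_Mon T5.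
exists r.
  have T := transversal_mul sS Mon_sub (sG 32%Z) (fun _ _ => I) Gam32_Mon Tr Mu.
  have E : size t5 = size [seq x * y | x <- r, y <- u].
    by apply/eqP; rewrite eqn_leq; apply/andP; split;
      exact: (@transversal_leq (fun _ => True) (Gam 32)).
  rewrite size_allpairs su s5 s4 s3 s2 s1 size_map in E.
  have p25 : (0 < 2 ^ 25)%N by rewrite expn_gt0.
  by rewrite -mulnA; exact: (index_arith (expnD 2) p25 E).
exact: Tr.
Qed.

Import GRing.Theory Num.Theory.
Local Open Scope classical_set_scope.
Local Open Scope ring_scope.

(** * Matrices over the ring of integers *)

Lemma sympl_formE (K : comNzRingType) (i j : 'I_4) : sympl_form K i j =
  if (j == i + 2 :> nat)%N then 1 else if (i == j + 2 :> nat)%N then -1 else 0.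
Proof.
rewrite /sympl_form mxE; case: splitP => i' Ei; rewrite mxE; case: splitP => j' Ej; rewrite !mxE Ei Ej;
  by case: i' j' {Ei Ej} => [[|[|//]] ?] [[|[|//]] ?]; rewrite /= ?oppr0.
Qed.

Definition to_mx (A : mat) : 'M[int]_4 :=
  \matrix_(i < 4, j < 4) int_of_Z (nth Z0 (mat_seq A) (4 * i + j)).

Definition of_mx (M : 'M[int]_4) : mat :=
  seq_mat [seq Z_of_int (M (inord (k %/ 4)) (inord (k %% 4))) | k <- iota 0 16].

Ltac ord4 i := case: i => [[|[|[|[|//]]]] ?].

Lemma of_mxK : cancel of_mx to_mx.
Proof.
move=> M; apply/matrixP => i j; rewrite mxE /of_mx.
have -> : nth Z0 (mat_seq (seq_mat [seq Z_of_int (M (inord (k %/ 4)) (inord (k %% 4))) | k <- iota 0 16])) (4 * i + j)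
    = Z_of_int (M (inord i) (inord j)).
  by ord4 i; ord4 j; reflexivity.
by rewrite Z_of_intK !inord_val.
Qed.

Lemma to_mx_inj : injective to_mx.
Proof.
move=> A B /matrixP E.
have {}E (i j : 'I_4) : nth Z0 (mat_seq A) (4 * i + j) = nth Z0 (mat_seq B) (4 * i + j).
  by have := E i j; rewrite !mxE => /(can_inj int_of_ZK).
pose o k : 'I_4 := inord k.
have {}E k l : (k < 4)%N -> (l < 4)%N -> nth Z0 (mat_seq A) (4 * k + l) = nth Z0 (mat_seq B) (4 * k + l).
  by move=> k4 l4; have := E (o k) (o l); rewrite /o !inordK.
have := (E 0 0 isT isT, E 0 1 isT isT, E 0 2 isT isT, E 0 3 isT isT,
  (E 1 0 isT isT, E 1 1 isT isT, E 1 2 isT isT, E 1 3 isT isT),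
  (E 2 0 isT isT, E 2 1 isT isT, E 2 2 isT isT, E 2 3 isT isT),
  (E 3 0 isT isT, E 3 1 isT isT, E 3 2 isT isT, E 3 3 isT isT))%N.
by case: A B {E} => ? ? ? ? ? ? ? ? ? ? ? ? ? ? ? ? [] ? ? ? ? ? ? ? ? ? ? ? ? ? ? ? ? /= [] [] [] [] [] [] -> -> -> -> [] [] [] -> -> -> -> [] [] [] -> -> -> -> [] [] [] -> -> -> ->.
Qed.

Lemma to_mxM A B : to_mx (mat_mul A B) = to_mx A *m to_mx B.
Proof.
apply/matrixP => i j; rewrite !mxE !big_ord_recr big_ord0 /= add0r !mxE -!rmorphM -!rmorphD.
by case: A B => ? ? ? ? ? ? ? ? ? ? ? ? ? ? ? ? [] ? ? ? ? ? ? ? ? ? ? ? ? ? ? ? ?; ord4 i; ord4 j.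
Qed.

Lemma to_mx1 : to_mx mat1 = 1%:M.
Proof. by apply/matrixP => i j; rewrite !mxE; ord4 i; ord4 j. Qed.

(** This makes the adjoint [mat_adj] a left inverse, hence an inverse. *)
Lemma sympl_form_sqr (K : comNzRingType) : sympl_form K *m sympl_form K = - 1%:M.
Proof.
apply/matrixP => i j; rewrite mxE !big_ord_recr big_ord0 /= !sympl_formE !mxE.
by ord4 i; ord4 j; rewrite /= ?mul0r ?mulr0 ?mul1r ?mulr1 ?addr0 ?add0r ?oppr0.
Qed.

Lemma to_mx_adj A : to_mx (mat_adj A) = - (sympl_form int *m (to_mx A)^T *m sympl_form int).
Proof.
apply/matrixP => i j.
rewrite mxE [RHS]mxE [X in - X]mxE !big_ord_recr big_ord0 /= ![(sympl_form int *m _) _ _]mxE.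
rewrite !big_ord_recr !big_ord0 /= !sympl_formE !mxE.
case: A => ? ? ? ? ? ? ? ? ? ? ? ? ? ? ? ?.
by ord4 i; ord4 j; rewrite /= ?mul0r ?mulr0 ?mul1r ?mulr1 ?addr0 ?add0r ?mulN1r ?mulrN1 ?opprK ?rmorphN.
Qed.

Lemma mulmx_adj (K : comNzRingType) (A : 'M[K]_4) :
  A^T *m sympl_form K *m A = sympl_form K ->
  (- (sympl_form K *m A^T *m sympl_form K)) *m A = 1%:M.
Proof. by move=> E; rewrite mulNmx -!mulmxA (mulmxA A^T) E sympl_form_sqr opprK. Qed.

Lemma to_mx_Sp4 (g : Sp) : Sp4 int (to_mx g).
Proof.
rewrite /Sp4 /=; have /andP[/eqP E _] := sp_matP g.
set O := sympl_form int.
have F : O *m (- (O *m (to_mx g)^T *m O) *m to_mx g) = O.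
  by rewrite -to_mx_adj -to_mxM E to_mx1 mulmx1.
by rewrite -[RHS]F mulNmx mulmxN !mulmxA sympl_form_sqr !mulNmx mul1mx opprK.
Qed.

(** Over a commutative ring, a left inverse of a square matrix is also a right
    inverse. *)
Lemma of_mx_Sp (M : 'M[int]_4) : Sp4 int M -> symplectic (of_mx M).
Proof.
rewrite /Sp4 /= => /mulmx_adj E.
have E' := mulmx1C E.
by apply/andP; split; apply/eqP; apply: to_mx_inj; rewrite to_mxM to_mx_adj of_mxK to_mx1.
Qed.

Lemma Sp4_Sp (M : 'M[int]_4) : Sp4 int M -> exists g : Sp, to_mx g = M.
Proof. by move=> sM; exists (MkSp (of_mx_Sp sM)); rewrite /= of_mxK. Qed.

Lemma to_mxMg (g h : Sp) : to_mx (g * h)%g = to_mx g *m to_mx h.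
Proof. exact: to_mxM. Qed.

Lemma to_mx1g : to_mx (1%g : Sp) = 1%:M. Proof. exact: to_mx1. Qed.

Lemma to_mxK (g : Sp) : to_mx g *m to_mx (g^-1)%g = 1%:M.
Proof. by rewrite -to_mxMg mulgV to_mx1g. Qed.

Lemma to_mx_unit (g : Sp) : to_mx g \in unitmx.
Proof. by have [] := mulmx1_unit (to_mxK g). Qed.

Lemma to_mxV (g : Sp) : invmx (to_mx g) = to_mx (g^-1)%g.
Proof. by rewrite -[LHS]mulmx1 -(to_mxK g) mulmxA mulVmx ?to_mx_unit // mul1mx. Qed.

Lemma Sp_eq_mx (g h : Sp) : to_mx g = to_mx h -> g = h.
Proof. by move/to_mx_inj/Sp_eq. Qed.

Ltac mx_gen := let i := fresh "i" in let j := fresh "j" in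
  apply/matrixP => i j; rewrite !mxE; ord4 i; ord4 j; reflexivity.

Lemma T_1E : T_1 = to_mx g1. Proof. by mx_gen. Qed.
Lemma T_ooE : T_oo = to_mx g2. Proof. by mx_gen. Qed.
Lemma T_m1E : T_m1 = to_mx g3. Proof. by mx_gen. Qed.
Lemma T_m2E : T_m2 = to_mx g4. Proof. by mx_gen. Qed.

Lemma Mon_image_subgroup : mx_subgroup [set to_mx g | g in [set g | Mon g]].
Proof.
split.
- by move=> _ [g _ <-]; exact: to_mx_unit.
- by exists 1%g; [exact: (sub1 Mon_sub) | exact: to_mx1g].
- move=> _ _ [g Mg <-] [h Mh <-]; exists (g * h)%g; [exact: (subM Mon_sub)|exact: to_mxMg].
- by move=> _ [g Mg <-]; exists (g^-1)%g; [exact: (subV Mon_sub)|rewrite to_mxV].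
Qed.

Lemma Mon250E : Mon250 = [set to_mx g | g in [set g | Mon g]].
Proof.
apply/seteqP; split=> [M|_ [g Mg <-]].
  apply; split; first exact: Mon_image_subgroup.
  move=> _ [[[->|->]|->]|->].
  - by exists g1; [exact: (letter_Mon 1%Z) | rewrite T_1E].
  - by exists g2; [exact: (letter_Mon 2%Z) | rewrite T_ooE].
  - by exists g3; [exact: (letter_Mon 3%Z) | rewrite T_m1E].
  - by exists g4; [exact: (letter_Mon 4%Z) | rewrite T_m2E].
move=> H [[uH H1 HM HV] sH]; elim: Mg => {g} [|g E|g h _ Hg _ Hh|g _ Hg].
- by rewrite to_mx1g.
- apply: sH; case: E => ->.
  + by do 3!left; rewrite T_1E.
  + by do 2!left; right; rewrite T_ooE.
  + by left; right; rewrite T_m1E.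
  + by right; rewrite T_m2E.
- by rewrite to_mxMg; exact: HM.
- by rewrite -to_mxV; exact: HV.
Qed.

Definition coset_of_Mon (g : Sp) : set 'M[int]_4 := [set to_mx g *m h | h in Mon250].

Lemma coset_of_Mon_eq (g h : Sp) : coset_of_Mon g = coset_of_Mon h <-> Mon (g^-1 * h)%g.
Proof.
rewrite /coset_of_Mon Mon250E; split=> [E|M].
  have : [set to_mx h *m k | k in [set to_mx g | g in [set g | Mon g]]] (to_mx h).
    exists 1%:M; last by rewrite mulmx1.
    by exists 1%g; [exact: (sub1 Mon_sub) | exact: to_mx1g].
  rewrite -E => -[_ [k Mk <-]]; rewrite -to_mxMg => /Sp_eq_mx <-.
  by rewrite mulKg.
apply/seteqP; split=> _ [_ [k Mk <-] <-].
  exists (to_mx ((g^-1 * h)^-1 * k)%g).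
    by exists ((g^-1 * h)^-1 * k)%g => //; apply: (subM Mon_sub) => //; exact: (subV Mon_sub).
  by rewrite -!to_mxMg invgM invgK !mulgA mulgV mul1g.
exists (to_mx (g^-1 * h * k)%g).
  by exists (g^-1 * h * k)%g => //; exact: (subM Mon_sub).
by rewrite -!to_mxMg !mulgA mulgV mul1g.
Qed.

Lemma transversal_index s : transversal (fun _ => True) Mon s ->
  mx_index (Sp4 int) Mon250 (size s).
Proof.
case=> us _ cov inj; rewrite /mx_index.
pose f n := coset_of_Mon (nth 1%g s n).
have fE : left_cosets (Sp4 int) Mon250 = f @` `I_(size s).
  apply/seteqP; split=> [_ [M /Sp4_Sp[g <-] <-]|_ [n ns <-]]; last first.
    by exists (to_mx (nth 1%g s n)); [exact: to_mx_Sp4 |].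
  have [x xs Mx] := cov g I; exists (index x s); first by rewrite /= index_mem.
  by rewrite /f nth_index //; apply/coset_of_Mon_eq.
rewrite fE; apply: inj_card_eq => i j; rewrite !inE /= => si sj.
move/coset_of_Mon_eq => /inj; rewrite !mem_nth // => /(_ isT isT)/eqP.
by rewrite nth_uniq // => /eqP.
Qed.

Lemma nat_of_binM (a b : N) : nat_of_bin (N.mul a b) = (nat_of_bin a * nat_of_bin b)%N.
Proof. lia. Qed.

(** The number in the statement is about 2 * 10^7: the conversion stays
    symbolic. *)
Lemma nat_of_bin_pow (b : N) e : nat_of_bin (N.pow b (N.of_nat e)) = (nat_of_bin b ^ e)%N.
Proof.
elim: e => [|e IH] //.
have -> : N.of_nat e.+1 = N.succ (N.of_nat e) by lia.
by rewrite N.pow_succ_r' nat_of_binM IH expnS.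
Qed.

Lemma index_bin : nat_of_bin 23592960%num = (2 ^ 19 * 3 ^ 2 * 5)%N.
Proof.
have -> : 23592960%num = N.mul (N.mul (N.pow 2 (N.of_nat 19)) (N.pow 3 (N.of_nat 2))) 5 by [].
by rewrite !nat_of_binM !nat_of_bin_pow.
Qed.

(** * Zariski density *)

(** The transvection power over an arbitrary commutative ring; rings of
    polynomials are needed below. *)
Definition Umx (L : comNzRingType) (w : 'cV[L]_4) (c : L) : 'M[L]_4 :=
  1%:M + c *: (w *m (w^T *m sympl_form L)).

Lemma map_sympl_form (L L' : comNzRingType) (f : {rmorphism L -> L'}) :
  map_mx f (sympl_form L) = sympl_form L'.
Proof.
by apply/matrixP => i j; rewrite mxE !sympl_formE; case: ifP => _; [exact: rmorph1 | case: ifP => _; [exact: rmorphN1 | exact: rmorph0]].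
Qed.

Lemma map_Umx (L L' : comNzRingType) (f : {rmorphism L -> L'}) w c :
  map_mx f (Umx w c) = Umx (map_mx f w) (f c).
Proof.
by rewrite /Umx map_mxD map_mx1 map_mxZ !map_mxM map_trmx map_sympl_form.
Qed.

Definition col4 (L : nzRingType) (a b c d : L) : 'cV[L]_4 := \col_(i < 4) nth 0 [:: a; b; c; d] i.

Section Density.
Variable K : numFieldType.
Implicit Types (S : set 'M[K]_4) (p : mpoly.mpoly (4 * 4) K) (A B U : 'M[K]_4).

Let peval p A := mpoly.meval (mxvec A ord0) p.

(** Composing a polynomial in the entries with left multiplication by U gives a
    polynomial in the entries. *)
Lemma closure_left S U :
  (forall p, (forall B, S B -> peval p B = 0) -> forall B, S B -> peval p (U *m B) = 0) ->
  forall A, zariski_closure S A -> zariski_closure S (U *m A).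
Proof.
move=> H A clA p pS.
pose L (k : 'I_(4 * 4)) : mpoly.mpoly (4 * 4) K :=
  \sum_(l < 4 * 4) lin_mulmx U l k *: mpoly.mpolyX K (mpoly.mnm1 l).
pose q := mpoly.mmap (@mpoly.mpolyC (4 * 4) K) L p.
have qE B : peval q B = peval p (U *m B).
  rewrite /peval /q /mpoly.mmap raddf_sum mpoly.mevalE; apply: eq_bigr => m _.
  rewrite /= mpoly.mevalM mpoly.mevalC; congr (_ * _).
  rewrite /mpoly.mmap1 rmorph_prod; apply: eq_bigr => k _; rewrite rmorphXn /=; congr (_ ^+ _).
  rewrite raddf_sum /= -[U *m B]/(mulmx U B) -mul_vec_lin mxE; apply: eq_bigr => l _.
  by rewrite mpoly.mevalZ mpoly.mevalXU mulrC.
by rewrite -/(peval p _) -qE; apply: clA => B SB; rewrite -/(peval q B) qE; exact: H.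
Qed.

Lemma poly_nat_roots (r : {poly K}) : (forall n : nat, r.[n%:R] = 0) -> r = 0.
Proof.
move=> H; apply/eqP; apply: contraT => r0.
have := max_poly_roots (rs := [seq n%:R | n <- iota 0 (size r)]) r0.
rewrite size_map size_iota ltnn; apply.
  by apply/allP => _ /mapP[n _ ->]; rewrite /root H.
by rewrite map_inj_uniq ?iota_uniq // => m n /eqP; rewrite eqr_nat => /eqP.
Qed.

(** Along a matrix with polynomial entries, p becomes a polynomial in one
    variable. *)
Lemma peval_path (F : 'M[{poly K}]_4) p :
  (forall n : nat, peval p (map_mx (horner_eval n%:R) F) = 0) ->
  forall t, peval p (map_mx (horner_eval t) F) = 0.
Proof.
pose r := mpoly.mmap polyC (fun k => mxvec F ord0 k) p.
have rE t : peval p (map_mx (horner_eval t) F) = r.[t].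
  rewrite /peval /r /mpoly.mmap horner_sum mpoly.mevalE; apply: eq_bigr => m _.
  rewrite hornerM hornerC; congr (_ * _).
  rewrite /mpoly.mmap1 horner_prod; apply: eq_bigr => k _; rewrite horner_exp; congr (_ ^+ _).
  by rewrite -map_mxvec mxE.
move=> H t; rewrite rE (poly_nat_roots (r := r)) ?horner0 // => n.
by rewrite -rE.
Qed.

Section Transvections.
Variable S : set 'M[K]_4.

(** Translation by the transvection keeps the ideal of polynomials vanishing on
    S; by [closure_left] the closure of S is then stable under it. *)
Definition preserves_vanishing w c := forall p, (forall B, S B -> peval p B = 0) ->
  forall B, S B -> peval p (Umx w c *m B) = 0.

Lemma preserves_path (W : 'cV[{poly K}]_4) (C : {poly K}) :
  (forall n : nat, preserves_vanishing (map_mx (horner_eval n%:R) W) C.[n%:R]) ->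
  forall t, preserves_vanishing (map_mx (horner_eval t) W) C.[t].
Proof.
move=> H t p pS B SB.
have E s : map_mx (horner_eval s) (Umx W C *m map_mx polyC B) = Umx (map_mx (horner_eval s) W) C.[s] *m B.
  rewrite map_mxM map_Umx; congr (_ *m _).
  by apply/matrixP => i j; rewrite 2!mxE; exact: hornerC.
by rewrite -E; apply: peval_path => n; rewrite E; exact: H.
Qed.

Let horner_col4 (a b c d : {poly K}) t :
  map_mx (horner_eval t) (col4 a b c d) = col4 a.[t] b.[t] c.[t] d.[t].
Proof. by apply/matrixP => i j; rewrite !mxE; ord4 i. Qed.

Variable N : K.
Hypothesis N0 : N != 0.
Hypothesis base : forall a b c d n : nat,
  preserves_vanishing (col4 a%:R b%:R c%:R d%:R) (N * n%:R).

(** One after the other, the exponent and the four coordinates are freed from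
    being natural numbers. *)
Lemma preserves_all w e : preserves_vanishing w e.
Proof.
have H1 (a b c d : nat) x : preserves_vanishing (col4 a%:R b%:R c%:R d%:R) x.
  have := @preserves_path (col4 a%:R%:P b%:R%:P c%:R%:P d%:R%:P) (N *: 'X) _ (N^-1 * x).
  rewrite horner_col4 !hornerC hornerZ hornerX mulVKf //; apply=> n.
  by rewrite horner_col4 !hornerC hornerZ hornerX; exact: base.
have H2 a (b c d : nat) x : preserves_vanishing (col4 a b%:R c%:R d%:R) x.
  have := @preserves_path (col4 'X b%:R%:P c%:R%:P d%:R%:P) x%:P _ a.
  rewrite horner_col4 !hornerC hornerX; apply=> n.
  by rewrite horner_col4 !hornerC hornerX; exact: H1.
have H3 a b (c d : nat) x : preserves_vanishing (col4 a b c%:R d%:R) x.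
  have := @preserves_path (col4 a%:P 'X c%:R%:P d%:R%:P) x%:P _ b.
  rewrite horner_col4 !hornerC hornerX; apply=> n.
  by rewrite horner_col4 !hornerC hornerX; exact: H2.
have H4 a b c (d : nat) x : preserves_vanishing (col4 a b c d%:R) x.
  have := @preserves_path (col4 a%:P b%:P 'X d%:R%:P) x%:P _ c.
  rewrite horner_col4 !hornerC hornerX; apply=> n.
  by rewrite horner_col4 !hornerC hornerX; exact: H3.
have H5 a b c d x : preserves_vanishing (col4 a b c d) x.
  have := @preserves_path (col4 a%:P b%:P c%:P 'X) x%:P _ d.
  rewrite horner_col4 !hornerC hornerX; apply=> n.
  by rewrite horner_col4 !hornerC hornerX; exact: H4.
have -> : w = col4 (w 0 0) (w 1 0) (w 2 0) (w 3 0); last exact: H5.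
by apply/matrixP => i j; rewrite mxE ord1; ord4 i => /=; congr (w _ _); exact: val_inj.
Qed.

End Transvections.
End Density.

(** * Transvections generate the symplectic group over a field *)

Section Generation.
Variable K : fieldType.
Implicit Types (x y z w f : 'cV[K]_4) (A B U : 'M[K]_4).

Definition sform x y : K := (x^T *m sympl_form K *m y) 0 0.
Let e (i : 'I_4) : 'cV[K]_4 := delta_mx i 0.

Lemma sformE x y : sform x y = x 0 0 * y 2 0 + x 1 0 * y 3 0 - x 2 0 * y 0 0 - x 3 0 * y 1 0.
Proof.
rewrite /sform mxE !big_ord_recr big_ord0 /= !mxE !big_ord_recr !big_ord0 /= !sympl_formE !mxE /=.
have -> : widen_ord (leqnSn 3) (widen_ord (leqnSn 2) (widen_ord (leqnSn 1) ord_max)) = 0 :> 'I_4 by exact: val_inj.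
have -> : widen_ord (leqnSn 3) (widen_ord (leqnSn 2) ord_max) = 1 :> 'I_4 by exact: val_inj.
have -> : widen_ord (leqnSn 3) ord_max = 2 :> 'I_4 by exact: val_inj.
have -> : ord_max = 3 :> 'I_4 by exact: val_inj.
rewrite !mulr0 !mulr1 !mulrN1 !addr0 !add0r !mulNr.
by rewrite -addrA [LHS]addrC addrA.
Qed.

Lemma sformDl x y z : sform (x + y) z = sform x z + sform y z.
Proof. by rewrite /sform linearD !mulmxDl mxE. Qed.

Lemma sformDr x y z : sform z (x + y) = sform z x + sform z y.
Proof. by rewrite /sform mulmxDr mxE. Qed.

Lemma sformZl c x y : sform (c *: x) y = c * sform x y.
Proof. by rewrite /sform linearZ -!scalemxAl mxE. Qed.

Lemma sformZr c x y : sform x (c *: y) = c * sform x y.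
Proof. by rewrite /sform -scalemxAr mxE. Qed.

Lemma sformC x y : sform x y = - sform y x.
Proof.
by rewrite !sformE !(mulrC (y _ _)) !opprB addrCA opprD !addrA.
Qed.

Lemma sformNl x y : sform (- x) y = - sform x y.
Proof. by rewrite -scaleN1r sformZl mulN1r. Qed.

Lemma sformxx x : sform x x = 0.
Proof. by rewrite sformE (mulrC (x 2 0)) (mulrC (x 3 0)) -addrA -opprD subrr. Qed.

Lemma Umx_mul w c x : Umx w c *m x = x + (c * sform w x) *: w.
Proof.
rewrite /Umx mulmxDl mul1mx -scalemxAl -scalerA -!mulmxA; congr (_ + _ *: _).
by rewrite [w^T *m _]mx11_scalar mul_mx_scalar /sform mulmxA.
Qed.

Lemma mx_ext A B : (forall x : 'cV_4, A *m x = B *m x) -> A = B.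
Proof. by move=> E; apply/matrixP => i j; have /colP/(_ i) := E (e j); rewrite -!colE !mxE. Qed.

Lemma Sp4P A : Sp4 K A <-> forall x y, sform (A *m x) (A *m y) = sform x y.
Proof.
rewrite /Sp4 /=; split=> [E x y|E].
  by rewrite /sform trmx_mul -!mulmxA (mulmxA A^T) (mulmxA _ A y) E.
have D (M : 'M[K]_4) i j : ((e i)^T *m M *m e j) 0 0 = M i j.
  by rewrite trmx_delta -rowE -colE !mxE.
apply/matrixP => i j; rewrite -!D -[RHS]/(sform _ _) -E.
by rewrite /sform trmx_mul !mulmxA.
Qed.

Lemma Umx_Sp4 w c : Sp4 K (Umx w c).
Proof.
apply/Sp4P => x y; rewrite !Umx_mul sformDl !sformDr !sformZl !sformZr sformxx !mulr0 addr0 -addrA.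
by rewrite -[RHS]addr0; congr (_ + _); rewrite (sformC x) mulrN mulrAC addrC subrr.
Qed.

Lemma UmxK w c : Umx w (- c) *m Umx w c = 1%:M.
Proof.
apply: mx_ext => x; rewrite -mulmxA mul1mx !Umx_mul sformDr sformZr sformxx mulr0 addr0.
by rewrite -addrA -scalerDl mulNr subrr scale0r addr0.
Qed.

Lemma Sp4M A B : Sp4 K A -> Sp4 K B -> Sp4 K (A *m B).
Proof. by move=> /Sp4P HA /Sp4P HB; apply/Sp4P => x y; rewrite -!mulmxA HA HB. Qed.

Section Closed.
Variable T : set 'M[K]_4.
Hypothesis T1 : T 1%:M.
Hypothesis TU : forall w c A, T A -> T (Umx w c *m A).

(** T contains A as soon as it contains U A, for symplectic U; such U allow the
    reduction of A to the identity. *)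
Definition reducing U := Sp4 K U /\ forall A, T (U *m A) -> T A.

Lemma reducing_Umx w c : reducing (Umx w c).
Proof.
split=> [|A /(TU w (- c))]; first exact: Umx_Sp4.
by rewrite mulmxA UmxK mul1mx.
Qed.

Lemma reducing_mul U V : reducing U -> reducing V -> reducing (U *m V).
Proof.
move=> [sU gU] [sV gV]; split=> [|A]; first exact: Sp4M.
by rewrite -mulmxA => /gU /gV.
Qed.

(** The transvection of y - x sends x to y for a suitable exponent, and fixes
    the vectors having the same product with x and y. *)
Lemma move1 x y : sform x y != 0 ->
  exists U, [/\ reducing U, U *m x = y & forall f, sform x f = sform y f -> U *m f = f].
Proof.
move=> xy0; exists (Umx (y - x) (- (sform x y)^-1)); split; first exact: reducing_Umx.
  rewrite Umx_mul sformDl sformNl sformxx subr0 (sformC y) mulrNN mulVf // scale1r.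
  by rewrite addrC subrK.
by move=> f E; rewrite Umx_mul sformDl sformNl E subrr mulr0 scale0r addr0.
Qed.

(** Two transvections, through z, when x and y are orthogonal. *)
Lemma move2 x z y : sform x z != 0 -> sform z y != 0 ->
  exists U, [/\ reducing U, U *m x = y
    & forall f, sform x f = sform z f -> sform z f = sform y f -> U *m f = f].
Proof.
move=> /move1[U [gU Ux fU]] /move1[V [gV Vz fV]].
exists (V *m U); split; first exact: reducing_mul.
  by rewrite -mulmxA Ux.
by move=> f E1 E2; rewrite -mulmxA fU // fV.
Qed.

Lemma sform_e y : (sform (e 0) y = y 2 0) * (sform (e 1) y = y 3 0) *
  (sform (e 2) y = - y 0 0) * (sform (e 3) y = - y 1 0).
Proof. by rewrite !sformE !mxE /= !mul0r !mul1r ?subr0 ?add0r ?addr0 ?sub0r. Qed.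

Lemma fix_basis A : A *m e 0 = e 0 -> A *m e 1 = e 1 -> A *m e 2 = e 2 -> A *m e 3 = e 3 -> A = 1%:M.
Proof.
move=> E0 E1 E2 E3; apply/matrixP => i j.
have /colP/(_ i) : A *m e j = e j.
  ord4 j; [move: E0 | move: E1 | move: E2 | move: E3]; congr (_ *m e _ = e _); exact: val_inj.
by rewrite -colE !mxE andbT.
Qed.

Lemma transvections_generate3 A : Sp4 K A -> A *m e 0 = e 0 -> A *m e 2 = e 2 -> A *m e 1 = e 1 -> T A.
Proof.
move=> /Sp4P sA A0 A2 A1; pose y := A *m e 3.
have y2 : y 2 0 = 0 by rewrite -sform_e -A0 sA sform_e mxE.
have y0 : y 0 0 = 0 by apply/eqP; rewrite -oppr_eq0 -sform_e -A2 sA sform_e mxE oppr0.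
have y3 : y 3 0 = 1 by rewrite -sform_e -A1 sA sform_e mxE.
have [_ ] := reducing_Umx (e 1) (- y 1 0); apply.
suff -> : Umx (e 1) (- y 1 0) *m A = 1%:M by [].
apply: fix_basis; rewrite -mulmxA ?A0 ?A1 ?A2 Umx_mul sform_e.
- by rewrite [e _ _ _]mxE mulr0 scale0r addr0.
- by rewrite [e _ _ _]mxE mulr0 scale0r addr0.
- by rewrite [e _ _ _]mxE mulr0 scale0r addr0.
rewrite -/y; move: (y) y0 y2 y3 => z z0 z2 z3; rewrite z3 mulr1; apply/colP => i; rewrite !mxE.
ord4 i => /=; rewrite ?mulr0 ?addr0 ?mulr1.
- by rewrite -[RHS]z0; congr (z _ _); exact: val_inj.
- apply/eqP; rewrite subr_eq0; apply/eqP; congr (z _ _); exact: val_inj.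
- by rewrite -[RHS]z2; congr (z _ _); exact: val_inj.
- by rewrite -[RHS]z3; congr (z _ _); exact: val_inj.
Qed.

Lemma transvections_generate2 A : Sp4 K A -> A *m e 0 = e 0 -> A *m e 2 = e 2 -> T A.
Proof.
move=> sA A0 A2; have /Sp4P sA' := sA; pose x := A *m e 1.
have x2 : x 2 0 = 0 by rewrite -sform_e -A0 sA' sform_e mxE.
have x0 : x 0 0 = 0 by apply/eqP; rewrite -oppr_eq0 -sform_e -A2 sA' sform_e mxE oppr0.
have ox0 : sform x (e 0) = 0 by rewrite sformC sform_e x2 oppr0.
have ox2 : sform x (e 2) = 0 by rewrite sformC sform_e x0 !oppr0.
suff [U [[sU gU] Ux U0 U2]] : exists U, [/\ reducing U, U *m x = e 1, U *m e 0 = e 0 & U *m e 2 = e 2].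
  apply: gU; apply: transvections_generate3; first exact: Sp4M.
  - by rewrite -mulmxA A0.
  - by rewrite -mulmxA A2.
  - by rewrite -mulmxA.
have [x3|x3] := eqVneq (x 3 0) 0; last first.
  have [|U [gU Ux fU]] := move1 (x := x) (y := e 1); first by rewrite sformC sform_e oppr_eq0.
  by exists U; split=> //; apply: fU; rewrite sform_e mxE.
have x1 : x 1 0 != 0.
  have := sA' (e 1) (e 3); rewrite -/x sform_e [RHS]mxE sformE x0 x2 x3 !mul0r add0r !subr0 => E.
  by apply: contra_eqN E => /eqP ->; rewrite mul0r eq_sym oner_eq0.
have [||U [gU Ux fU]] := move2 (x := x) (z := e 3) (y := e 1).
- by rewrite sformC sform_e opprK.
- by rewrite sform_e mxE oppr_eq0 oner_eq0.
by exists U; split=> //; apply: fU; rewrite ?ox0 ?ox2 !sform_e !mxE ?oppr0.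
Qed.

Lemma transvections_generate1 A : Sp4 K A -> A *m e 0 = e 0 -> T A.
Proof.
move=> sA A0; have /Sp4P sA' := sA; pose u := A *m e 2.
have u2 : u 2 0 = 1 by rewrite -sform_e -A0 sA' sform_e mxE.
have o0 : sform u (e 0) = -1 by rewrite sformC sform_e u2.
suff [U [[sU gU] Uu U0]] : exists U, [/\ reducing U, U *m u = e 2 & U *m e 0 = e 0].
  apply: gU; apply: transvections_generate2; first exact: Sp4M.
  - by rewrite -mulmxA A0.
  - by rewrite -mulmxA.
have [u0|u0] := eqVneq (u 0 0) 0; last first.
  have [|U [gU Uu fU]] := move1 (x := u) (y := e 2); first by rewrite sformC sform_e opprK.
  by exists U; split=> //; apply: fU; rewrite o0 sform_e mxE.
have [||U [gU Uu fU]] := move2 (x := u) (z := e 0 + u) (y := e 2).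
- by rewrite sformDr sformxx addr0 o0 oppr_eq0 oner_eq0.
- by rewrite sformDl sform_e mxE sformC sform_e u0 !oppr0 addr0 oner_eq0.
by exists U; split=> //; apply: fU; rewrite sformDl sformxx add0r ?sform_e ?mxE // o0.
Qed.

(** The columns of A are brought one by one to those of the identity, in the
    order 0, 2, 1, 3, each time by transvections that fix the previous ones. *)
Lemma transvections_generate A : Sp4 K A -> T A.
Proof.
move=> sA; have /Sp4P sA' := sA; pose x := A *m e 0.
suff [U [[sU gU] Ux]] : exists U, reducing U /\ U *m x = e 0.
  apply: gU; apply: transvections_generate1; first exact: Sp4M.
  by rewrite -mulmxA.
have via z : sform x z != 0 -> sform z (e 0) != 0 -> exists U, reducing U /\ U *m x = e 0.
  by move=> xz /(move2 xz)[U [gU Ux _]]; exists U.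
have [x2|x2] := eqVneq (x 2 0) 0; last first.
  have [|U [gU Ux _]] := move1 (x := x) (y := e 0); first by rewrite sformC sform_e oppr_eq0.
  by exists U.
have [x0|x0] := eqVneq (x 0 0) 0; last first.
  by apply: (via (e 2)); rewrite ?sform_e ?mxE ?oppr_eq0 ?oner_eq0 // sformC sform_e opprK.
have [x1|x1] := eqVneq (x 1 0) 0; last first.
  apply: (via (e 2 + e 3)); first by rewrite sformDr sformC sform_e (sformC x) sform_e x0 !opprK add0r.
  by rewrite sformDl !sform_e !mxE /= subr0 oppr_eq0 oner_eq0.
apply: (via (e 2 + e 1)).
  rewrite sformDr sformC sform_e (sformC x) sform_e x0 !oppr0 add0r oppr_eq0; apply/eqP => x3.
  have := sA' (e 0) (e 2); rewrite -/x sform_e mxE sformE x0 x1 x2 x3 !mul0r !subr0 addr0 => /eqP.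
  by rewrite eq_sym oner_eq0.
by rewrite sformDl !sform_e !mxE /= addr0 oppr_eq0 oner_eq0.
Qed.

End Closed.
End Generation.

(** * Density and index of the monodromy group *)

Lemma to_mx_tv a b c d n :
  to_mx (tv a b c d n) = Umx (col4 (int_of_Z a) (int_of_Z b) (int_of_Z c) (int_of_Z d)) (int_of_Z n).
Proof.
apply/matrixP => i j; rewrite !mxE !big_ord_recr !big_ord0 /= !mxE !big_ord_recr !big_ord0 /= !sympl_formE !mxE /=.
ord4 i; ord4 j; rewrite /=; lia.
Qed.

(** Stated for an abstract level, since the actual one is too large for unary
    computation. *)
Lemma EE_dense (K : numFieldType) (m : Z) : m <> 0%Z -> (forall g, EE m g -> Mon g) ->
  zariski_dense_Sp4 K Mon250.
Proof.
move=> m0 EM A; apply: transvections_generate => {A} [p pS|w c A].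
  apply: pS; exists 1%:M; last exact: map_mx1.
  by rewrite Mon250E; exists 1%g; [exact: (sub1 Mon_sub) | exact: to_mx1g].
apply: closure_left.
have N0 : (int_of_Z m)%:~R != 0 :> K.
  by rewrite intr_eq0; apply/eqP => E; apply: m0; rewrite -(int_of_ZK m) E.
apply: (preserves_all N0) => a b c' d n p pS B SB.
have [g Mg <-] : exists2 g : Sp, Mon g & map_mx intr (to_mx g) = B.
  by case: SB => M; rewrite {1}Mon250E => -[g Mg <-] <-; exists g.
pose Z := Z.of_nat; have ZE k : int_of_Z (Z k) = k%:Z by rewrite /Z; lia.
have -> : Umx (col4 a%:R b%:R c'%:R d%:R) ((int_of_Z m)%:~R * n%:R) =
    map_mx intr (to_mx (tv (Z a) (Z b) (Z c') (Z d) (m * Z n))) :> 'M[K]_4.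
  rewrite to_mx_tv map_Umx; congr Umx.
    by apply/colP => i; rewrite !mxE; ord4 i; rewrite /= ZE.
  have -> : int_of_Z (m * Z n) = int_of_Z m * n%:Z by rewrite rmorphM; congr (_ * _); exact: ZE.
  by rewrite rmorphM.
rewrite -map_mxM -to_mxMg; apply: pS; apply: imageP; rewrite Mon250E; apply: imageP.
apply: (subM Mon_sub) => //; apply: EM; apply: EE_tvM.
by exists (Z n); rewrite Z.mul_comm.
Qed.

Lemma Mon250_dense (K : numFieldType) : zariski_dense_Sp4 K Mon250.
Proof. by apply: (@EE_dense K (2 * 64 ^ 4)) => //; exact: EE_Mon. Qed.

Theorem theorem4 (R : realType) :
  [/\ arithmetic_Sp4Z R Mon250,
      mx_index (Sp4 int) Mon250 (nat_of_bin 23592960%num)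
    & nat_of_bin 23592960%num = (2 ^ 19 * 3 ^ 2 * 5)%N].
Proof.
have ind : mx_index (Sp4 int) Mon250 (nat_of_bin 23592960%num).
  by have [s sz tr] := Mon_index; rewrite index_bin -sz; exact: transversal_index.
split; [split | exact: ind | exact: index_bin].
- split=> [|M]; last by rewrite Mon250E => -[g _ <-]; exact: to_mx_Sp4.
  rewrite Mon250E; exact: Mon_image_subgroup.
- exists [set T_1; T_oo; T_m1; T_m2]; split=> //; exact: sub_gen_smallest.
- exact: Mon250_dense.
- by apply/finite_setP; exists (nat_of_bin 23592960%num).
Qed.
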